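(* Let $I\subset\mathbb{R}$ be a nondegenerate interval, let $D:I^2\to\mathbb{R}$ be a deviation and let $(\xi_n)_{n\in\mathbb{N}}$ be a sequence of independent and identically distributed (real) random variables. Assume that (i) $D$ is Borel measurable in the first variable; (ii) $\mathbb{P}(\xi_1\in I)=1$ and $\xi_1$ satisfies the interior point condition with respect to $D$; put $t_0:=\mathbb{M}^D(\xi_1)$; (iii') $D$ is differentiable in the second variable at $t_0$, and there exist $r>0$, $\alpha\in[0,\infty)$, a nonnegative Borel measurable function $H:I\to\mathbb{R}$ and a nonnegative function $h:(0,r)\to\mathbb{R}$ such that $(t_0-r,t_0+r)\subset I^D_{\xi_1}$, $$\left|\frac{D(x,t)-D(x,t_0)}{t-t_0}-\partial_2 D(x,t_0)\right|\leq H(x)\,h(|t-t_0|)\qquad\text{for all } x\in I,\ t\in(t_0-r,t_0+r),\ t\neq t_0,$$ and $$\limsup_{s\to0^+}\frac{h(s)}{s^\alpha}\ \begin{cases}=0&\text{if }\alpha=0,\\ <\infty&\text{if }\alpha>0,\end{cases}\qquad\text{and}\qquad \mathbb{E}(H(\xi_1)^q)<\infty,$$ where $q:=1$ if $\alpha=0$, and $q\in\big(\frac{2}{2+\alpha},1\big)$ if $\alpha>0$; (iv) $0<\mathbb{E}(D(\xi_1,t_0)^2)<\infty$ and $0<\mathbb{E}(-\partial_2D(\xi_1,t_0))<\infty$. Then, almost surely, $$\limsup_{n\to\infty}\frac{\mathscr{M}_n^{D}(\xi_1,\ldots,\xi_n)-t_0}{\sqrt{2n^{-1}\ln(\ln(n))}}=\frac{\sqrt{\mathbb{E}(D(\xi_1,t_0)^2)}}{\mathbb{E}(-\partial_2D(\xi_1,t_0))}$$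 and, almost surely, $$\liminf_{n\to\infty}\frac{\mathscr{M}_n^{D}(\xi_1,\ldots,\xi_n)-t_0}{\sqrt{2n^{-1}\ln(\ln(n))}}=-\frac{\sqrt{\mathbb{E}(D(\xi_1,t_0)^2)}}{\mathbb{E}(-\partial_2D(\xi_1,t_0))}.$$
   Context: All random variables are defined on a probability space $(\Omega,\mathcal{F},\mathbb{P})$. An interval is nondegenerate if it contains at least two distinct points. A function $D:I^2\to\mathbb{R}$ is a deviation if (a) for all $x\in I$, the function $I\ni t\mapsto D(x,t)$ is strictly decreasing and continuous, and (b) $D(t,t)=0$ for all $t\in I$. $D$ is Borel measurable in the first variable if, for all $t\in I$, the function $I\ni x\mapsto D(x,t)$ is Borel measurable. $D$ is differentiable in the second variable at $t_0$ if for every $x\in I$ the function $t\mapsto D(x,t)$ is differentiable at $t_0$; its derivative there is denoted $\partial_2D(x,t_0)$. For $n\in\mathbb{N}$ and $x_1,\dots,x_n\in I$, the deviation mean $\mathscr{M}_n^D(x_1,\dots,x_n)$ is the unique solution $t\in I$ of $\sum_{i=1}^n D(x_i,t)=0$ (it exists, is unique, and lies in $[\min_i x_i,\max_i x_i]$). Since $\mathbb{P}(\xi_i\in I,\ i\in\mathbb{N})=1$, $\mathscr{M}_n^D(\xi_1,\dots,\xi_n)$ is defined almost surely. For a random variable $\xi$ with $\mathbb{P}(\xi\in I)=1$ let $I_\xi^D:=\{t\in I : \mathbb{E}(|D(\xi,t)|)<\infty\}$, which is a (possibly degenerate) subinterval of $I$. If there exists $t_0\in I_\xi^D$ with $\mathbb{E}(D(\xi,t_0))=0$,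 then it is unique; it is called the $D$-deviation mean of $\xi$ and is denoted by $\mathbb{M}^D(\xi)$. If $\mathbb{M}^D(\xi)$ exists and belongs to the interior of $I_\xi^D$, then $\xi$ is said to satisfy the interior point condition with respect to $D$. *)

(* Defs.v *)
From HB Require Import structures.
From mathcomp Require Import all_boot all_order all_algebra.
From mathcomp Require Import finmap.
From mathcomp Require Import all_classical all_reals all_analysis.

Set Implicit Arguments.
Unset Strict Implicit.
Unset Printing Implicit Defensive.

Import Order.TTheory GRing.Theory Num.Theory.
Import numFieldNormedType.Exports.

Local Open Scope classical_set_scope.
Local Open Scope ring_scope.

Definition nondegenerate_interval (R : realType) (I : set R) : Prop :=
  is_interval I /\ exists x y : R, [/\ I x, I y & x != y].

(* A function on I (resp. on I * I) is represented by a total function of which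
   only the values on I (resp. on I * I) are ever used. *)

Definition deviation (R : realType) (I : set R) (D : R -> R -> R) : Prop :=
  [/\ forall x, I x -> forall s t, I s -> I t -> s < t -> D x t < D x s,
      forall x, I x -> {within I, continuous (D x)}
    & forall t, I t -> D t t = 0].

Definition measurable_in_first_variable (R : realType) (I : set R)
    (D : R -> R -> R) : Prop :=
  forall t, I t -> measurable_fun I (fun x : R => D x t).

(* The derivatives below are two-sided: they are only used at points in the
   interior of I, where they do not depend on the values off I. *)
Definition differentiable_in_second_variable (R : realType) (I : set R)
    (D : R -> R -> R) (t0 : R) : Prop :=
  forall x, I x -> derivable (D x) t0 1.

Definition partial2 (R : realType) (D : R -> R -> R) (x t0 : R) : R :=
  derive1 (D x) t0.

(* The equation determines t when n > 0 and every x i lies in I; otherwise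
   the value is irrelevant. *)
Definition sample_deviation_mean (R : realType) (I : set R) (D : R -> R -> R)
    (n : nat) (x : 'I_n -> R) : R :=
  get [set t | I t /\ \sum_(i < n) D (x i) t = 0].

Section RandomVariables.
Context d (T : measurableType d) (R : realType) (P : probability T R).

Definition independent_RVs (X : nat -> {RV P >-> R}) : Prop :=
  forall (J : {fset nat}) (A : nat -> set R),
    (forall i, i \in J -> measurable (A i)) ->
    P (\bigcap_(i in [set` J]) (X i @^-1` A i)) =
    (\prod_(i <- J) P (X i @^-1` A i))%E.

Definition identically_distributed (X : nat -> {RV P >-> R}) : Prop :=
  forall i j (A : set R), measurable A ->
    distribution P (X i) A = distribution P (X j) A.

(* E(f(X)) for f defined on I only and X almost surely in I: f is extended by 0
   outside I. *)
Definition expectation_on (I : set R) (X : T -> R) (f : R -> R) : \bar R :=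
  'E_P[(f \_ I) \o X]%E.

Definition deviation_domain (I : set R) (D : R -> R -> R) (X : T -> R) :
    set R :=
  [set t | I t /\ (expectation_on I X (fun x => `|D x t|%R) < +oo)%E].

Definition is_deviation_mean (I : set R) (D : R -> R -> R) (X : T -> R) :
    set R :=
  [set t | deviation_domain I D X t /\
           expectation_on I X (fun x => D x t) = 0%E].

Definition deviation_mean (I : set R) (D : R -> R -> R) (X : T -> R) : R :=
  get (is_deviation_mean I D X).

Definition interior_point_condition (I : set R) (D : R -> R -> R)
    (X : T -> R) : Prop :=
  (exists t, is_deviation_mean I D X t) /\
  interior (deviation_domain I D X) (deviation_mean I D X).

End RandomVariables.

(* Main.v *)
(* Near t0 the deviation function is linear up to a negligible error: with
   r_n = sqrt (2 ln (ln n) / n), hypothesis (iii') and the laws of large numbers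
   for H(xi) ^ q and for - d2 D(xi, t0) give, for every c <> 0, almost surely
     sum_(k < n) D(xi_k, t0 + c r_n)
       = sum_(k < n) D(xi_k, t0) - c m n r_n + o(n r_n),
   where m = E(- d2 D(xi, t0)); for alpha > 0 one bounds sum H(xi_k) by
   (sum H(xi_k) ^ q) ^ (1 / q) = O(n ^ (1 / q)), and q > 2 / (2 + alpha) says that
   r_n ^ alpha * n ^ (1 / q - 1) tends to 0.  The sample mean exceeds t0 + c r_n
   exactly when the left-hand side is positive, so the theorem follows from the
   Hartman-Wintner law of the iterated logarithm for D(xi_k, t0).

   For the latter, X_k is truncated at tau sqrt (2^j / ln (j + 4)), where 2^j is the
   dyadic scale of k.  The truncated variables have two-sided estimates of the
   moment generating function.  The upper bound then comes from Ville's maximal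
   inequality for products of independent variables and Borel-Cantelli along the
   points 2^a c with 2^p <= c <= 2^(p + 1), p fixed; the lower bound from an
   exponential change of measure on the independent blocks [2^(p j), 2^(p (j + 1))). *)

Require Import Defs.
From HB Require Import structures.
From mathcomp Require Import all_boot all_order all_algebra.
From mathcomp Require Import finmap.
From mathcomp Require Import all_classical all_reals all_analysis.
From mathcomp Require Import measurable_realfun lra ring zify.

Set Implicit Arguments.
Unset Strict Implicit.
Unset Printing Implicit Defensive.

Import Order.TTheory GRing.Theory Num.Theory.
Import numFieldNormedType.Exports.

Local Open Scope classical_set_scope.
Local Open Scope ring_scope.

(** * Independence and the maximal inequality *)

(** With only a second moment at hand, the truncation level has to meet two opposite demands. The
    exponential parameter suited to time N is of order sqrt (ln (ln N) / N), and its product with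
    the level must stay below a small constant, so that exp may be replaced by its quadratic
    expansion; this caps the level at a small multiple of sqrt (N / ln (ln N)). On the other hand
    the removed parts, divided by the normalisation sqrt (N ln (ln N)), must be summable in mean. At
    this level their sum is at most a constant times E X^2, because a block of 2^j indices, each
    weighted by the inverse normalisation, again weighs as much as the level. Kronecker's lemma then
    makes the removed parts and their means negligible, so the truncated variables are never
    recentred. The changed measure is not constructed as such: exponential moments at three
    parameters, theta and theta (1 +- del), do its work through an integral inequality over an
    arbitrary event of the past. That event also plays the part of a conditioning in the second
    Borel-Cantelli argument. *)

Lemma indep_integral d d1 d2 (T : measurableType d) (T1 : measurableType d1)
    (T2 : measurableType d2) (R : realType) (P : probability T R)
    (U : {mfun T >-> T1}) (V : {mfun T >-> T2})
    (f : T1 -> \bar R) (g : T2 -> \bar R) :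
  (forall A B, measurable A -> measurable B ->
     P (U @^-1` A `&` V @^-1` B) = (P (U @^-1` A) * P (V @^-1` B))%E) ->
  measurable_fun [set: T1] f -> (forall x, 0 <= f x)%E ->
  measurable_fun [set: T2] g -> (forall x, 0 <= g x)%E ->
  (\int[P]_w (f (U w) * g (V w)) =
   (\int[P]_w f (U w)) * (\int[P]_w g (V w)))%E.
Proof.
move=> hUV mf f0 mg g0.
pose UV (w : T) : T1 * T2 := (U w, V w).
have mUV : measurable_fun [set: T] UV by exact: measurable_fun_pair.
pose UVm := isMeasurableFun.Build _ _ _ _ UV mUV.
pose UVp : {mfun T >-> (T1 * T2)%type} := HB.pack UV UVm.
pose h (z : T1 * T2) := (f z.1 * g z.2)%E.
have mh : measurable_fun setT h.
  by apply: emeasurable_funM; exact: measurableT_comp.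
have h0 z : (0 <= h z)%E by exact: mule_ge0.
have -> : (\int[P]_w (f (U w) * g (V w)) =
           \int[distribution P UVp]_z h z)%E.
  by rewrite ge0_integral_distribution.
have -> : (\int[distribution P UVp]_z h z =
           \int[(distribution P U \x distribution P V)%E]_z h z)%E.
  apply: eq_measure_integral => A mA _.
  exact/esym/product_measure_unique.
rewrite fubini_tonelli1//.
under eq_integral => x _.
  rewrite /fubini_F /h/= ge0_integralZl//.
  rewrite ge0_integral_distribution//.
  over.
rewrite ge0_integralZr//; last by apply: integral_ge0 => w _; exact: g0.
by congr (_ * _)%E; rewrite ge0_integral_distribution.
Qed.

Section Independence.
Context d (T : measurableType d) (R : realType) (P : probability T R).
Variable X : nat -> {RV P >-> R}.

(** Only the cylinder sets of [X 0], ..., [X n.-1]: independence is known on these, and being a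
    pi-system they carry it to the generated sigma-algebra [<<s past n>>], the information available
    before time n. *)
Definition past (n : nat) : set (set T) :=
  [set E | exists A : nat -> set R, (forall i, measurable (A i)) /\
           E = \bigcap_(i in `I_n) X i @^-1` A i].

Lemma past_setI n : setI_closed (past n).
Proof.
move=> _ _ [A [mA ->]] [B [mB ->]]; exists (fun i => A i `&` B i); split.
  by move=> i; exact: measurableI.
by rewrite -bigcapI; apply: eq_bigcapr => i _.
Qed.

Lemma past_setT n : past n setT.
Proof.
exists (fun=> setT); split=> //.
by apply/esym/seteqP; split=> // w _ i _.
Qed.

Lemma past_measurable n : past n `<=` measurable.
Proof.
move=> _ [A [mA ->]]; apply: fin_bigcap_measurable => [|i _]; first exact: finite_II.
by rewrite -[X in measurable X]setTI; exact: measurable_funP.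
Qed.

Lemma sigma_past_measurable n : <<s past n>> `<=` measurable.
Proof.
apply: smallest_sub; last exact: past_measurable.
split; first exact: measurable0.
  by move=> A mA; apply: measurableD.
by move=> A mA; exact: bigcup_measurable.
Qed.

Lemma sigma_past_le m n : (m <= n)%N -> <<s past m>> `<=` <<s past n>>.
Proof.
move=> mn; apply: smallest_sub; first exact: smallest_sigma_algebra.
move=> _ [A [mA ->]]; apply: sub_sigma_algebra.
exists (fun i => if (i < m)%N then A i else setT); split.
  by move=> i; case: ifP.
apply/seteqP; split=> w /= h i ilt.
  by case: ifPn => // im; exact: h.
by have := h i (leq_trans ilt mn); rewrite ilt.
Qed.

Lemma past_preimage i n (A : set R) : (i < n)%N -> measurable A ->
  <<s past n>> (X i @^-1` A).
Proof.
move=> ilt mA; apply: sub_sigma_algebra.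
exists (fun j => if j == i then A else setT); split.
  by move=> j; case: ifP.
apply/seteqP; split=> w /=.
  by move=> wA j _; case: eqP => // ->.
by move=> /(_ i ilt); rewrite eqxx.
Qed.

Local Notation pastT n := (g_sigma_algebraType (past n)).

Lemma measurable_past_fun d' (T' : measurableType d') n (f : pastT n -> T') :
  measurable_fun setT f -> measurable_fun (setT : set T) (f : T -> T').
Proof.
by move=> mf _ B mB; apply: (@sigma_past_measurable n); exact: mf.
Qed.

Lemma measurable_past_le d' (T' : measurableType d') m n (f : T -> T') :
  (m <= n)%N -> measurable_fun (setT : set (pastT m)) f ->
  measurable_fun (setT : set (pastT n)) f.
Proof. by move=> mn mf _ B mB; apply: (sigma_past_le mn); exact: mf. Qed.

Lemma measurable_past_X i n : (i < n)%N ->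
  measurable_fun (setT : set (pastT n)) (X i).
Proof. by move=> ilt _ B mB; rewrite setTI; exact: past_preimage. Qed.

Hypothesis hindep : independent_RVs X.

(** For fixed [B] both sides are finite measures in [E]. They agree on the pi-system [past n] by
    independence, hence on the sigma-algebra it generates. *)
Lemma past_indep_set n (E : set T) (B : set R) :
  <<s past n>> E -> measurable B ->
  P (E `&` X n @^-1` B) = (P (X n @^-1` B) * P E)%E.
Proof.
move=> sE mB.
have mXB : measurable (X n @^-1` B).
  by rewrite -[X in measurable X]setTI; exact: measurable_funP.
have p0 : 0 <= fine (P (X n @^-1` B)) by rewrite fine_ge0.
pose m1 : {measure set T -> \bar R} := mrestr P mXB.
pose m2 : {measure set T -> \bar R} := mscale (NngNum p0) P.
have -> : P (E `&` X n @^-1` B) = m1 E by [].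
have -> : (P (X n @^-1` B) * P E)%E = m2 E.
  by rewrite /= /mscale /= fineK// fin_num_measure.
apply: (@g_sigma_algebra_measure_unique _ R T (past n) _ (fun=> setT) _ _ m1 m2) => //.
- by move=> A; exact: past_measurable.
- by move=> _; exact: past_setT.
- by rewrite bigcup_const.
- exact: past_setI.
- move=> _ [A [mA ->]]; rewrite /= /mrestr /mscale /= fineK ?fin_num_measure//.
  (* Independence is used for the index set {0, ..., n-1} and for the same set with n adjoined, [A']
     putting [B] at n; comparing the two products isolates the factor of [X n]. *)
  pose J := [fset x in iota 0 n]%fset.
  have JE k : (k \in J) = (k < n)%N by rewrite inE mem_iota.
  pose A' i := if i == n then B else A i.
  have mA' i : measurable (A' i) by rewrite /A'; case: ifP.
  have nJ : n \notin J by rewrite JE ltnn.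
  have := hindep (fun i (_ : i \in (n |` J)%fset) => mA' i).
  have /esym/= := hindep (fun i (_ : i \in J) => mA i).
  rewrite big_fsetU1// => /= PJ.
  rewrite {2}/A' eqxx.
  have -> : (\prod_(i <- J) P (X i @^-1` A' i) =
             \prod_(i <- J) P (X i @^-1` A i))%E.
    apply: eq_big_seq => i iJ; rewrite /A'; case: eqP => // in_.
    by move: nJ; rewrite -in_ iJ.
  rewrite {}PJ => PnJ.
  have -> : `I_n = [set` J] by apply/seteqP; split=> i /=; rewrite JE.
  rewrite -PnJ; congr (P _); apply/seteqP; split=> w /=.
    move=> [wJ wB] i /=; rewrite /A' !inE => /orP[/eqP->|]; first by rewrite eqxx.
    by case: eqP => [->//|_ iJ]; apply: wJ; rewrite /= !inE.
  move=> h; split; last first.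
    by have := h n; rewrite /= /A' eqxx; apply; rewrite !inE eqxx.
  move=> i /= iJ; have := h i; rewrite /= /A'; case: eqP => [ni|_].
    by move: nJ; rewrite -ni iJ.
  by apply; rewrite !inE in iJ *; rewrite iJ orbT.
- by move=> k; rewrite /= /mrestr setTI ltey_eq fin_num_measure.
Qed.

(** The identity, seen as a measurable map onto the same space with a smaller sigma-algebra: the
    whole past becomes one random element, to which [indep_integral] applies. *)
Definition inpast (n : nat) (w : T) : pastT n := w.

Lemma measurable_inpast n : measurable_fun setT (inpast n).
Proof. by move=> _ B mB; rewrite setTI; exact: (@sigma_past_measurable n). Qed.

HB.instance Definition _ n :=
  isMeasurableFun.Build _ _ _ _ (inpast n) (@measurable_inpast n).

Lemma past_indep_integral n (f : T -> \bar R) (g : R -> \bar R) :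
  measurable_fun (setT : set (pastT n)) f -> (forall w, 0 <= f w)%E ->
  measurable_fun setT g -> (forall x, 0 <= g x)%E ->
  (\int[P]_w (f w * g (X n w)) =
   (\int[P]_w f w) * (\int[P]_w g (X n w)))%E.
Proof.
move=> mf f0 mg g0.
apply: (@indep_integral _ _ _ _ _ _ _ P (inpast n) (X n)) => // A B mA mB.
by rewrite past_indep_set// muleC.
Qed.

End Independence.

Section MeasureBasics.
Context d (T : measurableType d) (R : realType).

Lemma measurable_superlevel (f : T -> R) (y : R) :
  measurable_fun setT f -> measurable [set w | y <= f w].
Proof.
move=> mf; rewrite -[X in measurable X]setTI.
by apply: measurable_fun_le => //; exact: measurable_cst.
Qed.

Lemma markov_ge0 (mu : {measure set T -> \bar R}) (f : T -> R) (y : R) :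
  measurable_fun setT f -> (forall w, 0 <= f w) -> 0 < y ->
  (mu [set w | (y <= f w)%R] <= y^-1%:E * \int[mu]_w (f w)%:E)%E.
Proof.
move=> mf f0 y0; pose A := [set w | y <= f w].
have mA : measurable A by exact: measurable_superlevel.
have yA : (y%:E * mu A <= \int[mu]_w (f w)%:E)%E.
  have <- : (\int[mu]_w (y * \1_A w)%:E = y%:E * mu A)%E.
    under eq_integral do rewrite EFinM.
    rewrite ge0_integralZl//=; last 2 first.
    - exact/measurable_EFinP/measurable_indic.
    - by rewrite lee_fin ltW.
    by rewrite integral_indic// setIT.
  apply: ge0_le_integral => //=.
  - by move=> w _; rewrite lee_fin mulr_ge0// ltW.
  - apply/measurable_EFinP; apply: measurable_funM => //.
  - exact/measurable_EFinP.
  - move=> w _; rewrite lee_fin indicE; have [|wA] := boolP (w \in A).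
      by rewrite inE mulr1.
    by rewrite mulr0.
rewrite -(@lee_pmul2l _ y%:E)// ?lte_fin// muleA -EFinM divff ?gt_eqF// mul1e.
exact: yA.
Qed.

Lemma borel_cantelli_ev (mu : {measure set T -> \bar R}) (F : nat -> set T)
    (c : nat -> R) (M : R) :
  (forall n, measurable (F n)) ->
  (forall n, mu (F n) <= (c n)%:E)%E ->
  (forall n, \sum_(0 <= i < n) c i <= M) ->
  {ae mu, forall w, \forall n \near \oo, ~ F n w}.
Proof.
move=> mF Fc cM.
have mL : measurable (lim_sup_set F).
  by apply: bigcap_measurable => // n _; apply: bigcup_measurable.
exists (lim_sup_set F); split=> //.
  apply: lim_sup_set_cvg0 => //.
  apply: (@le_lt_trans _ _ M%:E); last exact: ltry.
  apply: lime_le; first exact: is_cvg_nneseries.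
  apply: nearW => n; apply: (@le_trans _ _ (\sum_(0 <= i < n) (c i)%:E)%E).
    exact: lee_sum.
  by rewrite sumEFin lee_fin.
move=> w /= hw n _; apply: contrapT => nh; apply: hw.
exists n => // m /= nm Fm; apply: nh.
by exists m.
Qed.

End MeasureBasics.

(** * Ville's inequality for products of independent factors *)

Section MaximalInequality.
Context d (T : measurableType d) (R : realType) (P : probability T R).
Variable X : nat -> {RV P >-> R}.
Hypothesis hindep : independent_RVs X.

Lemma past_indep_fun n (f : T -> R) (g : R -> R) :
  measurable_fun (setT : set (g_sigma_algebraType (past X n))) f ->
  (forall w, 0 <= f w) ->
  measurable_fun setT g -> (forall x, 0 <= g x) ->
  (\int[P]_w (f w * g (X n w))%:E =
   (\int[P]_w (f w)%:E) * (\int[P]_w (g (X n w))%:E))%E.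
Proof.
move=> mf f0 mg g0.
under eq_integral do rewrite EFinM.
apply: (@past_indep_integral _ _ _ _ _ hindep n (EFin \o f) (EFin \o g)) => //.
- exact/measurable_EFinP.
- exact/measurable_EFinP.
Qed.

Variable f : nat -> R -> R.
Hypothesis mf : forall k, measurable_fun setT (f k).
Hypothesis f0 : forall k x, 0 <= f k x.

(** Induction on [m]: [g] and the earlier factors belong to the past of the last variable, so its
    factor splits off. *)
Lemma integral_prod_indep n m (g : T -> R) :
  measurable_fun (setT : set (g_sigma_algebraType (past X n))) g ->
  (forall w, 0 <= g w) -> (n <= m)%N ->
  (\int[P]_w (g w * \prod_(n <= i < m) f i (X i w))%:E =
   \int[P]_w (g w)%:E * \prod_(n <= i < m) \int[P]_w (f i (X i w))%:E)%E.
Proof.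
move=> mg g0; elim: m => [|m IH].
  rewrite leqn0 => /eqP ->; rewrite big_geq// mule1.
  by apply: eq_integral => w _; rewrite big_geq// mulr1.
rewrite leq_eqVlt ltnS => /predU1P[<-|nm].
  rewrite big_geq// mule1.
  by apply: eq_integral => w _; rewrite big_geq// mulr1.
rewrite big_nat_recr//= muleA -IH//.
rewrite -(@past_indep_fun m (fun w => g w * \prod_(n <= i < m) f i (X i w)) (f m))//.
- by apply: eq_integral => w _; rewrite big_nat_recr//= mulrA.
- apply: measurable_funM; first exact: (measurable_past_le nm).
  apply: measurable_prod => i; rewrite mem_index_iota => /andP[_ im].
  by apply: (measurableT_comp (mf i)); exact: measurable_past_X.
- by move=> w; rewrite mulr_ge0// prodr_ge0.
Qed.

Hypothesis f1 : forall k, (\int[P]_w (f k (X k w))%:E <= 1)%E.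

Variable y : R.
Hypothesis y0 : 0 < y.

(* The product process, frozen as soon as it exceeds y. *)
Let W := fix W (n : nat) (w : T) : R :=
  if n is m.+1 then W m w * (if y <= W m w then 1 else f m (X m w)) else 1.

Let W0 n w : 0 <= W n w.
Proof.
by elim: n => [|n IH] //=; rewrite mulr_ge0//; case: ifP.
Qed.

Let mW n : measurable_fun (setT : set (g_sigma_algebraType (past X n))) (W n).
Proof.
elim: n => [|n IH] /=; first exact: measurable_cst.
have IH' := measurable_past_le (leqnSn n) IH.
apply: measurable_funM => //; apply: measurable_fun_ifT => //.
  by apply: measurable_fun_ler => //; exact: measurable_cst.
by apply: (measurableT_comp (mf n)); exact: measurable_past_X.
Qed.

(** [W] is a nonnegative supermartingale. The event [A] that it is already frozen lies in the past,
    so the integral splits: on [A] nothing changes, and off [A] the new factor is independent of the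
    past and has integral at most 1. *)
Let W_le1 n : (\int[P]_w (W n w)%:E <= 1)%E.
Proof.
elim: n => [|n IH] /=.
  by rewrite integral_cst// mul1e probability_le1.
apply: le_trans IH.
pose A := [set w | y <= W n w].
have mA' : measurable (A : set (g_sigma_algebraType (past X n))).
  exact: measurable_superlevel.
pose a w := W n w * \1_A w; pose b w := W n w * \1_(~` A) w.
have ma : measurable_fun (setT : set (g_sigma_algebraType (past X n))) a.
  by apply: measurable_funM => //; exact: measurable_indic.
have mb : measurable_fun (setT : set (g_sigma_algebraType (past X n))) b.
  by apply: measurable_funM => //; apply: measurable_indic; exact: measurableC.
have a0 w : 0 <= a w by rewrite mulr_ge0.
have b0 w : 0 <= b w by rewrite mulr_ge0.
have mTa := measurable_past_fun ma.
have mTb := measurable_past_fun mb.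
have Wab w : W n w = a w + b w.
  rewrite /a /b -mulrDr !indicE in_setC; case: (w \in A) => /=;
  by rewrite ?(addr0, add0r) mulr1.
have -> : (\int[P]_w (W n w * (if y <= W n w then 1 else f n (X n w)))%:E =
    \int[P]_w ((a w)%:E + (b w * f n (X n w))%:E))%E.
  apply: eq_integral => w _; rewrite -EFinD; congr EFin.
  rewrite /a /b !indicE in_setC; case: ifPn => hy.
    have -> : w \in A by rewrite inE.
    by rewrite mulr0 mul0r addr0.
  have /negbTE -> : w \notin A by apply/negP; rewrite inE; exact/negP.
  by rewrite /= mulr0 mulr1 add0r.
under [leRHS]eq_integral => w _ do rewrite Wab EFinD.
have mfX : measurable_fun [set: T] (fun w => f n (X n w)).
  exact: (measurableT_comp (mf n)).
rewrite ge0_integralD//=; last 4 first.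
- by move=> w _; rewrite lee_fin.
- exact/measurable_EFinP.
- by move=> w _; rewrite lee_fin mulr_ge0.
- by apply/measurable_EFinP; exact: measurable_funM.
rewrite ge0_integralD//=; last 4 first.
- by move=> w _; rewrite lee_fin.
- exact/measurable_EFinP.
- by move=> w _; rewrite lee_fin.
- exact/measurable_EFinP.
rewrite leeD2l// past_indep_fun// -[leRHS]mule1 lee_pmul//.
  by apply: integral_ge0 => w _; rewrite lee_fin.
by apply: integral_ge0 => w _; rewrite lee_fin.
Qed.

(** Freezing turns a maximum into a terminal value: if some product up to N reaches [y], then [W N]
    is still at least [y], and Markov's inequality for [W N] suffices. *)
Lemma maximal_inequality N :
  (P [set w | exists2 k, (k <= N)%N & (y <= \prod_(0 <= i < k) f i (X i w))%R]
   <= y^-1%:E)%E.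
Proof.
have mWT n : measurable_fun [set: T] (W n) by exact: (measurable_past_fun (@mW n)).
have mS k : measurable_fun [set: T] (fun w => \prod_(0 <= i < k) f i (X i w)).
  by apply: measurable_prod => i _; exact: (measurableT_comp (mf i)).
have inv n w : (y <= W n w) \/ (W n w = \prod_(0 <= i < n) f i (X i w) /\
    forall k, (k <= n)%N -> \prod_(0 <= i < k) f i (X i w) < y).
  elim: n => [|n [IH|[IH1 IH2]]] /=.
  - case: (leP y 1) => y1; [by left|right; split; first by rewrite big_geq].
    by move=> k; rewrite leqn0 => /eqP->; rewrite big_geq.
  - by left; rewrite IH mulr1.
  - have -> : (y <= W n w) = false by rewrite IH1 leNgt IH2.
    rewrite IH1 -big_nat_recr//=; case: (leP y) => hy'; [by left|right; split=> //].
    by move=> k; rewrite leq_eqVlt ltnS => /predU1P[->//|]; exact: IH2.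
apply: (@le_trans _ _ (P [set w | y <= W N w])).
  apply: le_measure.
  - rewrite inE (_ : [set _ | _] = \bigcup_(k in `I_N.+1)
      [set w | y <= \prod_(0 <= i < k) f i (X i w)]).
      by apply: bigcup_measurable => k _; exact: measurable_superlevel.
    by apply/seteqP; split=> w [k kN h]; exists k.
  - by rewrite inE; exact: measurable_superlevel.
  - move=> w [k kN h] /=; case: (inv N w) => // -[_ /(_ _ kN)].
    by rewrite ltNge h.
apply: (le_trans (markov_ge0 _ _ (W0 N) y0)) => //.
rewrite -[leRHS]mule1; apply: lee_wpmul2l; last exact: W_le1.
by rewrite lee_fin invr_ge0 ltW.
Qed.

End MaximalInequality.

(** * Elementary estimates *)

Section RealAnalysis.
Context (R : realType).
Implicit Types x y z : R.

Lemma expR_le_inv1B z : z < 1 -> expR z <= (1 - z)^-1.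
Proof.
move=> z1; rewrite -[z in expR z]opprK expRN lef_pV2 ?posrE ?expR_gt0 ?subr_gt0//.
exact: expR_ge1Dx.
Qed.

Lemma expR_taylor1 z : `|z| <= 2^-1 -> 0 <= expR z - 1 - z <= 2 * z ^+ 2.
Proof.
rewrite ler_norml => /andP[z1 z2].
have := expR_ge1Dx z => h; apply/andP; split; first by lra.
have z1' : z < 1 by lra.
have := expR_le_inv1B z1' => h2.
have : (1 - z)^-1 <= 1 + z + 2 * z ^+ 2; last by lra.
rewrite -[leLHS]mulr1 mulrC ler_pdivrMr ?subr_gt0//.
by nra.
Qed.

(** The remainder has derivative exp y - 1 - y, which [expR_taylor1] bounds by 2 z^2 between 0 and
    z; the mean value theorem contributes the factor |z|. *)
Lemma expR_taylor2 z : `|z| <= 2^-1 ->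
  `|expR z - (1 + z + z ^+ 2 / 2)| <= 2 * `|z| * z ^+ 2.
Proof.
move=> hz.
pose f y := expR y - (1 + y + y ^+ 2 / 2).
have df y : is_derive y 1 f (expR y - 1 - y).
  by apply: is_derive_eq; rewrite /GRing.scale/= ; lra.
have cf a b : {within `[a, b], continuous f}.
  apply: derivable_within_continuous => x _; exact: (@ex_derive _ _ _ _ _ _ _ (df x)).
have f0 : f 0 = 0 by rewrite /f expR0 expr0n/= mul0r !addr0 subrr.
have bnd x : `|x| <= `|z| -> `|expR x - 1 - x| <= 2 * z ^+ 2.
  move=> xz; have /andP[h1 h2] := expR_taylor1 (le_trans xz hz).
  rewrite ger0_norm//; apply: (le_trans h2); rewrite ler_pM2l//.
  by rewrite -[x ^+ 2]real_normK ?num_real// -[z ^+ 2]real_normK ?num_real// lerXn2r ?nnegrE.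
have [z0|z0|z0] := ltgtP z 0.
- have [x xin] := MVT z0 (fun x _ => df x) (cf z 0).
  rewrite f0 sub0r sub0r => /eqP; rewrite eqr_oppLR => /eqP fz.
  rewrite -/(f z) fz normrN normrM normrN mulrAC.
  rewrite ler_wpM2r//; apply: bnd.
  by move: xin; rewrite in_itv/= => /andP[? ?]; rewrite !ltr0_norm// lerN2 ltW.
- have [x xin] := MVT z0 (fun x _ => df x) (cf 0 z).
  rewrite f0 !subr0 => fz; rewrite -/(f z) fz normrM mulrAC.
  rewrite ler_wpM2r//; apply: bnd.
  by move: xin; rewrite in_itv/= => /andP[? ?]; rewrite !gtr0_norm// ltW.
- by rewrite z0 -/(f 0) f0 normr0 mulr0 mul0r.
Qed.

Lemma expR_le_quad (eta z : R) : `|z| <= eta -> eta <= 2^-1 ->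
  expR z <= 1 + z + z ^+ 2 / 2 * (1 + 4 * eta).
Proof.
move=> h1 h2; have := expR_taylor2 (le_trans h1 h2).
rewrite ler_norml => /andP[_]; have : 2 * `|z| * z ^+ 2 <= 2 * eta * z ^+ 2.
  by rewrite ler_wpM2r ?sqr_ge0// ler_wpM2l.
lra.
Qed.

Lemma expR_ge_quad (eta z : R) : `|z| <= eta -> eta <= 2^-1 ->
  1 + z + z ^+ 2 / 2 * (1 - 4 * eta) <= expR z.
Proof.
move=> h1 h2; have := expR_taylor2 (le_trans h1 h2).
rewrite ler_norml => /andP[+ _]; have : 2 * `|z| * z ^+ 2 <= 2 * eta * z ^+ 2.
  by rewrite ler_wpM2r ?sqr_ge0// ler_wpM2l.
lra.
Qed.

(** A converse of 1 + p <= exp p for small p, with a separate error r: it turns lower bounds for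
    single moment generating functions into exponentials, so that their product becomes a sum of
    exponents. By exp y <= 1 / (1 - y) it reduces to the polynomial inequality 1 <= (1 + p - r) (1 -
    y). *)
Lemma ge_expR_sub (e p r : R) : 0 <= p -> 0 <= r -> p <= e -> r <= e ->
  e <= 2^-1 -> expR (p * (1 - e) - 2 * r) <= 1 + p - r.
Proof.
move=> p0 r0 pe re e2.
set y := p * (1 - e) - 2 * r.
have : expR y <= (1 - y)^-1 by apply: expR_le_inv1B; rewrite /y; nra.
move=> /le_trans; apply; rewrite -[leLHS]mul1r ler_pdivrMr; last by rewrite /y; nra.
rewrite /y.
have h1 : 0 <= p * (e - p) by rewrite mulr_ge0// subr_ge0.
have h2 : 0 <= p * (e - r) by rewrite mulr_ge0// subr_ge0.
have h3 : 0 <= r * (e - p) by rewrite mulr_ge0// subr_ge0.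
have h4 : 0 <= r * (e - r) by rewrite mulr_ge0// subr_ge0.
have h5 : 0 <= p * p * e by rewrite !mulr_ge0// (le_trans p0).
have h6 : 0 <= p * (2^-1 - e) by rewrite mulr_ge0// subr_ge0.
have h7 : 0 <= r * (2^-1 - e) by rewrite mulr_ge0// subr_ge0.
nra.
Qed.

(** The terms are (i + 4)^-(1 + del). They are dominated by [del^-1] times the decrements of [g n],
    that is of (n + 3)^-del, so the sum telescopes. *)
Lemma sum_expR_ln_bounded (del : R) : 0 < del ->
  exists M : R, forall n, \sum_(0 <= i < n) expR (- (1 + del) * ln i.+4%:R) <= M.
Proof.
move=> del0; pose g n : R := expR (- del * ln n.+3%:R).
have g0 n : 0 <= g n by exact: expR_ge0.
have key n : expR (- (1 + del) * ln n.+4%:R) <= del^-1 * (g n - g n.+1).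
  have n4 : 0 < n.+4%:R :> R by rewrite ltr0n.
  have n3 : 0 < n.+3%:R :> R by rewrite ltr0n.
  have -> : expR (- (1 + del) * ln n.+4%:R) = n.+4%:R^-1 * g n.+1.
    by rewrite mulNr mulrDl mul1r opprD expRD expRN lnK// /g mulNr.
  have : g n.+1 * (1 + del * n.+4%:R^-1) <= g n.
    rewrite /g; apply: (@le_trans _ _ (expR (- del * ln n.+4%:R) * expR (del * n.+4%:R^-1))).
      by rewrite ler_wpM2l ?expR_ge0// expR_ge1Dx.
    rewrite -expRD ler_expR.
    have : ln n.+3%:R <= ln n.+4%:R - n.+4%:R^-1 :> R.
      have -> : n.+3%:R = n.+4%:R * (1 - n.+4%:R^-1) :> R.
        by rewrite mulrBr divff ?gt_eqF// mulr1 -(natrB _ (isT : 1 <= n.+4)%N) subn1.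
      have h : 0 < 1 - n.+4%:R^-1 :> R by rewrite subr_gt0 invf_lt1// ltr1n.
      rewrite lnM ?posrE// lerD2l.
      by apply: le_ln1Dx; rewrite ltrNl opprK invf_lt1// ltr1n.
    move: (ln n.+3%:R) (ln n.+4%:R) (n.+4%:R^-1) => a b c.
    by move=> /(ler_wpM2l (ltW del0)); lra.
  rewrite ler_pdivlMl//; move: (g n) (g n.+1) (n.+4%:R^-1) => a b c; lra.
exists (del^-1 * g 0) => n.
apply: (@le_trans _ _ (del^-1 * (g 0 - g n))); last first.
  by rewrite ler_wpM2l ?invr_ge0 ?(ltW del0)// lerBlDr lerDl.
elim: n => [|n IH]; first by rewrite big_geq// subrr mulr0.
rewrite big_nat_recr//=; apply: (le_trans (lerD IH (key n))).
by rewrite -mulrDr ler_wpM2l ?invr_ge0 ?(ltW del0)// addrA subrK.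
Qed.

Lemma ln_le_harmonic n : ln n.+1%:R <= \sum_(0 <= i < n) (i.+1%:R^-1 : R).
Proof.
elim: n => [|n IH]; first by rewrite big_geq// ln1.
rewrite big_nat_recr//=.
have n0 : 0 < n.+1%:R :> R by rewrite ltr0n.
have -> : n.+2%:R = n.+1%:R * (1 + n.+1%:R^-1) :> R.
  by rewrite mulrDr mulr1 divff ?gt_eqF// natr1.
rewrite lnM ?posrE ?addr_gt0 ?invr_gt0//; apply: lerD => //.
by apply: le_ln1Dx; rewrite (lt_trans _ (_ : 0 < _)) ?invr_gt0 ?ltrN10.
Qed.

Lemma ln_natr_cvgy : (ln n%:R : R) @[n --> \oo] --> +oo.
Proof.
apply/cvgryPge => A.
near=> n.
rewrite -[A]expRK ler_ln ?posrE ?expR_gt0//; last first.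
  near: n; exists 1%N => // n /= n1; by rewrite ltr0n.
near: n; exact: nbhs_infty_ger.
Unshelve. all: by end_near. Qed.

(** Kronecker's lemma for nonnegative terms: past an index N the weighted tail is at most e / 2 and
    each [w i] is at most [w n], while the finitely many terms before N are beaten by [w n] tending
    to infinity. *)
Lemma kronecker_nonneg (a w : nat -> R) (M : R) :
  (forall n, 0 <= a n) -> (forall n, 0 < w n) ->
  (forall m n, (m <= n)%N -> w m <= w n) -> w n @[n --> \oo] --> +oo ->
  (forall n, \sum_(0 <= i < n) a i / w i <= M) ->
  forall e : R, 0 < e -> \forall n \near \oo, \sum_(0 <= i < n) a i <= e * w n.
Proof.
move=> a0 w0 wnd wy aM e e0.
pose s n := \sum_(0 <= i < n) a i / w i.
have snd : nondecreasing_seq s.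
  apply/nondecreasing_seqP => n; rewrite /s big_nat_recr//= lerDl.
  by rewrite divr_ge0// ltW.
have cs : cvgn s.
  apply: nondecreasing_is_cvgn => //; exists M => _ [n _ <-]; exact: aM.
have /cvgrPdist_le/(_ (e / 2))[|N _ hN] := cs; first by rewrite divr_gt0.
have sle n : s n <= limn s by exact: nondecreasing_cvgn_le.
pose C := \sum_(0 <= i < N) a i.
have hC : \forall n \near \oo, C * (2 / e) <= w n.
  by move/cvgryPge : wy; apply.
near=> n.
have nN : (N <= n)%N by near: n; exists N.
rewrite (big_cat_nat (n := N))//= -/C.
have hC' : C <= e / 2 * w n.
  have : C * (2 / e) <= w n by near: n.
  rewrite -(ler_pM2l (_ : 0 < e / 2)) ?divr_gt0//; apply: le_trans.
  by rewrite mulrCA mulf_div mulrC [2 * e]mulrC divff ?mulr1// ?mul1r// mulf_neq0// gt_eqF.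
have : \sum_(N <= i < n) a i <= e / 2 * w n.
  apply: (@le_trans _ _ (\sum_(N <= i < n) a i / w i * w n)).
    apply: ler_sum_nat => i /andP[_ im].
    rewrite -mulrA ler_peMr// mulrC ler_pdivlMr// mul1r; apply: wnd; exact: ltnW.
  rewrite -mulr_suml ler_wpM2r ?(ltW (w0 n))//.
  have hNN := hN N (leqnn _); rewrite ger0_norm ?subr_ge0// in hNN.
  have sn : s n = s N + \sum_(N <= i < n) a i / w i by rewrite /s (big_cat_nat (n := N)).
  rewrite -(lerD2l (s N)) -sn; apply: (le_trans (sle n)).
  by rewrite -lerBlDl.
lra.
Unshelve. all: by end_near. Qed.

End RealAnalysis.

(** * Dyadic scales *)

Notation lg := (trunc_log 2).

(* On the dyadic block 2^j <= n < 2^(j+1), ll j plays the role of ln (ln n),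
   and the function 2^j / ll j of j, unlike n / ln (ln n), grows geometrically
   from the start. *)
Definition ll (R : realType) (j : nat) : R := ln j.+4%:R.
(** Up to a constant factor [lower_scale] is the truncation level on block j and [upper_scale] the
    size of the partial sums there. Their product is 2^j, the length of the block. *)
Definition lower_scale (R : realType) (j : nat) : R := Num.sqrt (2 ^+ j / ll R j).
Definition upper_scale (R : realType) (j : nat) : R := Num.sqrt (2 ^+ j * ll R j).

Section DyadicScales.
Context (R : realType).
Local Notation ll := (ll R).
Local Notation u := (lower_scale R).
Local Notation w := (upper_scale R).

(** With this, the shift by 4 in [ll] makes it at least 1 from j = 0 on. *)
Lemma expR1_le4 : expR 1 <= 4 :> R.
Proof.
have -> : 1 = 2^-1 + 2^-1 :> R by lra.
rewrite expRD; have : expR 2^-1 <= (1 - 2^-1)^-1 :> R.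
  by apply: expR_le_inv1B; lra.
have -> : (1 - 2^-1)^-1 = 2 :> R by rewrite [X in X^-1](_ : _ = 2^-1) ?invrK//; lra.
by have := expR_ge0 (2^-1 : R); nra.
Qed.

Lemma ll_ge1 j : 1 <= ll j.
Proof.
rewrite /ll -[leLHS]expRK ler_ln ?posrE ?expR_gt0 ?ltr0n//.
by apply: (le_trans expR1_le4); rewrite ler_nat.
Qed.

Lemma ll_gt0 j : 0 < ll j.
Proof. exact: lt_le_trans (ll_ge1 j). Qed.

Lemma le_ll i j : (i <= j)%N -> ll i <= ll j.
Proof. by move=> ij; rewrite /ll ler_ln ?posrE ?ltr0n// ler_nat !ltnS. Qed.

Lemma llS j : ll j.+1 <= ll j + j.+4%:R^-1.
Proof.
have j0 : 0 < j.+4%:R :> R by rewrite ltr0n.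
rewrite /ll; have -> : j.+1.+4%:R = j.+4%:R * (1 + j.+4%:R^-1) :> R.
  by rewrite mulrDr mulr1 divff ?gt_eqF// natr1.
rewrite lnM ?posrE ?addr_gt0 ?invr_gt0// lerD2l.
by apply: le_ln1Dx; rewrite (lt_trans _ (_ : 0 < _)) ?invr_gt0 ?ltrN10.
Qed.

Lemma llS_le j : ll j.+1 <= 5 / 4 * ll j.
Proof.
apply: (le_trans (llS j)); have := ll_ge1 j.
have : j.+4%:R^-1 <= 4^-1 :> R by rewrite lef_pV2 ?posrE ?ltr0n// ler_nat.
by move: (j.+4%:R^-1 : R) (ll j) => a b; lra.
Qed.

Lemma ll_cvgy : ll j @[j --> \oo] --> +oo.
Proof. by have := @ln_natr_cvgy R; rewrite -(cvg_shiftn 4); under eq_fun do rewrite addn4. Qed.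

Lemma lower_scale_gt0 j : 0 < u j.
Proof. by rewrite sqrtr_gt0 divr_gt0 ?exprn_gt0 ?ll_gt0. Qed.

Lemma upper_scale_gt0 j : 0 < w j.
Proof. by rewrite sqrtr_gt0 mulr_gt0 ?exprn_gt0 ?ll_gt0. Qed.

Lemma upper_lower_scale j : 2 ^+ j / w j = u j.
Proof.
have w0 := upper_scale_gt0 j.
apply: (mulIf (lt0r_neq0 w0)); rewrite divfK ?gt_eqF//.
rewrite /u /w -sqrtrM ?divr_ge0 ?exprn_ge0 ?(ltW (ll_gt0 j))//.
rewrite mulrACA mulVf ?gt_eqF ?ll_gt0// mulr1 -expr2 sqrtr_sqr.
by rewrite ger0_norm// exprn_ge0.
Qed.

(** The squared ratio is 2 ll j / ll j.+1, at least 8 / 5 by [llS_le], and 8 / 5 exceeds (5 / 4)^2.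
    Growth by a fixed factor from j = 0 on bounds a sum of these scales by 5 times its last term. *)
Lemma lower_scaleS j : u j <= 4 / 5 * u j.+1.
Proof.
rewrite -(@ler_pXn2r _ 2)// ?nnegrE ?mulr_ge0 ?(ltW (lower_scale_gt0 _))//.
rewrite exprMn /u !sqr_sqrtr ?divr_ge0 ?exprn_ge0 ?(ltW (ll_gt0 _))//.
have l0 := ll_gt0 j; have l1 := ll_gt0 j.+1; have lS := llS_le j.
have e0 : 0 < 2 ^+ j :> R by rewrite exprn_gt0.
rewrite (exprS _ j) ler_pdivrMr//.
move: e0 l0 l1 lS; move: (2 ^+ j) (ll j) (ll j.+1) => a b c a0 b0 c0 cb.
have -> : (4 / 5) ^+ 2 * (2 * a / c) * b = (32 / 25 * a * b) / c by field; lra.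
by rewrite ler_pdivlMr//; nra.
Qed.

Lemma le_lower_scale i j : (i <= j)%N -> u i <= u j.
Proof.
move=> ij; rewrite -(subnKC ij); elim: (j - i)%N => [|n IH]; first by rewrite addn0.
rewrite addnS; apply: (le_trans IH); have := lower_scaleS (i + n).
by have := lower_scale_gt0 (i + n).+1; lra.
Qed.

Lemma le_upper_scale i j : (i <= j)%N -> w i <= w j.
Proof.
move=> ij; apply: ler_wsqrtr; rewrite ler_pM ?exprn_ge0 ?(ltW (ll_gt0 _))// ?le_ll//.
by rewrite ler_weXn2l// ler1n.
Qed.

Lemma lg_cvgy : lg n @[n --> \oo] --> \oo.
Proof.
move=> A [N _ hN]; exists (2 ^ N)%N => // n /= hn; apply: hN => /=.
exact: trunc_log_max.
Qed.

Lemma geometric_cvgy (z : R) : 1 < z -> z ^+ n @[n --> \oo] --> +oo.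
Proof.
move=> z1; have bern n : 1 + n%:R * (z - 1) <= z ^+ n.
  elim: n => [|n IH]; first by rewrite mul0r addr0.
  rewrite exprS -natr1; apply: (@le_trans _ _ (z * (1 + n%:R * (z - 1)))).
    have : 0 <= n%:R * (z - 1) ^+ 2 by rewrite mulr_ge0// sqr_ge0.
    by move: (n%:R : R) => m; nra.
  by rewrite ler_pM2l// (lt_trans _ z1).
apply/cvgryPge => A; near=> n; apply: le_trans (bern n).
have : (z - 1)^-1 * A <= n%:R by near: n; exact: nbhs_infty_ger.
by rewrite mulrC ler_pdivrMr ?subr_gt0//; lra.
Unshelve. all: by end_near. Qed.

Lemma exp2_cvgy : (2 ^+ j : R) @[j --> \oo] --> +oo.
Proof. by apply: geometric_cvgy; rewrite ltr1n. Qed.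

Lemma upper_scale_cvgy : w j @[j --> \oo] --> +oo.
Proof.
apply/cvgryPge => A; near=> j.
apply: (@le_trans _ _ `|A|); first exact: ler_norm.
rewrite -[leLHS]ger0_norm// -sqrtr_sqr; apply: ler_wsqrtr.
apply: (@le_trans _ _ (2 ^+ j)); last by rewrite ler_peMr ?exprn_ge0// ll_ge1.
by near: j; move/cvgryPge : exp2_cvgy; apply.
Unshelve. all: by end_near. Qed.

Lemma lower_scale_ge j : (5 / 4) ^+ j * u 0 <= u j.
Proof.
elim: j => [|j IH]; first by rewrite mul1r.
by rewrite exprS -mulrA; have := lower_scaleS j; move: IH; lra.
Qed.

Lemma lower_scale_cvgy : u j @[j --> \oo] --> +oo.
Proof.
have h : ((5 / 4 : R) ^+ j) @[j --> \oo] --> +oo by apply: geometric_cvgy; lra.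
apply/cvgryPge => A; near=> j.
apply: le_trans (lower_scale_ge j); rewrite -ler_pdivrMr ?lower_scale_gt0//.
by near: j; move/cvgryPge : h; apply.
Unshelve. all: by end_near. Qed.

(** Block j holds 2^j indices, each contributing 1 / w j, hence u j in total. Only blocks with tau *
    u j < y count, and by geometric growth their sum is at most 5 times the last, thus at most 5 y /
    tau. With y = |X| and a further factor |X| the right-hand side becomes a multiple of X^2. *)
Lemma sum_truncated_blocks (tau y : R) (n : nat) : 0 < tau -> 0 <= y ->
  \sum_(0 <= k < n) ((tau * u (lg k) < y)%R%:R / w (lg k)) <= 6 * (y / tau).
Proof.
move=> tau0 y0; pose f j : R := (tau * u j < y)%R%:R / w j.
have f0 j : 0 <= f j by rewrite divr_ge0 ?ler0n ?(ltW (upper_scale_gt0 _)).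
have Y0 : 0 <= y / tau by rewrite divr_ge0// ltW.
have uY j : tau * u j < y -> u j <= y / tau.
  by move=> /ltW; rewrite ler_pdivlMr// mulrC.
have su J : \sum_(0 <= j < J.+1) u j <= 5 * u J.
  elim: J => [|J IH].
    by rewrite big_nat1; have := lower_scale_gt0 0; lra.
  by rewrite big_nat_recr//=; have := lower_scaleS J; move: IH; lra.
pose g j : R := (tau * u j < y)%R%:R * u j.
have sg J : \sum_(0 <= j < J) g j <= 5 * (y / tau).
  elim: J => [|J IH]; first by rewrite big_geq// mulr_ge0.
  have [h|h] := boolP (tau * u J < y).
    apply: (@le_trans _ _ (\sum_(0 <= j < J.+1) u j)).
      apply: ler_sum => j _; rewrite /g ler_piMl ?(ltW (lower_scale_gt0 _))//.
      by case: (tau * _ < _).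
    by apply: (le_trans (su J)); rewrite ler_pM2l// uY.
  by rewrite big_nat_recr//= /g (negbTE h) mul0r addr0.
(* Index 0 is counted in addition to the block {1} of exponent 0, since [lg 0] is 0; this produces
   [f 0] and turns the 5 into 6. *)
have sf J : \sum_(0 <= k < 2 ^ J) f (lg k) = f 0 + \sum_(0 <= j < J) g j.
  elim: J => [|J IH]; first by rewrite expn0 big_nat1 big_geq// addr0.
  have h2 : (2 ^ J <= 2 ^ J.+1)%N by rewrite leq_exp2l.
  rewrite (big_cat_nat (n := 2 ^ J))//= IH big_nat_recr//= addrA; congr (_ + _).
  rewrite (@eq_big_nat _ _ _ _ _ _ (fun=> f J)); last first.
    by move=> k hk; congr f; exact: trunc_log_eq.
  rewrite sumr_const_nat expnS mul2n -addnn addnK.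
  by rewrite -mulr_natr /f /g natrX -mulrA [_^-1 * _]mulrC upper_lower_scale.
apply: (@le_trans _ _ (\sum_(0 <= k < 2 ^ n) f (lg k))).
  rewrite [leRHS](big_cat_nat (n := n))//=; last by rewrite ltnW// ltn_expl.
  by rewrite lerDl sumr_ge0.
rewrite sf; have : f 0 <= y / tau.
  rewrite /f; case: ltP => h; last by rewrite mul0r.
  by apply: le_trans (uY _ h); rewrite -upper_lower_scale expr0.
by have := sg n; lra.
Qed.

Lemma upper_scale_le n : (0 < n)%N -> w (lg n) <= Num.sqrt (n%:R * ll (lg n)).
Proof.
move=> n0; apply: ler_wsqrtr; rewrite ler_wpM2r ?(ltW (ll_gt0 _))//.
by rewrite -natrX ler_nat trunc_logP.
Qed.

Lemma ll_lg_small (e : R) : 0 < e -> \forall n \near \oo, ll (lg n) <= e * n%:R.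
Proof.
move=> e0.
have h : \forall j \near \oo, e^-1 <= u j ^+ 2.
  move/cvgryPge : lower_scale_cvgy => /(_ (1 + e^-1)); apply: filterS => j hj.
  by have : 0 < e^-1 by [rewrite invr_gt0]; nra.
near=> n.
have n0 : (0 < n)%N by near: n; exists 1%N.
have : e^-1 <= u (lg n) ^+ 2 by near: n; exact: (lg_cvgy h).
rewrite sqr_sqrtr ?divr_ge0 ?exprn_ge0 ?(ltW (ll_gt0 _))//.
rewrite ler_pdivlMr ?ll_gt0// ler_pdivrMl// => /le_trans; apply.
by rewrite ler_pM2l// -natrX ler_nat trunc_logP.
Unshelve. all: by end_near. Qed.

End DyadicScales.

(** * Truncation and moment generating functions *)

Section SeriesOfIntegrals.
Context d (T : measurableType d) (R : realType) (P : probability T R).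

Lemma bounded_integrable (f : T -> R) (C : R) :
  measurable_fun setT f -> (forall w, `|f w| <= C) ->
  P.-integrable setT (EFin \o f).
Proof.
move=> mf fC; apply: (@le_integrable _ _ _ P setT measurableT _ (EFin \o cst C)).
- exact/measurable_EFinP.
- by move=> w _ /=; rewrite lee_fin (le_trans (fC w))// ler_norm.
- by apply: finite_measure_integrable_cst.
Qed.

Lemma integrable_EFinZ (c : R) (f : T -> R) : P.-integrable setT (EFin \o f) ->
  P.-integrable setT (EFin \o (fun w => c * f w)).
Proof. by move=> fi; exact: (integrableZl measurableT c fi). Qed.

Lemma integrable_EFinD (f g : T -> R) : P.-integrable setT (EFin \o f) ->
  P.-integrable setT (EFin \o g) ->
  P.-integrable setT (EFin \o (fun w => f w + g w)).
Proof. by move=> fi gi; exact: (integrableD measurableT fi gi). Qed.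

Lemma integrable_EFinB (f g : T -> R) : P.-integrable setT (EFin \o f) ->
  P.-integrable setT (EFin \o g) ->
  P.-integrable setT (EFin \o (fun w => f w - g w)).
Proof. by move=> fi gi; exact: (integrableB measurableT fi gi). Qed.

Lemma integrable_EFin_cst (c : R) : P.-integrable setT (EFin \o (fun=> c)).
Proof. exact: finite_measure_integrable_cst. Qed.

Lemma Rintegral_probability_cst (c : R) : \int[P]_(w in setT) c = c.
Proof.
rewrite Rintegral_cst// -[RHS]mulr1; congr (_ * _).
by rewrite -[RHS]/(fine 1%E); congr fine; exact: probability_setT.
Qed.

Lemma EFin_Rintegral (f : T -> R) : P.-integrable setT (EFin \o f) ->
  ((\int[P]_w f w)%R%:E = \int[P]_w (f w)%:E)%E.
Proof. by move=> fi; rewrite fineK// integrable_fin_num. Qed.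

Lemma ae_bounded_series (f : nat -> T -> R) (M : R) :
  (forall k, measurable_fun setT (f k)) -> (forall k w, 0 <= f k w) ->
  (forall n, \sum_(0 <= k < n) \int[P]_w (f k w)%:E <= M%:E)%E ->
  {ae P, forall w, exists C : R, forall n, \sum_(0 <= k < n) f k w <= C}.
Proof.
move=> mf f0 fM.
pose F w := (\sum_(k <oo) (f k w)%:E)%E.
have mF : measurable_fun setT F.
  apply: ge0_emeasurable_sum => k; first by move=> w _ _; rewrite lee_fin.
  by move=> _; exact/measurable_EFinP.
have F0 w : (0 <= F w)%E by apply: nneseries_ge0 => k _ _; rewrite lee_fin.
have iF : P.-integrable setT F.
  apply/integrableP; split=> //.
  under eq_integral do rewrite gee0_abs//.
  rewrite integral_nneseries//; last 2 first.
  - by move=> k; exact/measurable_EFinP.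
  - by move=> k w _; rewrite lee_fin.
  apply: (@le_lt_trans _ _ M%:E); last exact: ltry.
  apply: lime_le; last by apply: nearW => n; exact: fM.
  by apply: is_cvg_nneseries => k _ _; apply: integral_ge0 => w _; rewrite lee_fin.
have := integrable_ae measurableT iF; apply: filterS => w /(_ I) Ffin.
exists (fine (F w)) => n; rewrite -lee_fin fineK// -sumEFin.
by apply: nneseries_lim_ge => k _; rewrite lee_fin.
Qed.

End SeriesOfIntegrals.

Definition truncate (R : realType) (b x : R) : R := if `|x| <= b then x else 0.
Definition tail_part (R : realType) (b x : R) : R := if `|x| <= b then 0 else `|x|.

Section Truncation.
Context (R : realType).
Implicit Types b x : R.

Lemma truncate_norm_le b x : 0 <= b -> `|truncate b x| <= b.
Proof. by rewrite /truncate; case: ifP => //; rewrite normr0. Qed.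

Lemma truncate_sqr_le b x : truncate b x ^+ 2 <= x ^+ 2.
Proof. by rewrite /truncate; case: ifP => //; rewrite expr0n/= sqr_ge0. Qed.

Lemma tail_part_ge0 b x : 0 <= tail_part b x.
Proof. by rewrite /tail_part; case: ifP. Qed.

Lemma tail_part_le b x : tail_part b x <= `|x|.
Proof. by rewrite /tail_part; case: ifP. Qed.

Lemma norm_sub_truncate b x : `|x - truncate b x| = tail_part b x.
Proof.
by rewrite /truncate /tail_part; case: ifP; rewrite ?subrr ?normr0// subr0.
Qed.

Lemma tail_partE b x : tail_part b x = (b < `|x|)%R%:R * `|x|.
Proof. by rewrite /tail_part ltNge; case: ifP; rewrite ?mul0r ?mul1r. Qed.

Lemma measurable_truncate b : measurable_fun setT (truncate b).
Proof.
have mn : measurable_fun [set: R] (fun x : R => `|x|) by exact: measurableT_comp.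
by apply: measurable_fun_ifT => //; apply: measurable_fun_ler.
Qed.

Lemma measurable_tail_part b : measurable_fun setT (tail_part b).
Proof.
have mn : measurable_fun [set: R] (fun x : R => `|x|) by exact: measurableT_comp.
by apply: measurable_fun_ifT => //; apply: measurable_fun_ler.
Qed.

End Truncation.

Section IdenticallyDistributed.
Context d (T : measurableType d) (R : realType) (P : probability T R).
Variable X : nat -> {RV P >-> R}.
Hypothesis hident : identically_distributed X.

Lemma ident_integral (k : nat) (g : R -> R) :
  measurable_fun setT g -> (forall x, 0 <= g x) ->
  (\int[P]_w (g (X k w))%:E = \int[P]_w (g (X 0%N w))%:E)%E.
Proof.
move=> mg g0.
have E i : (\int[P]_w (g (X i w))%:E =
            \int[distribution P (X i)]_x (g x)%:E)%E.
  rewrite ge0_integral_distribution//; first exact/measurable_EFinP.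
rewrite !E; apply: eq_measure_integral => A mA _; exact: hident.
Qed.

Hypothesis var1 : (\int[P]_w (X 0%N w ^+ 2)%:E = 1)%E.
Hypothesis mean0 : (\int[P]_w (X 0%N w)%:E = 0)%E.

Local Notation u := (lower_scale R).
Local Notation wt := (upper_scale R).

Lemma integrable_sqr : P.-integrable setT (EFin \o (fun w => X 0%N w ^+ 2)).
Proof.
apply/integrableP; split.
  by apply/measurable_EFinP; exact: measurable_funX.
under eq_integral do rewrite gee0_abs ?lee_fin ?sqr_ge0//.
by rewrite var1 ltry.
Qed.

Lemma integrable_X0 : P.-integrable setT (EFin \o X 0%N).
Proof.
have i1 : P.-integrable setT (EFin \o (fun w => 1 + X 0%N w ^+ 2)).
  by apply: integrable_EFinD; [exact: integrable_EFin_cst|exact: integrable_sqr].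
apply: le_integrable i1 => //; first exact/measurable_EFinP.
move=> w _ /=; rewrite lee_fin [leRHS]ger0_norm ?addr_ge0 ?sqr_ge0//.
rewrite -[X in _ <= 1 + X]real_normK ?num_real//.
by have := normr_ge0 (X 0%N w); move: `|X 0%N w| => x; nra.
Qed.

Lemma integrable_tail b : P.-integrable setT (EFin \o (fun w => tail_part b (X 0%N w))).
Proof.
apply: le_integrable integrable_X0 => //.
  apply/measurable_EFinP; apply: (measurableT_comp (measurable_tail_part b)) => //.
by move=> w _ /=; rewrite lee_fin ger0_norm ?tail_part_ge0// tail_part_le.
Qed.

Definition tail_mean (b : R) : R := \int[P]_w tail_part b (X 0%N w).

Lemma tail_mean_ge0 b : 0 <= tail_mean b.
Proof. by apply: Rintegral_ge0 => w _; exact: tail_part_ge0. Qed.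

Lemma tail_mean_le1 b : tail_mean b <= 1.
Proof.
rewrite -lee_fin EFin_Rintegral; last exact: integrable_tail.
apply: (@le_trans _ _ (\int[P]_w (2^-1 * (1 + X 0%N w ^+ 2))%:E)%E).
  apply: ge0_le_integral => //.
  - by move=> w _; rewrite lee_fin tail_part_ge0.
  - apply/measurable_EFinP; apply: (measurableT_comp (measurable_tail_part b)) => //.
  - apply/measurable_EFinP; apply: measurable_funM => //; apply: measurable_funD => //.
    exact: measurable_funX.
  - move=> w _; rewrite lee_fin; apply: (le_trans (tail_part_le _ _)).
    rewrite -[X in 1 + X]real_normK ?num_real//.
    by move: `|X 0%N w| => x; have := sqr_ge0 (x - 1); nra.
under eq_integral do rewrite EFinM.
rewrite ge0_integralZl//; last 2 first.
- by apply/measurable_EFinP; apply: measurable_funD => //; exact: measurable_funX.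
- by move=> w _; rewrite lee_fin addr_ge0 ?sqr_ge0.
under eq_integral do rewrite EFinD.
rewrite ge0_integralD//; last 2 first.
- by move=> w _; rewrite lee_fin sqr_ge0.
- by apply/measurable_EFinP; exact: measurable_funX.
have -> : (\int[P]_(_ in setT) 1 = 1)%E.
  by rewrite integral_cst// mul1e; exact: probability_setT.
rewrite var1 -EFinD -EFinM lee_fin; lra.
Qed.

Variable tau : R.
Hypothesis tau0 : 0 < tau.

Let level k : R := tau * u (lg k).

(** Pointwise, [sum_truncated_blocks] at |X|, multiplied by |X|, bounds the integrand by 6 / tau
    times X^2, so the unit variance pays for everything that truncation removes. *)
Lemma sum_integral_tail_le n :
  (\sum_(0 <= k < n) \int[P]_w (tail_part (level k) (X 0%N w) / wt (lg k))%:E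
   <= (6 / tau)%:E)%E.
Proof.
have mt k : measurable_fun setT (fun w => tail_part (level k) (X 0%N w) / wt (lg k)).
  apply: measurable_funM => //.
  exact: (measurableT_comp (measurable_tail_part _)).
have t0 k w : 0 <= tail_part (level k) (X 0%N w) / wt (lg k).
  by rewrite divr_ge0 ?tail_part_ge0 ?(ltW (upper_scale_gt0 _ _)).
rewrite -ge0_integral_sum//; last 2 first.
- by move=> k; exact/measurable_EFinP.
- by move=> k w _; rewrite lee_fin.
have -> : (6 / tau)%:E = (\int[P]_w ((6 / tau) * X 0%N w ^+ 2)%:E)%E.
  under eq_integral do rewrite EFinM.
  rewrite ge0_integralZl//.
  - by rewrite var1 mule1.
  - by apply/measurable_EFinP; exact: measurable_funX.
  - by move=> w _; rewrite lee_fin sqr_ge0.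
  - by rewrite lee_fin divr_ge0// ltW.
apply: ge0_le_integral => //.
- by move=> w _; rewrite sumEFin lee_fin sumr_ge0.
- by apply: emeasurable_sum => k; exact/measurable_EFinP.
- apply/measurable_EFinP; apply: measurable_funM => //; exact: measurable_funX.
move=> w _; rewrite sumEFin lee_fin.
have := sum_truncated_blocks n tau0 (normr_ge0 (X 0%N w)).
move=> /(ler_wpM2l (normr_ge0 (X 0%N w))); rewrite mulr_sumr => h.
apply: (@le_trans _ _ (\sum_(0 <= i < n) `|X 0%N w| *
    ((tau * u (lg i) < `|X 0%N w|)%R%:R / wt (lg i)))).
  by apply: ler_sum => k _; rewrite tail_partE mulrCA mulrA.
apply: (le_trans h); rewrite -[X in _ <= _ * X]real_normK ?num_real//.
by rewrite le_eqVlt; apply/orP; left; apply/eqP; field; rewrite gt_eqF.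
Qed.

(** The means of the truncated variables are bounded by [tail_mean]; as these add up to less than
    the normalisation, the means can be carried as an error instead of being subtracted. *)
Lemma sum_tail_mean_small (e : R) : 0 < e ->
  \forall n \near \oo, \sum_(0 <= k < n) tail_mean (level k) <= e * wt (lg n).
Proof.
apply: (@kronecker_nonneg _ _ (fun n => wt (lg n)) (6 / tau)).
- by move=> n; exact: tail_mean_ge0.
- by move=> n; exact: upper_scale_gt0.
- by move=> m n mn; apply: le_upper_scale; exact: leq_trunc_log.
- exact: (cvg_comp _ _ lg_cvgy (@upper_scale_cvgy R)).
move=> n; rewrite -lee_fin -sumEFin; apply: le_trans (sum_integral_tail_le n).
rewrite le_eqVlt; apply/orP; left; apply/eqP; apply: eq_bigr => k _.
rewrite EFinM EFin_Rintegral; last exact: integrable_tail.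
under [RHS]eq_integral do rewrite EFinM.
rewrite ge0_integralZr//.
- by apply/measurable_EFinP; exact: (measurableT_comp (measurable_tail_part _)).
- by move=> w _; rewrite lee_fin tail_part_ge0.
- by rewrite lee_fin invr_ge0 (ltW (upper_scale_gt0 _ _)).
Qed.

(** The pathwise counterpart, again by Kronecker's lemma: almost surely the partial sums of X and of
    its truncations differ by less than any multiple of the normalisation. *)
Lemma sum_tail_part_small :
  {ae P, forall w, forall e : R, 0 < e -> \forall n \near \oo,
     \sum_(0 <= k < n) tail_part (level k) (X k w) <= e * wt (lg n)}.
Proof.
have mt k : measurable_fun setT (fun x => tail_part (level k) x / wt (lg k)).
  apply: measurable_funM => //.
  exact: measurable_tail_part.
have t0 k x : 0 <= tail_part (level k) x / wt (lg k).
  by rewrite divr_ge0 ?tail_part_ge0 ?(ltW (upper_scale_gt0 _ _)).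
have := @ae_bounded_series _ _ _ P
  (fun k w => tail_part (level k) (X k w) / wt (lg k)) (6 / tau).
have h1 k : measurable_fun setT (fun w => tail_part (level k) (X k w) / wt (lg k)).
  exact: (measurableT_comp (mt k)).
move=> /(_ h1 (fun k w => t0 k _)).
have h2 n : (\sum_(0 <= k < n)
    \int[P]_w (tail_part (level k) (X k w) / wt (lg k))%:E <= (6 / tau)%:E)%E.
  apply: le_trans (sum_integral_tail_le n).
  rewrite le_eqVlt; apply/orP; left; apply/eqP; apply: eq_bigr => k _.
  exact: (ident_integral k (mt k) (t0 k)).
move=> /(_ h2); apply: filterS => w [C hC].
apply: (@kronecker_nonneg _ _ (fun n => wt (lg n)) C) => //.
- by move=> n; exact: tail_part_ge0.
- by move=> n; exact: upper_scale_gt0.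
- by move=> m n mn; apply: le_upper_scale; exact: leq_trunc_log.
- exact: (cvg_comp _ _ lg_cvgy (@upper_scale_cvgy R)).
Qed.

End IdenticallyDistributed.

(** * Moment generating functions of truncated variables *)

Section MomentGeneratingFunction.
Context d (T : measurableType d) (R : realType) (P : probability T R).
Variable X : nat -> {RV P >-> R}.
Hypothesis var1 : (\int[P]_w (X 0%N w ^+ 2)%:E = 1)%E.
Hypothesis mean0 : (\int[P]_w (X 0%N w)%:E = 0)%E.

Local Notation u := (lower_scale R).
Local Notation wt := (upper_scale R).
Local Notation ll := (ll R).

Definition truncated_mgf (b theta : R) : R :=
  \int[P]_w expR (theta * truncate b (X 0%N w)).
Definition truncated_var (b : R) : R := \int[P]_w truncate b (X 0%N w) ^+ 2.

Let mtr b : measurable_fun setT (fun w => truncate b (X 0%N w)).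
Proof. exact: (measurableT_comp (measurable_truncate b)). Qed.

Let itr b : 0 <= b -> P.-integrable setT (EFin \o (fun w => truncate b (X 0%N w))).
Proof.
by move=> b0; apply: (@bounded_integrable _ _ _ _ _ b) => // w; exact: truncate_norm_le.
Qed.

Let itr2 b : 0 <= b ->
  P.-integrable setT (EFin \o (fun w => truncate b (X 0%N w) ^+ 2)).
Proof.
move=> b0; apply: (@bounded_integrable _ _ _ _ _ (b ^+ 2)).
  exact: measurable_funX.
move=> w; rewrite ger0_norm ?sqr_ge0// -real_normK ?num_real//.
by rewrite lerXn2r ?nnegrE// truncate_norm_le.
Qed.

(** The full mean is 0, so the truncated mean is minus the mean of the part removed. *)
Lemma truncated_mean_le b : 0 <= b ->
  `|\int[P]_w truncate b (X 0%N w)| <= tail_mean X b.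
Proof.
move=> b0; have iX := integrable_X0 var1.
have -> : \int[P]_w truncate b (X 0%N w) =
    - \int[P]_w (X 0%N w - truncate b (X 0%N w)).
  rewrite RintegralB//; last exact: itr.
  rewrite [X in _ = - (X - _)](_ : _ = 0) ?sub0r ?opprK//.
  by rewrite /Rintegral mean0.
rewrite normrN.
have iB : P.-integrable setT (EFin \o (fun w => X 0%N w - truncate b (X 0%N w))).
  by apply: integrable_EFinB => //; exact: itr.
apply: (le_trans (le_normr_Rintegral measurableT iB)).
by under eq_Rintegral do rewrite norm_sub_truncate.
Qed.

Lemma truncated_var_le1 b : 0 <= b -> truncated_var b <= 1.
Proof.
move=> b0; rewrite -lee_fin EFin_Rintegral; last exact: itr2.
rewrite -var1; apply: ge0_le_integral => //.
- by move=> w _; rewrite lee_fin sqr_ge0.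
- by apply/measurable_EFinP; exact: measurable_funX.
- by apply/measurable_EFinP; exact: measurable_funX.
- by move=> w _; rewrite lee_fin truncate_sqr_le.
Qed.

Lemma truncated_var_ge0 b : 0 <= truncated_var b.
Proof. by apply: Rintegral_ge0 => w _; exact: sqr_ge0. Qed.

Lemma integrable_truncated_exp b theta : 0 <= b ->
  P.-integrable setT (EFin \o (fun w => expR (theta * truncate b (X 0%N w)))).
Proof.
move=> b0; apply: (@bounded_integrable _ _ _ _ _ (expR (`|theta| * b))).
  by apply: measurableT_comp => //; exact: measurable_funM.
move=> w; rewrite ger0_norm ?expR_ge0// ler_expR.
apply: (le_trans (ler_norm _)); rewrite normrM ler_wpM2l//.
exact: truncate_norm_le.
Qed.

Let quadratic_integral (b theta c : R) : 0 <= b ->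
  P.-integrable setT (EFin \o (fun w => 1 + theta * truncate b (X 0%N w)
      + (theta * truncate b (X 0%N w)) ^+ 2 / 2 * c)) /\
  \int[P]_w (1 + theta * truncate b (X 0%N w)
      + (theta * truncate b (X 0%N w)) ^+ 2 / 2 * c) =
  1 + theta * \int[P]_w truncate b (X 0%N w) + theta ^+ 2 / 2 * c * truncated_var b.
Proof.
move=> b0; pose t w := truncate b (X 0%N w).
have i1 : P.-integrable setT (EFin \o (fun=> 1 : R)) by exact: integrable_EFin_cst.
have i2 : P.-integrable setT (EFin \o (fun w => theta * t w)).
  by apply: integrable_EFinZ; exact: itr.
have i3 : P.-integrable setT (EFin \o (fun w => (theta ^+ 2 / 2 * c) * t w ^+ 2)).
  by apply: integrable_EFinZ; exact: itr2.
have i12 : P.-integrable setT (EFin \o (fun w => 1 + theta * t w)).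
  exact: integrable_EFinD.
have i123 : P.-integrable setT (EFin \o (fun w => 1 + theta * t w
    + (theta ^+ 2 / 2 * c) * t w ^+ 2)).
  exact: integrable_EFinD.
have E : (fun w => 1 + theta * t w + (theta * t w) ^+ 2 / 2 * c) =
         (fun w => 1 + theta * t w + (theta ^+ 2 / 2 * c) * t w ^+ 2).
  by apply/funext => w; rewrite exprMn; congr (_ + _); ring.
split; first by rewrite E.
rewrite [LHS](_ : _ = \int[P]_w (1 + theta * t w + (theta ^+ 2 / 2 * c) * t w ^+ 2)); last first.
  by rewrite -E.
rewrite RintegralD// RintegralD// !RintegralZl//; [|exact: itr2|exact: itr].
by rewrite Rintegral_probability_cst.
Qed.

Lemma truncated_mgf_le (b theta eta : R) : 0 <= b -> 0 <= theta ->
  theta * b <= eta -> eta <= 4^-1 ->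
  truncated_mgf b theta <=
    expR (theta * tail_mean X b + theta ^+ 2 / 2 * (1 + 4 * eta)).
Proof.
move=> b0 th0 tb eta4.
have eta0 : 0 <= eta by apply: le_trans tb; exact: mulr_ge0.
have [iq eq] := @quadratic_integral b theta (1 + 4 * eta) b0.
apply: (@le_trans _ _ (\int[P]_w (1 + theta * truncate b (X 0%N w)
      + (theta * truncate b (X 0%N w)) ^+ 2 / 2 * (1 + 4 * eta)))).
  apply: le_Rintegral => //; first exact: integrable_truncated_exp.
  move=> w _; apply: expR_le_quad; last by lra.
  rewrite normrM ger0_norm//; apply: le_trans tb.
  by rewrite ler_wpM2l// truncate_norm_le.
rewrite eq; apply: le_trans (expR_ge1Dx _); rewrite -addrA lerD2l; apply: lerD.
  rewrite ler_wpM2l//; apply: le_trans (truncated_mean_le b0); exact: ler_norm.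
rewrite -[leRHS]mulr1; apply: ler_wpM2l; last exact: truncated_var_le1.
by rewrite mulr_ge0 ?divr_ge0 ?sqr_ge0// addr_ge0// mulr_ge0.
Qed.

(** The quadratic minorant of exp integrates to at least 1 + p - r, with p the variance term and r
    the bound on the truncated mean. As variance and [tail_mean] are at most 1, [theta <= e] keeps p
    and r below e, as [ge_expR_sub] requires. *)
Lemma truncated_mgf_ge (b theta eta e : R) : 0 <= b -> 0 <= theta ->
  theta * b <= eta -> eta <= 4^-1 -> theta <= e -> e <= 2^-1 ->
  expR (theta ^+ 2 / 2 * truncated_var b * (1 - 4 * eta) * (1 - e)
        - 2 * (theta * tail_mean X b)) <= truncated_mgf b theta.
Proof.
move=> b0 th0 tb eta4 the e2.
have eta0 : 0 <= eta by apply: le_trans tb; exact: mulr_ge0.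
have [iq eq] := @quadratic_integral b theta (1 - 4 * eta) b0.
apply: (@le_trans _ _ (\int[P]_w (1 + theta * truncate b (X 0%N w)
      + (theta * truncate b (X 0%N w)) ^+ 2 / 2 * (1 - 4 * eta)))); last first.
  apply: le_Rintegral => //; first exact: integrable_truncated_exp.
  move=> w _; apply: expR_ge_quad; last by lra.
  rewrite normrM ger0_norm//; apply: le_trans tb.
  by rewrite ler_wpM2l// truncate_norm_le.
rewrite eq.
have v0 := truncated_var_ge0 b; have v1 := truncated_var_le1 b0.
have t0 := tail_mean_ge0 X b; have t1 := tail_mean_le1 var1 b.
have c0 : 0 <= theta ^+ 2 / 2 * (1 - 4 * eta).
  by rewrite mulr_ge0 ?divr_ge0 ?sqr_ge0//; lra.
have p0 : 0 <= theta ^+ 2 / 2 * truncated_var b * (1 - 4 * eta).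
  by rewrite mulrAC mulr_ge0.
have pe : theta ^+ 2 / 2 * truncated_var b * (1 - 4 * eta) <= e.
  rewrite mulrAC; apply: (@le_trans _ _ (theta ^+ 2 / 2 * (1 - 4 * eta))).
    by rewrite ler_piMr.
  apply: (@le_trans _ _ (theta ^+ 2 / 2)).
    by rewrite ler_piMr ?divr_ge0 ?sqr_ge0//; lra.
  by nra.
have r0 : 0 <= theta * tail_mean X b by rewrite mulr_ge0.
have re : theta * tail_mean X b <= e.
  by apply: le_trans the; rewrite ler_piMr.
apply: (le_trans (ge_expR_sub p0 r0 pe re e2)).
have := truncated_mean_le b0; rewrite ler_norml => /andP[h _].
have := ler_wpM2l th0 h; rewrite mulrN mulrAC.
move: (theta * tail_mean X b) => A; lra.
Qed.

Lemma truncated_var_cvg (b : nat -> R) : (forall k, 0 <= b k) ->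
  b k @[k --> \oo] --> +oo -> truncated_var (b k) @[k --> \oo] --> (1 : R).
Proof.
move=> b0 bcvg.
have mf n : measurable_fun setT (EFin \o (fun w => truncate (b n) (X 0%N w) ^+ 2)).
  by apply/measurable_EFinP; exact: measurable_funX.
have mX2 : measurable_fun setT (EFin \o (fun w => X 0%N w ^+ 2)).
  by apply/measurable_EFinP; exact: measurable_funX.
have := @dominated_convergence _ _ _ P setT measurableT
  (fun n => EFin \o (fun w => truncate (b n) (X 0%N w) ^+ 2))
  (EFin \o (fun w => X 0%N w ^+ 2)) (EFin \o (fun w => X 0%N w ^+ 2)) mf mX2.
case=> [| | |_ _].
- apply/aeW => w _; apply: cvg_near_cst.
  move/cvgryPge : bcvg => /(_ `|X 0%N w|); apply: filterS => k hk.
  by rewrite /= /truncate hk.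
- exact: integrable_sqr.
- apply/aeW => w n _ /=; rewrite !ger0_norm ?lee_fin ?sqr_ge0//.
  exact: truncate_sqr_le.
move=> h.
have h1 : (\int[P]_w (truncate (b n) (X 0%N w) ^+ 2)%:E)%E @[n --> \oo] --> (1%R : R)%:E.
  by rewrite -[X in _ --> X]var1; exact: h.
exact: (fine_cvg h1).
Qed.

Variables (tau eta : R).
Hypothesis tau0 : 0 < tau.
Hypothesis eta4 : eta <= 4^-1.

Let level k : R := tau * u (lg k).

Let level0 k : 0 <= level k.
Proof. by rewrite mulr_ge0 ?(ltW tau0) ?(ltW (lower_scale_gt0 _ _)). Qed.

(** The parameter that optimises the Gaussian Chernoff bound for a deviation lam * sqrt (N * ll (lg
    N)) after N steps of unit variance. It makes N * tilt^2 a multiple of [ll (lg N)], so all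
    exponents below are multiples of [ll], and exp (- c * ll j) is the power (j + 4)^-c. *)
Definition tilt (lam : R) (N : nat) : R := lam * Num.sqrt (ll (lg N) / N%:R).

Lemma tilt_ge0 lam N : 0 <= lam -> 0 <= tilt lam N.
Proof. by move=> lam0; rewrite mulr_ge0. Qed.

Lemma tilt_sqr lam N : (0 < N)%N -> N%:R * tilt lam N ^+ 2 = lam ^+ 2 * ll (lg N).
Proof.
move=> N0; rewrite exprMn sqr_sqrtr ?divr_ge0 ?(ltW (ll_gt0 _ _))//.
have n0 : N%:R != 0 :> R by rewrite pnatr_eq0 -lt0n.
by move: (N%:R : R) n0 (ll _) => n n0 l; field.
Qed.

Lemma tilt_sqrt lam N : (0 < N)%N ->
  tilt lam N * Num.sqrt (N%:R * ll (lg N)) = lam * ll (lg N).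
Proof.
move=> N0; rewrite -mulrA -sqrtrM ?divr_ge0 ?(ltW (ll_gt0 _ _))//.
have n0 : N%:R != 0 :> R by rewrite pnatr_eq0 -lt0n.
rewrite (_ : ll (lg N) / N%:R * _ = ll (lg N) ^+ 2); last first.
  by move: (N%:R : R) n0 (ll _) => n n0 l; field.
by rewrite sqrtr_sqr ger0_norm// (ltW (ll_gt0 _ _)).
Qed.

(** The truncation level is made for this bound: level times tilt is largest at k = N, where 2^(lg
    N) <= N leaves at most lam * tau. *)
Lemma tilt_level lam k N : 0 < lam -> lam * tau <= eta -> (0 < N)%N -> (k <= N)%N ->
  tilt lam N * level k <= eta.
Proof.
move=> lam0 lt N0 kN; apply: le_trans lt.
rewrite /tilt /level mulrACA -[leRHS]mulr1; apply: ler_wpM2l.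
  by rewrite mulr_ge0// ltW.
apply: (@le_trans _ _ (Num.sqrt (ll (lg N) / N%:R) * u (lg N))).
  by rewrite ler_wpM2l// le_lower_scale// leq_trunc_log.
rewrite /lower_scale -sqrtrM ?divr_ge0 ?(ltW (ll_gt0 _ _))// -[leRHS]sqrtr1.
apply: ler_wsqrtr.
have l0 : ll (lg N) != 0 by rewrite gt_eqF// ll_gt0.
have n0 : 0 < N%:R :> R by rewrite ltr0n.
rewrite (_ : ll (lg N) / N%:R * (2 ^+ lg N / ll (lg N)) = 2 ^+ (lg N) / N%:R); last first.
  by move: (N%:R : R) n0 (ll _) l0 => n n0 l l0; field; rewrite l0 gt_eqF.
by rewrite ler_pdivrMr// mul1r -natrX ler_nat trunc_logP.
Qed.

Lemma tilt_small lam e : 0 < lam -> 0 < e -> \forall N \near \oo, tilt lam N <= e.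
Proof.
move=> lam0 e0.
have e0' : 0 < (e / lam) ^+ 2 by rewrite exprn_gt0// divr_gt0.
near=> N.
have N0 : (0 < N)%N by near: N; exists 1%N.
have h : ll (lg N) <= (e / lam) ^+ 2 * N%:R by near: N; exact: ll_lg_small.
rewrite /tilt mulrC -ler_pdivlMr// -[leRHS]ger0_norm ?divr_ge0 ?(ltW e0) ?(ltW lam0)//.
rewrite -sqrtr_sqr; apply: ler_wsqrtr.
by rewrite ler_pdivrMr// ltr0n.
Unshelve. all: by end_near. Qed.

Lemma tilt_tail_small lam e : 0 < lam -> 0 < e -> \forall N \near \oo,
  tilt lam N * \sum_(0 <= k < N) tail_mean X (level k) <= e * ll (lg N).
Proof.
move=> lam0 e0.
have e0' : 0 < e / lam by rewrite divr_gt0.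
near=> N.
have N0 : (0 < N)%N by near: N; exists 1%N.
have h : \sum_(0 <= k < N) tail_mean X (level k) <= e / lam * wt (lg N).
  by near: N; exact: sum_tail_mean_small.
have h2 := le_trans h (ler_wpM2l (ltW e0') (upper_scale_le _ N0)).
apply: (le_trans (ler_wpM2l (tilt_ge0 N (ltW lam0)) h2)).
rewrite mulrCA tilt_sqrt// mulrA divfK ?gt_eqF//.
Unshelve. all: by end_near. Qed.

(** All exponents are nonnegative, so any subproduct is bounded by the exponential sum over [0, N).
    Uniformity in n and m, with the tilt of N kept fixed, serves both the maximal inequality, where
    the end point varies, and the blocks, where the starting point does. *)
Lemma prod_truncated_mgf_le lam e : 0 < lam -> lam * tau <= eta -> 0 < e ->
  \forall N \near \oo, forall n m, (m <= N)%N ->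
    \prod_(n <= k < m) truncated_mgf (level k) (tilt lam N) <=
    expR (ll (lg N) * (lam ^+ 2 / 2 * (1 + 4 * eta) + e)).
Proof.
move=> lam0 lt e0; near=> N.
have N0 : (0 < N)%N by near: N; exists 1%N.
have hb : tilt lam N * \sum_(0 <= k < N) tail_mean X (level k) <= e * ll (lg N).
  by near: N; exact: tilt_tail_small.
have eta0 : 0 <= eta by apply: le_trans lt; rewrite mulr_ge0// ltW.
have th0 := tilt_ge0 N (ltW lam0).
move=> n m mN; set F := fun k => tilt lam N * tail_mean X (level k)
   + tilt lam N ^+ 2 / 2 * (1 + 4 * eta).
have F0 k : 0 <= F k.
  rewrite /F addr_ge0// mulr_ge0 ?tail_mean_ge0 ?divr_ge0 ?sqr_ge0//.
  by rewrite addr_ge0// mulr_ge0.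
apply: (@le_trans _ _ (\prod_(n <= k < m) expR (F k))).
  rewrite big_nat_cond [leRHS]big_nat_cond; apply: ler_prod => k /andP[/andP[_ km] _].
  apply/andP; split; first by apply: Rintegral_ge0 => w _; exact: expR_ge0.
  apply: truncated_mgf_le => //; apply: tilt_level => //.
  by rewrite (leq_trans _ mN)// ltnW.
rewrite -expR_sum ler_expR.
have [nm|nm] := leqP n m; last first.
  by rewrite big_geq ?(ltnW nm)// mulr_ge0 ?(ltW (ll_gt0 _ _))// addr_ge0 ?(ltW e0)//
    mulr_ge0 ?divr_ge0 ?sqr_ge0// addr_ge0// mulr_ge0.
apply: (@le_trans _ _ (\sum_(0 <= k < N) F k)).
  rewrite [leRHS](big_cat_nat (n := m))//= [X in _ <= X + _](big_cat_nat (n := n))//=.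
  by rewrite -addrA addrCA lerDl addr_ge0// sumr_ge0.
rewrite big_split/= -mulr_sumr sumr_const_nat subn0 -[_ *+ N]mulr_natl.
rewrite [leRHS]mulrDr [leRHS]addrC; apply: lerD; first by rewrite [leRHS]mulrC.
rewrite (_ : N%:R * (tilt lam N ^+ 2 / 2 * (1 + 4 * eta)) =
  (N%:R * tilt lam N ^+ 2) * ((1 + 4 * eta) / 2)); last by ring.
rewrite tilt_sqr// le_eqVlt; apply/orP; left; apply/eqP; ring.
Unshelve. all: by end_near. Qed.

(** The factor 1 - kap accounts for the indices below n, at most a fraction kap of N, that are
    missing from the product. *)
Lemma prod_truncated_mgf_ge lam kap e : 0 < lam -> lam * tau <= eta ->
  0 <= kap <= 1 -> 0 < e ->
  \forall N \near \oo, forall n, (n%:R <= kap * N%:R)%R ->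
    expR (ll (lg N) * (lam ^+ 2 / 2 * ((1 - 4 * eta) * (1 - kap)) - e)) <=
    \prod_(n <= k < N) truncated_mgf (level k) (tilt lam N).
Proof.
move=> lam0 lt /andP[kap0 kap1] e0.
have eta0 : 0 <= eta by apply: le_trans lt; rewrite mulr_ge0// ltW.
(* [f] bounds three small quantities at once: the defect of the truncated variance, the tilt, and
   the fraction K / N of early indices. Their joint cost is at most 3 f (see [pol]) and uses half of
   e; the other half goes to the truncated means. *)
have [f f0 [f2 fl]] : exists2 f : R, 0 < f & f <= 2^-1 /\ 3 * f * (lam ^+ 2 / 2) <= e / 2.
  pose c := e / (3 * lam ^+ 2).
  have c0 : 0 < c by rewrite divr_gt0// mulr_gt0// exprn_gt0.
  exists (Num.min 2^-1 c); first by rewrite lt_min c0 invr_gt0 ltr0n.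
  split; first by rewrite ge_min lexx.
  have : Num.min 2^-1 c <= c by rewrite ge_min lexx orbT.
  rewrite /c ler_pdivlMr ?mulr_gt0 ?exprn_gt0//; lra.
have lvy : level k @[k --> \oo] --> +oo.
  apply/cvgryPge => A.
  have : u (lg k) @[k --> \oo] --> +oo := cvg_comp _ _ lg_cvgy (@lower_scale_cvgy R).
  move=> /cvgryPge/(_ (A / tau)); apply: filterS => k.
  by rewrite ler_pdivrMr// mulrC.
have /cvgrPdist_le/(_ f f0)[K _ hK] := truncated_var_cvg level0 lvy.
have e20 : 0 < e / 4 by rewrite divr_gt0.
near=> N.
have N0 : (0 < N)%N by near: N; exists 1%N.
have hb : tilt lam N * \sum_(0 <= k < N) tail_mean X (level k) <= e / 4 * ll (lg N).
  by near: N; exact: tilt_tail_small.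
have hf : tilt lam N <= f by near: N; exact: tilt_small.
have hKN : f^-1 * K%:R <= N%:R by near: N; exact: nbhs_infty_ger.
have {}hKN : K%:R <= f * N%:R by move: hKN; rewrite ler_pdivrMl.
have th0 := tilt_ge0 N (ltW lam0).
move=> n nN.
have nN' : (n <= N)%N.
  by rewrite -(ler_nat R) (le_trans nN)// ler_piMl.
pose F k := tilt lam N ^+ 2 / 2 * truncated_var (level k) * (1 - 4 * eta) * (1 - f)
   - 2 * (tilt lam N * tail_mean X (level k)).
apply: (@le_trans _ _ (\prod_(n <= k < N) expR (F k))); last first.
  rewrite big_nat_cond [leRHS]big_nat_cond; apply: ler_prod => k /andP[/andP[_ km] _].
  rewrite expR_ge0/=; apply: truncated_mgf_ge => //.
  by apply: tilt_level => //; exact: ltnW.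
rewrite -expR_sum ler_expR big_split/= sumrN -mulr_sumr -mulr_sumr.
have s1 : tilt lam N * \sum_(n <= k < N) tail_mean X (level k) <= e / 4 * ll (lg N).
  apply: le_trans hb; apply: ler_wpM2l => //.
  rewrite [leRHS](big_cat_nat (n := n))//= lerDr sumr_ge0// => k _; exact: tail_mean_ge0.
(* From K on the truncated variance is at least 1 - f; the earlier indices, at most K <= f * N of
   them, are estimated by 0 at a cost of at most 1 each. *)
have s2 : N%:R * ((1 - f) * (1 - kap) - f) <= \sum_(n <= k < N) truncated_var (level k).
  apply: (@le_trans _ _ (\sum_(n <= k < N) ((1 - f) - (k < K)%N%:R))); last first.
    apply: ler_sum => k _; case: ltnP => kK.
      apply: le_trans (truncated_var_ge0 _).
      by rewrite subr_le0 gerBl (ltW f0).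
    have := hK k kK; rewrite ler_norml subr0 => /andP[_].
    by rewrite lerBlDr addrC -lerBlDr.
  rewrite big_split/= sumr_const_nat sumrN -[_ *+ (N - n)]mulr_natr natrB//.
  have : \sum_(n <= k < N) ((k < K)%N%:R : R) <= K%:R.
    apply: (@le_trans _ _ (\sum_(0 <= k < N + K) ((k < K)%N%:R : R))).
      rewrite [leRHS](big_cat_nat (n := N)) ?leq_addr//= [X in _ <= X + _](big_cat_nat (n := n))//=.
      by rewrite -addrA addrCA lerDl addr_ge0// sumr_ge0.
    rewrite (big_cat_nat (n := K)) ?leq_addl//=.
    rewrite (_ : \sum_(K <= k < N + K) _ = 0) ?addr0; last first.
      by rewrite big_nat_cond big1// => k /andP[/andP[Kk _] _]; rewrite ltnNge Kk.
    rewrite (@eq_big_nat _ _ _ _ _ _ (fun=> 1)); last by move=> k /andP[_ ->].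
    by rewrite sumr_const_nat subn0.
  move: (\sum_(n <= k < N) _) => S hS.
  by have : 0 <= (1 - f) * (kap * N%:R - n%:R) by [rewrite mulr_ge0//; lra]; lra.
have -> : \sum_(n <= k < N) tilt lam N ^+ 2 / 2 * truncated_var (level k) *
    (1 - 4 * eta) * (1 - f) =
    tilt lam N ^+ 2 / 2 * ((1 - 4 * eta) * (1 - f)) *
    \sum_(n <= k < N) truncated_var (level k).
  by rewrite mulr_sumr; apply: eq_bigr => k _; ring.
have c0 : 0 <= tilt lam N ^+ 2 / 2 * ((1 - 4 * eta) * (1 - f)).
  have A0 : 0 <= 1 - 4 * eta by move: eta4; lra.
  have B0 : 0 <= 1 - f by move: f2; lra.
  by rewrite mulr_ge0 ?divr_ge0 ?sqr_ge0// mulr_ge0.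
have := ler_wpM2l c0 s2.
rewrite (_ : tilt lam N ^+ 2 / 2 * ((1 - 4 * eta) * (1 - f)) *
    (N%:R * ((1 - f) * (1 - kap) - f)) = (N%:R * tilt lam N ^+ 2) *
    (2^-1 * (((1 - 4 * eta) * (1 - f)) * ((1 - f) * (1 - kap) - f)))); last by ring.
rewrite tilt_sqr// => h.
have s1' : - (2 * (e / 4 * ll (lg N))) <=
    - (2 * (tilt lam N * \sum_(n <= k < N) tail_mean X (level k))).
  by rewrite lerN2 ler_pM2l.
apply: le_trans (lerD h s1').
set A := 1 - 4 * eta; set B := 1 - kap.
have A0 : 0 <= A by rewrite /A; move: eta4; lra.
have A1 : A <= 1 by rewrite /A gerBl mulr_ge0.
have B0 : 0 <= B by rewrite /B subr_ge0.
have B1 : B <= 1 by rewrite /B gerBl.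
have AB0 : 0 <= A * B by rewrite mulr_ge0.
have AB1 : A * B <= 1 by rewrite mulr_ile1.
have pol : A * B - 3 * f <= A * (1 - f) * ((1 - f) * B - f).
  have h1 : 0 <= A * B * f ^+ 2 by rewrite mulr_ge0// sqr_ge0.
  have h2 : A * f <= f by rewrite ler_piMl// ltW.
  have h3 : A * B * f <= f by rewrite ler_piMl// ltW.
  have h4 : 0 <= A * f * f by rewrite !mulr_ge0// ltW.
  rewrite (_ : A * (1 - f) * ((1 - f) * B - f) =
    A * B - 2 * (A * B * f) + A * B * f ^+ 2 - A * f + A * f * f); last by ring.
  by move: h1 h2 h3 h4; lra.
have l0 := ll_gt0 R (lg N).
have la0 : 0 <= lam ^+ 2 / 2 by rewrite divr_ge0 ?sqr_ge0.
have := ler_wpM2l (mulr_ge0 (ltW l0) la0) pol.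
have := ler_wpM2l (ltW l0) fl.
rewrite (_ : lam ^+ 2 * ll (lg N) * (2^-1 * (A * (1 - f) * ((1 - f) * B - f))) =
  ll (lg N) * (lam ^+ 2 / 2) * (A * (1 - f) * ((1 - f) * B - f))); last by ring.
move: (A * B) (A * (1 - f) * ((1 - f) * B - f)) (lam ^+ 2 / 2) (ll _) => U V W L.
lra.
Unshelve. all: by end_near. Qed.

End MomentGeneratingFunction.

(** * Upper and lower bounds for partial sums *)

Section UpperLIL.
Context d (T : measurableType d) (R : realType) (P : probability T R).

Lemma borel_cantelli_near (F : nat -> set T) (c : nat -> R) (M : R) :
  (forall n, measurable (F n)) -> (forall n, 0 <= c n) ->
  (\forall n \near \oo, P (F n) <= (c n)%:E)%E ->
  (forall n, \sum_(0 <= i < n) c i <= M) ->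
  {ae P, forall w, \forall n \near \oo, ~ F n w}.
Proof.
move=> mF c0 [N _ hN] cM.
have := @borel_cantelli_ev _ _ _ P (fun n => if (n < N)%N then set0 else F n) c M.
case=> //.
- by move=> n; case: ifP.
- by move=> n; case: ltnP => [_|/hN//]; rewrite measure0 lee_fin.
move=> A [mA A0 sub]; exists A; split=> // w /= hw; apply: sub => /= h; apply: hw.
have [K _ hK] := h; exists (maxn K N) => // n /=; rewrite geq_max => /andP[Kn Nn].
by have := hK n Kn; rewrite ltnNge Nn.
Qed.

Variable X : nat -> {RV P >-> R}.
Hypothesis hindep : independent_RVs X.
Hypothesis hident : identically_distributed X.
Hypothesis var1 : (\int[P]_w (X 0%N w ^+ 2)%:E = 1)%E.
Hypothesis mean0 : (\int[P]_w (X 0%N w)%:E = 0)%E.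

Local Notation u := (lower_scale R).
Local Notation wt := (upper_scale R).
Local Notation ll := (ll R).

Lemma integral_truncated_exp b theta k : 0 <= b ->
  (\int[P]_w (expR (theta * truncate b (X k w)))%:E =
   (truncated_mgf X b theta)%:E)%E.
Proof.
move=> b0; rewrite EFin_Rintegral; last exact: integrable_truncated_exp.
apply: (@ident_integral _ _ _ _ _ hident k (fun x => expR (theta * truncate b x))) => //.
apply: measurableT_comp => //; apply: measurable_funM => //; exact: measurable_truncate.
Qed.

Lemma truncated_mgf_gt0 b theta : 0 <= b -> 0 < truncated_mgf X b theta.
Proof.
move=> b0; apply: (@lt_le_trans _ _ (expR (- (`|theta| * b)))); first exact: expR_gt0.
rewrite -[leLHS](Rintegral_probability_cst P).
apply: le_Rintegral => //.
- exact: integrable_EFin_cst.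
- exact: integrable_truncated_exp.
move=> w _; rewrite ler_expR lerNl; apply: (le_trans (ler_norm _)).
by rewrite normrN normrM ler_wpM2l// truncate_norm_le.
Qed.

Definition truncated_sum (tau : R) (k : nat) (w : T) : R :=
  \sum_(0 <= i < k) truncate (tau * u (lg i)) (X i w).

Lemma measurable_truncated_sum tau k : measurable_fun setT (truncated_sum tau k).
Proof.
apply: measurable_sum => i; exact: (measurableT_comp (measurable_truncate _)).
Qed.

(** Dividing each factor exp (theta * truncate) by its moment generating function gives integral 1,
    so the maximal inequality applies; [B] converts the normalised products back. *)
Lemma truncated_max_bound tau (theta x B : R) N : 0 < tau -> 0 <= theta -> 0 < B ->
  (forall k, (k <= N)%N ->
     \prod_(0 <= i < k) truncated_mgf X (tau * u (lg i)) theta <= B) ->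
  (P [set w | exists2 k, (k <= N)%N & (x <= truncated_sum tau k w)%R] <=
   (B * expR (- (theta * x)))%:E)%E.
Proof.
move=> tau0 th0 B0 hB.
have b0 i : 0 <= tau * u (lg i) by rewrite mulr_ge0 ?(ltW tau0) ?(ltW (lower_scale_gt0 _ _)).
pose M i := truncated_mgf X (tau * u (lg i)) theta.
have M0 i : 0 < M i by exact: truncated_mgf_gt0.
pose f i (z : R) := (M i)^-1 * expR (theta * truncate (tau * u (lg i)) z).
have mf i : measurable_fun setT (f i).
  apply: measurable_funM => //; apply: measurableT_comp => //.
  by apply: measurable_funM => //; exact: measurable_truncate.
have f0 i z : 0 <= f i z by rewrite mulr_ge0 ?invr_ge0 ?expR_ge0 ?(ltW (M0 i)).
have f1 i : (\int[P]_w (f i (X i w))%:E <= 1)%E.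
  rewrite /f; under eq_integral do rewrite EFinM.
  rewrite ge0_integralZl//.
  - by rewrite integral_truncated_exp// -EFinM mulVf// gt_eqF// M0.
  - apply/measurable_EFinP; apply: measurableT_comp => //; apply: measurable_funM => //.
    exact: (measurableT_comp (measurable_truncate _)).
  - by rewrite lee_fin invr_ge0 ltW// M0.
pose y := expR (theta * x) / B.
have y0 : 0 < y by rewrite divr_gt0 ?expR_gt0.
have := maximal_inequality hindep mf f0 f1 y0 N.
rewrite /y invf_div -expRN; apply: le_trans.
apply: le_measure.
- rewrite inE (_ : [set _ | _] = \bigcup_(k in `I_N.+1) [set w | x <= truncated_sum tau k w]).
    apply: bigcup_measurable => k _; apply: measurable_superlevel.
    exact: measurable_truncated_sum.
  by apply/seteqP; split=> w [k kN h]; exists k.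
- rewrite inE (_ : [set _ | _] = \bigcup_(k in `I_N.+1)
    [set w | expR (theta * x) / B <= \prod_(0 <= i < k) f i (X i w)]).
    apply: bigcup_measurable => k _; apply: measurable_superlevel.
    by apply: measurable_prod => i _; exact: (measurableT_comp (mf i)).
  by apply/seteqP; split=> w [k kN h]; exists k.
move=> w [k kN h]; exists k => //.
rewrite /f big_split/= prodfV [leRHS]mulrC -expR_sum -mulr_sumr -/(truncated_sum tau k w).
apply: ler_pM; rewrite ?expR_ge0 ?invr_ge0 ?(ltW B0)//.
- by rewrite ler_expR ler_wpM2l.
- by rewrite lef_pV2 ?hB// posrE// prodr_gt0.
Qed.

Variable del : R.
Hypothesis del0 : 0 < del.
Hypothesis del1 : del <= 1.

(** With lam = sqrt 2 this gives lam * tau = del / 8, the value of eta in the moment generating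
    function estimates. *)
Let tau : R := del / 8 / Num.sqrt 2.

Let tau0 : 0 < tau.
Proof. by rewrite !divr_gt0// sqrtr_gt0. Qed.

Let bound N : R := (1 + del) * (Num.sqrt 2 * Num.sqrt (N%:R * ll (lg N))).

Let truncated_exceed N : set T :=
  [set w | exists2 k, (k <= N)%N & (bound N <= truncated_sum tau k w)%R].

Let truncated_exceed_le : \forall N \near \oo,
  (P (truncated_exceed N) <= (expR (- (1 + del) * ll (lg N)))%:E)%E.
Proof.
have s2 : 0 < Num.sqrt 2 :> R by rewrite sqrtr_gt0.
have s22 : Num.sqrt 2 ^+ 2 = 2 :> R by rewrite sqr_sqrtr.
have lt : Num.sqrt 2 * tau <= del / 8 by rewrite /tau mulrC divfK// gt_eqF.
have e4 : del / 8 <= 4^-1 by move: del1; lra.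
have d8 : 0 < del / 8 by rewrite divr_gt0.
have h := prod_truncated_mgf_le var1 mean0 tau0 e4 s2 lt d8.
near=> N.
have N0 : (0 < N)%N by near: N; exists 1%N.
have h' : forall n m, (m <= N)%N ->
    \prod_(n <= k < m) truncated_mgf X (tau * u (lg k)) (tilt (Num.sqrt 2) N) <=
    expR (ll (lg N) * (Num.sqrt 2 ^+ 2 / 2 * (1 + 4 * (del / 8)) + del / 8)).
  by near: N; exact: h.
apply: le_trans (truncated_max_bound _ tau0 (tilt_ge0 N (ltW s2)) (expR_gt0 _) (h' 0%N)) _.
(* Exponents in units of [ll (lg N)]: 2 (1 + del) from the threshold, against 1 + del / 2 + del / 8
   from the moment generating functions; the difference exceeds 1 + del. *)
rewrite lee_fin -expRD ler_expR /bound [tilt _ _ * _]mulrCA.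
rewrite [tilt _ _ * _]mulrCA tilt_sqrt// [Num.sqrt 2 * _]mulrA -expr2 s22.
have := ll_gt0 R (lg N); move: (ll (lg N)) => L L0.
have : 0 <= L * del by rewrite mulr_ge0 ?ltW.
move: del => D; lra.
Unshelve. all: by end_near. Qed.

(** For fixed c the point 2^a * c.+1 has binary logarithm at least a, so the probability is
    eventually at most (a + 4)^-(1 + del), summable over a. The powers 2^a alone would leave gaps of
    ratio 2; varying c refines the grid. *)
Let truncated_exceed_ae (c : nat) :
  {ae P, forall w, \forall a \near \oo, ~ truncated_exceed (2 ^ a * c.+1) w}.
Proof.
have [M hM] := sum_expR_ln_bounded del0.
apply: (@borel_cantelli_near _ (fun a => expR (- (1 + del) * ll a)) M) => //.
- move=> a; rewrite /truncated_exceed (_ : [set _ | _] = \bigcup_(k in `I_(2 ^ a * c.+1).+1)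
    [set w | bound (2 ^ a * c.+1) <= truncated_sum tau k w]).
    apply: bigcup_measurable => k _; apply: measurable_superlevel.
    exact: measurable_truncated_sum.
  by apply/seteqP; split=> w [k kN h]; exists k.
have [N0 _ hN] := truncated_exceed_le.
exists N0 => // a /= Na.
have aN : (a < 2 ^ a * c.+1)%N.
  by apply: (@leq_trans (2 ^ a)); [exact: ltn_expl|rewrite leq_pmulr].
apply: (le_trans (hN _ (leq_trans Na (ltnW aN)))).
rewrite lee_fin ler_expR ler_wnM2l//; first by move: del0; lra.
apply: le_ll; apply: trunc_log_max => //.
by rewrite leq_pmulr.
Qed.

Let upper_truncated :
  {ae P, forall w, \forall n \near \oo,
    truncated_sum tau n w <=
      (1 + 2 * del) * (Num.sqrt 2 * Num.sqrt (n%:R * ll (lg n)))}.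
Proof.
have : {ae P, forall w, forall c, \forall a \near \oo,
    ~ truncated_exceed (2 ^ a * c.+1) w}.
  by apply/ae_foralln => c; exact: truncated_exceed_ae.
apply: filterS => w hw.
have [p hp] : exists p : nat, 2 / del <= 2 ^+ p.
  have /cvgryPge/(_ (2 / del))[p _ hp] := @exp2_cvgy R.
  by exists p; have := hp p (leqnn p).
have d2 : 0 < del / 2 by rewrite divr_gt0.
have {}hp : (2 ^+ p)^-1 <= del / 2.
  by rewrite -[leRHS]invrK lef_pV2 ?posrE ?exprn_gt0 ?invr_gt0// invf_div.
(* Only finitely many c occur, so one threshold [A] serves them all. *)
have hc : \forall a \near \oo, forall c : 'I_(2 ^ p.+1), ~ truncated_exceed (2 ^ a * c.+1) w.
  by apply: filter_forall => c; exact: hw.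
have [A _ hA] := hc.
have hj : \forall j \near \oo, (2 / del <= j%:R)%R by exact: nbhs_infty_ger.
near=> n.
have n0 : (0 < n)%N by near: n; exists 1%N.
have hlg : (A + p <= lg n)%N.
  near: n; have : \forall j \near \oo, (A + p <= j)%N by exists (A + p)%N.
  exact: lg_cvgy.
have hlg2 : (2 / del <= (lg n)%:R)%R by near: n; exact: lg_cvgy hj.
(* [c] is read off the p + 1 leading binary digits of n, so 2^p <= c < 2^(p + 1) and n < 2^a * c.+1
   <= n (1 + 2^-p). *)
pose a := (lg n - p)%N; pose c := (n %/ 2 ^ a)%N.
have Aa : (A <= a)%N by rewrite /a leq_subRL ?(leq_trans (leq_addl _ _) hlg)// addnC.
have lgE : lg n = (a + p)%N by rewrite /a subnK// (leq_trans (leq_addl _ _) hlg).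
have a0 : (0 < 2 ^ a)%N by rewrite expn_gt0.
have c2 : (c < 2 ^ p.+1)%N.
  by rewrite /c ltn_divLR// -expnD addSn addnC -lgE trunc_log_ltn.
have c1 : (2 ^ p <= c)%N by rewrite /c leq_divRL// -expnD addnC -lgE trunc_logP.
pose N := (2 ^ a * c.+1)%N.
have nN : (n <= N)%N.
  by rewrite /N mulnC ltnW// -ltn_divLR.
have cn : (2 ^ a * c <= n)%N by rewrite mulnC leq_divM.
have := hA a Aa (Ordinal c2); rewrite /= -/N => hex.
have : truncated_sum tau n w < bound N.
  by rewrite ltNge; apply/negP => h; apply: hex; exists n.
move=> /ltW/le_trans; apply; rewrite /bound.
have NR : N%:R <= n%:R * (1 + del / 2) :> R.
  rewrite /N mulnS natrD mulrDr mulr1 addrC; apply: lerD; first by rewrite ler_nat.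
  apply: (@le_trans _ _ (n%:R * (2 ^+ p)^-1)); last by rewrite ler_wpM2l.
  rewrite ler_pdivlMr ?exprn_gt0// -natrX -natrM ler_nat.
  by apply: leq_trans cn; rewrite leq_mul2l c1 orbT.
have llN : ll (lg N) <= ll (lg n) * (1 + del / 2).
  apply: (@le_trans _ _ (ll (lg n).+1)).
    apply: le_ll; rewrite -ltnS -(ltn_exp2l _ _ (isT : 1 < 2)%N).
    apply: (@leq_ltn_trans N); first by rewrite trunc_logP// (leq_trans n0).
    have cc : (c.+1 <= 2 ^ p.+1)%N by [].
    apply: (@leq_ltn_trans (2 ^ a * 2 ^ p.+1)); first by rewrite /N leq_mul2l cc orbT.
    by rewrite -expnD ltn_exp2l// lgE addnS.
  apply: (le_trans (llS _ _)); rewrite mulrDr mulr1 lerD2l.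
  apply: (@le_trans _ _ (1 * (del / 2))); last first.
    by rewrite ler_wpM2r ?(ltW d2)// ll_ge1.
  rewrite mul1r -[leRHS]invrK lef_pV2 ?posrE ?invr_gt0 ?ltr0n// invf_div.
  by apply: (le_trans hlg2); rewrite ler_nat -addn4 leq_addr.
have l0 := ll_gt0 R (lg n).
have sq : Num.sqrt (N%:R * ll (lg N)) <= (1 + del / 2) * Num.sqrt (n%:R * ll (lg n)).
  have d20 : 0 <= 1 + del / 2 by rewrite addr_ge0// ltW.
  rewrite -[X in _ <= X * _]ger0_norm// -sqrtr_sqr -sqrtrM ?sqr_ge0//.
  apply: ler_wsqrtr; apply: le_trans (ler_pM _ _ NR llN) _ => //.
    exact: (ltW (ll_gt0 _ _)).
  by rewrite le_eqVlt; apply/orP; left; apply/eqP; ring.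
have s0 := sqrtr_ge0 (n%:R * ll (lg n)).
rewrite [leLHS]mulrCA [leRHS]mulrCA; apply: ler_wpM2l => //.
apply: le_trans (ler_wpM2l _ sq) _; first by rewrite addr_ge0// ltW.
rewrite mulrA; apply: ler_wpM2r => //.
(* (1 + del) (1 + del / 2) <= 1 + 2 del, because del <= 1. *)
have : del * del <= del by rewrite ler_piMl// ltW.
by move: del => D; lra.
Unshelve. all: by end_near. Qed.

Lemma upper_lil_delta :
  {ae P, forall w, \forall n \near \oo,
    \sum_(0 <= k < n) X k w <=
      (1 + 3 * del) * (Num.sqrt 2 * Num.sqrt (n%:R * ll (lg n)))}.
Proof.
have h1 := upper_truncated.
have h2 := sum_tail_part_small hident var1 tau0.
apply: filterS2 h1 h2 => w h1 h2.
have {}h2 := h2 _ del0.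
near=> n.
have n0 : (0 < n)%N by near: n; exists 1%N.
have e1 : truncated_sum tau n w <=
      (1 + 2 * del) * (Num.sqrt 2 * Num.sqrt (n%:R * ll (lg n))) by near: n.
have e2 : \sum_(0 <= k < n) tail_part (tau * u (lg k)) (X k w) <= del * wt (lg n).
  by near: n.
have e3 := le_trans e2 (ler_wpM2l (ltW del0) (upper_scale_le R n0)).
have : \sum_(0 <= k < n) X k w <= truncated_sum tau n w +
    \sum_(0 <= k < n) tail_part (tau * u (lg k)) (X k w).
  rewrite -big_split/=; apply: ler_sum => k _.
  by rewrite -lerBlDl -norm_sub_truncate ler_norm.
move=> /le_trans; apply; apply: le_trans (lerD e1 e3) _.
have s0 := sqrtr_ge0 (n%:R * ll (lg n)).
have s1 : 1 <= Num.sqrt 2 :> R by rewrite -[leLHS]sqrtr1 ler_wsqrtr// ler1n.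
have : del * Num.sqrt (n%:R * ll (lg n)) <=
       del * (Num.sqrt 2 * Num.sqrt (n%:R * ll (lg n))).
  by apply: ler_wpM2l; [exact: ltW|rewrite ler_peMl].
by move: (Num.sqrt 2 * _) => Y; lra.
Unshelve. all: by end_near. Qed.

End UpperLIL.

Section Composition.
Context d (T : measurableType d) (R : realType) (P : probability T R).
Variable X : nat -> {RV P >-> R}.
Variable g : R -> R.
Hypothesis mg : measurable_fun setT g.

Definition comp_RV (k : nat) : {RV P >-> R} :=
  let m := isMeasurableFun.Build _ _ _ _ (g \o X k)
    (measurableT_comp mg (measurable_funPT (X k))) in
  HB.pack (g \o X k) m.

Lemma independent_comp : independent_RVs X -> independent_RVs comp_RV.
Proof.
move=> hX J A mA; apply: (hX J (fun i => g @^-1` A i)) => i iJ.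
by rewrite -[X in measurable X]setTI; apply: mg => //; exact: mA.
Qed.

Lemma identically_distributed_comp :
  identically_distributed X -> identically_distributed comp_RV.
Proof.
move=> hX i j A mA; apply: (hX i j (g @^-1` A)).
by rewrite -[X in measurable X]setTI; exact: mg.
Qed.

End Composition.

(** * Lower bound on blocks by exponential tilting *)

Section TiltExponents.
Context (R : realType).
Implicit Types L q D a b : R.

(** Here L stands for [ll (lg N)], q for lam^2 / 2 and D for the relative change of the tilt. Since
    2 D (1 - 2 D) + (1 - D)^2 = 1 - 3 D^2, lowering the tilt by the factor 1 - D gains 3 D^2; the
    relative errors D^2 / 2 of the two moment generating functions leave a margin of at least
    D^2. *)
Lemma tilt_exponent_lower L q D : 0 < L -> 0 < q -> 0 < D -> D <= 4^-1 ->
  D * (2 * q * (1 - 2 * D) * L) + L * (q * (1 - D) ^+ 2 * (1 + D ^+ 2 / 2)) <=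
  L * (q * (1 - D ^+ 2 / 2)) - L * (q * D ^+ 2).
Proof.
move=> L0 q0 D0 D1; have Lq0 : 0 < L * q by rewrite mulr_gt0.
suff : 0 <= L * q * (D ^+ 2 / 2 * (3 - (1 - D) ^+ 2)) by lra.
rewrite pmulr_rge0// mulr_ge0 ?divr_ge0 ?sqr_ge0//.
by have : (1 - D) ^+ 2 <= 1; [rewrite expr_le1//; lra|lra].
Qed.

(** The mirror image, from - 2 D (1 + 2 D) + (1 + D)^2 = 1 - 3 D^2. *)
Lemma tilt_exponent_upper L q D : 0 < L -> 0 < q -> 0 < D -> D <= 4^-1 ->
  - (D * (2 * q * (1 + 2 * D) * L)) + L * (q * (1 + D) ^+ 2 * (1 + D ^+ 2 / 2)) <=
  L * (q * (1 - D ^+ 2 / 2)) - L * (q * D ^+ 2).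
Proof.
move=> L0 q0 D0 D1; have Lq0 : 0 < L * q by rewrite mulr_gt0.
suff : 0 <= L * q * (D ^+ 2 / 2 * (3 - (1 + D) ^+ 2)) by lra.
rewrite pmulr_rge0// mulr_ge0 ?divr_ge0 ?sqr_ge0//.
have : (1 + D) ^+ 2 <= (5 / 4) ^+ 2 by rewrite lerXn2r ?nnegrE//; lra.
by lra.
Qed.

(** A margin of at least 4 in the exponent makes each of the two subtracted terms at most a quarter
    of the main one. Half of exp (L q (1 - k)) remains, to be divided by exp (2 q (1 + 2 D) L); this
    is at least exp (- L) / 2 as soon as q (1 + k + 4 D) <= 1, which is the origin of q = 1 / (1 + 5
    D). *)
Lemma tilt_conclusion L D a b (q := (1 + 5 * D)^-1) (k := D ^+ 2 / 2) :
  0 < L -> 0 < q -> 0 < D -> D <= 4^-1 -> 4 <= L * (q * D ^+ 2) -> 0 <= a ->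
  (expR (L * (q * (1 - k))) -
   expR (D * (2 * q * (1 - 2 * D) * L) + L * (q * (1 - D) ^+ 2 * (1 + k))) -
   expR (- (D * (2 * q * (1 + 2 * D) * L)) + L * (q * (1 + D) ^+ 2 * (1 + k)))) * a
  <= expR (2 * q * (1 + 2 * D) * L) * b ->
  expR (- L) / 2 * a <= b.
Proof.
move=> L0 q0 D0 D1 dd a0 hmain.
have exq (c : R) : expR (c - L * (q * D ^+ 2)) <= expR c / 4.
  rewrite expRB ler_pM2l ?expR_gt0// lef_pV2 ?posrE ?expR_gt0//.
  by apply: le_trans (expR_ge1Dx _); lra.
have ex1 := le_trans (etrans (ler_expR _ _) (tilt_exponent_lower L0 q0 D0 D1)) (exq _).
have ex2 := le_trans (etrans (ler_expR _ _) (tilt_exponent_upper L0 q0 D0 D1)) (exq _).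
have hmain2 : expR (L * (q * (1 - k))) / 2 * a <= expR (2 * q * (1 + 2 * D) * L) * b.
  apply: le_trans hmain; apply: ler_wpM2r => //.
  move: ex1 ex2; rewrite -/k.
  set x := expR (D * _ + _); set y := expR (- _ + _); move: (expR _) x y => z x y; lra.
have hq : q * (1 + k + 4 * D) <= 1.
  rewrite /q ler_pdivrMl; last by lra.
  rewrite mulr1 /k; have : D ^+ 2 <= D * 4^-1 by rewrite expr2 ler_pM2l.
  by lra.
rewrite -(@ler_pM2l _ (expR (2 * q * (1 + 2 * D) * L))) ?expR_gt0//.
apply: le_trans hmain2; rewrite !mulrA; apply: ler_wpM2r => //.
rewrite ler_wpM2r ?invr_ge0// -expRD ler_expR.
have := ler_wpM2l (ltW L0) hq.
clear hmain ex1 ex2 exq q0 hq dd; move: q k => Q K; lra.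
Qed.

End TiltExponents.

Section LowerLIL.
Context d (T : measurableType d) (R : realType) (P : probability T R).
Variable X : nat -> {RV P >-> R}.
Hypothesis hindep : independent_RVs X.
Hypothesis hident : identically_distributed X.
Hypothesis var1 : (\int[P]_w (X 0%N w ^+ 2)%:E = 1)%E.
Hypothesis mean0 : (\int[P]_w (X 0%N w)%:E = 0)%E.

Local Notation u := (lower_scale R).
Local Notation wt := (upper_scale R).
Local Notation ll := (ll R).

Definition truncated_block (tau : R) (n m : nat) (w : T) : R :=
  \sum_(n <= i < m) truncate (tau * u (lg i)) (X i w).

Lemma measurable_truncated_block tau n m :
  measurable_fun (setT : set (g_sigma_algebraType (past X m)))
    (truncated_block tau n m).
Proof.
rewrite (_ : truncated_block tau n m = fun w => \sum_(n <= i < m)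
  (if (i < m)%N then truncate (tau * u (lg i)) (X i w) else 0)); last first.
  apply/funext => w; rewrite /truncated_block big_nat_cond [RHS]big_nat_cond.
  by apply: eq_bigr => i /andP[/andP[_ ->]].
apply: measurable_sum => i; case: ltnP => im; last exact: measurable_cst.
apply: (measurableT_comp (measurable_truncate _)); exact: measurable_past_X.
Qed.

Lemma integral_exp_block tau theta n m (E : set T) : 0 < tau -> (n <= m)%N ->
  <<s past X n>> E ->
  (\int[P]_w (\1_E w * expR (theta * truncated_block tau n m w))%:E =
   P E * (\prod_(n <= i < m) truncated_mgf X (tau * u (lg i)) theta)%:E)%E.
Proof.
move=> tau0 nm sE.
have b0 i : 0 <= tau * u (lg i).
  by rewrite mulr_ge0 ?(ltW tau0) ?(ltW (lower_scale_gt0 _ _)).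
pose f i (z : R) := expR (theta * truncate (tau * u (lg i)) z).
have mf i : measurable_fun setT (f i).
  apply: measurableT_comp => //.
  by apply: measurable_funM => //; exact: measurable_truncate.
have f0 i z : 0 <= f i z by exact: expR_ge0.
have mE : measurable E by exact: (sigma_past_measurable sE).
transitivity (\int[P]_w (\1_E w * \prod_(n <= i < m) f i (X i w))%:E)%E.
  by apply: eq_integral => w _; rewrite /truncated_block mulr_sumr expR_sum.
rewrite (integral_prod_indep hindep mf f0)//.
rewrite integral_indic// setIT; congr (_ * _)%E.
rewrite -prodEFin; apply: eq_bigr => i _.
exact: integral_truncated_exp.
Qed.

(* Cramer's lower bound: under the measure tilted by exp(theta S), the variable
   S concentrates between x1 and x2. *)
Lemma tilted_lower_bound (E : set T) (S : T -> R) (theta theta' x1 x2 A B C : R) :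
  measurable E -> measurable_fun setT S -> 0 <= theta -> 0 <= theta' ->
  (A%:E * P E <= \int[P]_w (\1_E w * expR (theta * S w))%:E)%E ->
  (\int[P]_w (\1_E w * expR ((theta - theta') * S w))%:E <= B%:E * P E)%E ->
  (\int[P]_w (\1_E w * expR ((theta + theta') * S w))%:E <= C%:E * P E)%E ->
  ((A - expR (theta' * x1) * B - expR (- (theta' * x2)) * C)%:E * P E <=
   (expR (theta * x2))%:E * P (E `&` [set w | (x1 <= S w)%R]))%E.
Proof.
move=> mE mS th0 th0' hA hB hC.
pose F := [set w | x1 <= S w].
have mF : measurable F by exact: measurable_superlevel.
have mI c : measurable_fun setT (fun w => \1_E w * expR (c * S w)).
  apply: measurable_funM => //; apply: measurableT_comp => //.
  by apply: measurable_funM.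
have I0 c w : 0 <= \1_E w * expR (c * S w) by rewrite mulr_ge0 ?expR_ge0.
pose g1 w := expR (theta * x2) * \1_(E `&` F) w.
pose g2 w := expR (theta' * x1) * (\1_E w * expR ((theta - theta') * S w)).
pose g3 w := expR (- (theta' * x2)) * (\1_E w * expR ((theta + theta') * S w)).
have mg1 : measurable_fun setT g1.
  apply: measurable_funM => //; apply: measurable_indic; exact: measurableI.
have mg2 : measurable_fun setT g2 by apply: measurable_funM => //; exact: mI.
have mg3 : measurable_fun setT g3 by apply: measurable_funM => //; exact: mI.
have g10 w : 0 <= g1 w by rewrite mulr_ge0 ?expR_ge0.
have g20 w : 0 <= g2 w by rewrite mulr_ge0 ?expR_ge0.
have g30 w : 0 <= g3 w by rewrite mulr_ge0 ?expR_ge0.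
(* Three cases on E: for x1 <= S <= x2 the first term dominates; for S > x2 the factor exp (theta'
   (S - x2)) >= 1 gives the third; for S < x1 the factor exp (theta' (x1 - S)) >= 1 gives the
   second. *)
have key w : \1_E w * expR (theta * S w) <= g1 w + g2 w + g3 w.
  rewrite /g1 /g2 /g3 !indicE in_setI; case: (w \in E) => /=; last first.
    by rewrite !mul0r !mulr0 !addr0.
  rewrite !mul1r -!expRD.
  have [h1|h1] := lerP x1 (S w).
    have -> : w \in F by rewrite inE.
    rewrite mulr1; have [h2|h2] := lerP (S w) x2.
      rewrite -addrA; apply: ler_wpDr; first by rewrite addr_ge0 ?expR_ge0.
      by rewrite ler_expR ler_wpM2l.
    apply: ler_wpDl; first by rewrite addr_ge0 ?expR_ge0.
    rewrite ler_expR -subr_ge0.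
    rewrite (_ : _ - _ = theta' * (S w - x2)); last by ring.
    by rewrite mulr_ge0// subr_ge0 ltW.
  apply: ler_wpDr; first by rewrite expR_ge0.
  apply: ler_wpDl; first by rewrite mulr_ge0 ?expR_ge0.
  rewrite ler_expR -subr_ge0 (_ : _ - _ = theta' * (x1 - S w)); last by ring.
  by rewrite mulr_ge0// subr_ge0 ltW.
have i1 : (\int[P]_w (g1 w)%:E = (expR (theta * x2))%:E * P (E `&` F))%E.
  under eq_integral do rewrite EFinM.
  rewrite ge0_integralZl//.
  - by rewrite integral_indic ?setIT//; exact: measurableI.
  - by apply/measurable_EFinP; apply: measurable_indic; exact: measurableI.
have i2 : (\int[P]_w (g2 w)%:E <= (expR (theta' * x1) * B)%:E * P E)%E.
  under eq_integral do rewrite EFinM.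
  rewrite ge0_integralZl//.
  - rewrite EFinM -muleA; apply: lee_wpmul2l => //; by rewrite lee_fin expR_ge0.
  - by apply/measurable_EFinP; exact: mI.
have i3 : (\int[P]_w (g3 w)%:E <= (expR (- (theta' * x2)) * C)%:E * P E)%E.
  under eq_integral do rewrite EFinM.
  rewrite ge0_integralZl//.
  - rewrite EFinM -muleA; apply: lee_wpmul2l => //; by rewrite lee_fin expR_ge0.
  - by apply/measurable_EFinP; exact: mI.
have : (A%:E * P E <= (expR (theta * x2))%:E * P (E `&` F) +
   (expR (theta' * x1) * B)%:E * P E + (expR (- (theta' * x2)) * C)%:E * P E)%E.
  apply: (le_trans hA).
  apply: (@le_trans _ _ (\int[P]_w ((g1 w + g2 w)%:E + (g3 w)%:E))%E).
    apply: ge0_le_integral => //.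
    - by apply/measurable_EFinP; exact: mI.
    - under eq_fun do rewrite -EFinD.
      by apply/measurable_EFinP; apply: measurable_funD => //; exact: measurable_funD.
    - by move=> w _; rewrite -EFinD lee_fin.
  rewrite ge0_integralD//; last 4 first.
  - by move=> w _; rewrite lee_fin addr_ge0.
  - by apply/measurable_EFinP; exact: measurable_funD.
  - by move=> w _; rewrite lee_fin.
  - exact/measurable_EFinP.
  under [X in (X + _)%E]eq_integral do rewrite EFinD.
  rewrite ge0_integralD//; last 4 first.
  - by move=> w _; rewrite lee_fin.
  - exact/measurable_EFinP.
  - by move=> w _; rewrite lee_fin.
  - exact/measurable_EFinP.
  by rewrite i1; apply: leeD => //; exact: leeD.
rewrite -(fineK (fin_num_measure P _ mE)).
rewrite -(fineK (fin_num_measure P _ (measurableI _ _ mE mF))).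
rewrite -!EFinM -!EFinD !lee_fin.
move: (fine (P E)) (fine (P (E `&` F))) => a b; lra.
Qed.

Variable del : R.
Hypothesis del0 : 0 < del.
Hypothesis del1 : del <= 4^-1.

Let Q : R := (1 + 5 * del)^-1.
Let kap : R := del ^+ 2 / 2.
Let lam : R := Num.sqrt 2 * Num.sqrt Q.
Let eta : R := kap / 8.
Let tau : R := eta / 2.

Let Q_ge : 4 / 9 <= Q.
Proof.
rewrite /Q -[leLHS]invrK lef_pV2 ?posrE; last 2 first.
- by move: del0; lra.
- by move: del0; lra.
by rewrite invf_div; move: del1; lra.
Qed.

Let Q_gt0 : 0 < Q.
Proof. by move: Q_ge; lra. Qed.

Let Q_le : Q <= 1.
Proof. by rewrite /Q invf_le1; move: del0; lra. Qed.

Let lam_sqr : lam ^+ 2 = 2 * Q.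
Proof.
by rewrite /lam exprMn !sqr_sqrtr//; move: Q_ge; lra.
Qed.

Let kap_gt0 : 0 < kap.
Proof. by rewrite /kap divr_gt0 ?exprn_gt0. Qed.

Let kap_le : kap <= 32^-1.
Proof.
have : del ^+ 2 <= 4^-1 ^+ 2 by rewrite lerXn2r ?nnegrE ?(ltW del0) ?invr_ge0.
by rewrite /kap; lra.
Qed.

Let lam_gt0 : 0 < lam.
Proof. by rewrite /lam mulr_gt0 ?sqrtr_gt0//; move: Q_ge; lra. Qed.

Let lam_le : lam * (1 + del) <= 2.
Proof.
have h0 : 0 <= lam * (1 + del) by rewrite mulr_ge0 ?(ltW lam_gt0)// addr_ge0// ltW.
rewrite -(@ler_pXn2r _ 2) ?nnegrE//.
rewrite exprMn lam_sqr.
have : (1 + del) ^+ 2 <= (5 / 4) ^+ 2.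
  by rewrite lerXn2r ?nnegrE//; move: del0 del1; lra.
have : 0 <= (1 + del) ^+ 2 by exact: sqr_ge0.
by move: Q_le Q_ge; move: Q => q; nra.
Qed.

Let tau0 : 0 < tau.
Proof. by rewrite /tau /eta; move: kap_gt0; lra. Qed.

Let block_bound_upper (s : R) : 1 - del <= s -> s <= 1 + del ->
  \forall N \near \oo, forall n m, (m <= N)%N ->
    \prod_(n <= k < m) truncated_mgf X (tau * u (lg k)) (tilt (lam * s) N) <=
    expR (ll (lg N) * (Q * s ^+ 2 * (1 + kap))).
Proof.
move=> s1 s2.
have s0 : 3 / 4 <= s by move: del1; lra.
have ls0 : 0 < lam * s by rewrite mulr_gt0//; lra.
have lt : lam * s * tau <= eta.
  rewrite /tau mulrCA ler_piMr ?(ltW (divr_gt0 kap_gt0 _))// ler_pdivrMr// mul1r.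
  by apply: le_trans lam_le; rewrite ler_pM2l.
have e4 : eta <= 4^-1 by rewrite /eta; move: kap_le; lra.
have e0 : 0 < kap / 8 by rewrite divr_gt0.
have h := prod_truncated_mgf_le var1 mean0 tau0 e4 ls0 lt e0.
near=> N => n m mN.
have /(_ n m mN)/le_trans : forall n m, (m <= N)%N ->
    \prod_(n <= k < m) truncated_mgf X (tau * u (lg k)) (tilt (lam * s) N) <=
    expR (ll (lg N) * ((lam * s) ^+ 2 / 2 * (1 + 4 * eta) + kap / 8)).
  by near: N; exact: h.
apply; rewrite ler_expR ler_pM2l ?ll_gt0// exprMn lam_sqr /eta.
have : (3 / 4) ^+ 2 <= s ^+ 2 by rewrite lerXn2r ?nnegrE//; lra.
move: (s ^+ 2) => S hS.
(* The errors are Q s^2 kap / 2 and kap / 8. Since Q s^2 >= (4 / 9) (9 / 16) = 1 / 4, the second is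
   at most Q s^2 kap / 2 as well. *)
have : 4^-1 * kap <= Q * S * kap.
  rewrite ler_pM2r//; move: Q_ge; move: Q => q; nra.
by move: kap_gt0; move: kap Q => K q; lra.
Unshelve. all: by end_near. Qed.

Let block_bound_lower :
  \forall N \near \oo, forall n, n%:R <= kap / 8 * N%:R ->
    expR (ll (lg N) * (Q * (1 - kap))) <=
    \prod_(n <= k < N) truncated_mgf X (tau * u (lg k)) (tilt lam N).
Proof.
have lt : lam * tau <= eta.
  rewrite /tau mulrCA ler_piMr ?(ltW (divr_gt0 kap_gt0 _))// ler_pdivrMr// mul1r.
  by apply: le_trans lam_le; rewrite ler_peMr ?(ltW lam_gt0)// lerDl ltW.
have e4 : eta <= 4^-1 by rewrite /eta; move: kap_le; lra.
have e0 : 0 < kap / 8 by rewrite divr_gt0.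
have k01 : 0 <= kap / 8 <= 1 by rewrite (ltW e0)/=; move: kap_le; lra.
have h := prod_truncated_mgf_ge var1 mean0 tau0 e4 lam_gt0 lt k01 e0.
near=> N => n nN.
have /(_ n nN) : forall n, n%:R <= kap / 8 * N%:R ->
    expR (ll (lg N) * (lam ^+ 2 / 2 * ((1 - 4 * eta) * (1 - kap / 8)) - kap / 8)) <=
    \prod_(n <= k < N) truncated_mgf X (tau * u (lg k)) (tilt lam N).
  by near: N; exact: h.
apply: le_trans; rewrite ler_expR ler_pM2l ?ll_gt0// lam_sqr /eta.
have : 0 <= Q * kap ^+ 2 by rewrite mulr_ge0 ?sqr_ge0//; move: Q_ge; lra.
have : 4 / 9 * kap <= Q * kap by rewrite ler_pM2r.
by move: kap_gt0; move: kap Q => K q; lra.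
Unshelve. all: by end_near. Qed.

Let block_event (n N : nat) : set T :=
  [set w | (1 - 2 * del) * (lam * Num.sqrt (N%:R * ll (lg N)))
           <= truncated_block tau n N w].

Let block_event_past n N : <<s past X N>> (block_event n N).
Proof.
have := @measurable_superlevel _ (g_sigma_algebraType (past X N)) _ _
  ((1 - 2 * del) * (lam * Num.sqrt (N%:R * ll (lg N))))
  (@measurable_truncated_block tau n N).
exact.
Qed.

(** The bound is relative to an arbitrary event of the past of the block, a substitute for
    conditional probability. Its size exp (- ll (lg N)) / 2 is half of 1 / (lg N + 4), hence
    harmonic in j along N = 2^(p (j + 1)). *)
Let block_event_prob : \forall N \near \oo, forall n E,
  n%:R <= kap / 8 * N%:R -> <<s past X n>> E ->
  ((expR (- ll (lg N)) / 2)%:E * P E <= P (E `&` block_event n N))%E.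
Proof.
have d01 : 0 < 1 - del by move: del1; lra.
have hl := block_bound_lower.
have hu1 := @block_bound_upper (1 - del) (lexx _).
have hu2 := @block_bound_upper (1 + del) _ (lexx _).
have d2 : 1 - del <= 1 + del by move: del0; lra.
have {}hu1 := hu1 d2; have {}hu2 := hu2 d2.
(* This provides the margin 4 <= L * (Q * del^2) that [tilt_conclusion] asks for. *)
have hL : \forall N \near \oo, 4 / (Q * del ^+ 2) <= ll (lg N).
  have : ll (lg N) @[N --> \oo] --> +oo := cvg_comp _ _ lg_cvgy (@ll_cvgy R).
  by move=> /cvgryPge; apply.
near=> N => n E nN sE.
have N0 : (0 < N)%N by near: N; exists 1%N.
have kap1 : kap / 8 <= 1 by move: kap_le; lra.
have nN' : (n <= N)%N by rewrite -(ler_nat R) (le_trans nN)// ler_piMl.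
have hl' : expR (ll (lg N) * (Q * (1 - kap))) <=
    \prod_(n <= k < N) truncated_mgf X (tau * u (lg k)) (tilt lam N).
  have : forall n, n%:R <= kap / 8 * N%:R ->
    expR (ll (lg N) * (Q * (1 - kap))) <=
    \prod_(n <= k < N) truncated_mgf X (tau * u (lg k)) (tilt lam N).
    by near: N; exact: hl.
  exact.
have hu1' : \prod_(n <= k < N) truncated_mgf X (tau * u (lg k)) (tilt (lam * (1 - del)) N) <=
    expR (ll (lg N) * (Q * (1 - del) ^+ 2 * (1 + kap))).
  have : forall n m, (m <= N)%N ->
    \prod_(n <= k < m) truncated_mgf X (tau * u (lg k)) (tilt (lam * (1 - del)) N) <=
    expR (ll (lg N) * (Q * (1 - del) ^+ 2 * (1 + kap))) by near: N; exact: hu1.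
  exact.
have hu2' : \prod_(n <= k < N) truncated_mgf X (tau * u (lg k)) (tilt (lam * (1 + del)) N) <=
    expR (ll (lg N) * (Q * (1 + del) ^+ 2 * (1 + kap))).
  have : forall n m, (m <= N)%N ->
    \prod_(n <= k < m) truncated_mgf X (tau * u (lg k)) (tilt (lam * (1 + del)) N) <=
    expR (ll (lg N) * (Q * (1 + del) ^+ 2 * (1 + kap))) by near: N; exact: hu2.
  exact.
have hL' : 4 / (Q * del ^+ 2) <= ll (lg N) by near: N; exact: hL.
pose th := tilt lam N; pose sq := Num.sqrt (N%:R * ll (lg N)).
have th0 : 0 <= th by exact: tilt_ge0 (ltW lam_gt0).
have mE : measurable E by exact: (sigma_past_measurable sE).
have mS : measurable_fun [set: T] (truncated_block tau n N).
  exact: (measurable_past_fun (@measurable_truncated_block tau n N)).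
have PE0 : (0 <= P E)%E by [].
have := @tilted_lower_bound E (truncated_block tau n N) th (del * th)
  ((1 - 2 * del) * (lam * sq)) ((1 + 2 * del) * (lam * sq))
  (expR (ll (lg N) * (Q * (1 - kap))))
  (expR (ll (lg N) * (Q * (1 - del) ^+ 2 * (1 + kap))))
  (expR (ll (lg N) * (Q * (1 + del) ^+ 2 * (1 + kap)))) mE mS th0.
have c1 : th - del * th = tilt (lam * (1 - del)) N by rewrite /th /tilt; ring.
have c2 : th + del * th = tilt (lam * (1 + del)) N by rewrite /th /tilt; ring.
rewrite c1 c2 !integral_exp_block//.
have e1 (a b : R) : a <= b -> (a%:E * P E <= P E * b%:E)%E.
  by move=> ab; rewrite muleC lee_wpmul2l.
have e2 (a b : R) : a <= b -> (P E * a%:E <= b%:E * P E)%E.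
  by move=> ab; rewrite [leRHS]muleC lee_wpmul2l.
have dth0 : 0 <= del * th by rewrite mulr_ge0// ltW.
move=> /(_ dth0 (e1 _ _ hl') (e2 _ _ hu1') (e2 _ _ hu2')).
rewrite -/(block_event n N).
have thx c : th * (c * (lam * sq)) = 2 * Q * c * ll (lg N).
  transitivity (c * lam * (th * sq)); first by ring.
  rewrite /th /sq tilt_sqrt//.
  by transitivity (c * lam ^+ 2 * ll (lg N)); [ring|rewrite lam_sqr; ring].
rewrite -![del * th * _]mulrA !thx => hmain.
set L := ll (lg N) in hmain hL' *.
have L0 : 0 < L by exact: ll_gt0.
rewrite -!expRD in hmain.
have mEB : measurable (E `&` block_event n N).
  apply: measurableI => //; exact: (sigma_past_measurable (@block_event_past n N)).
rewrite -(fineK (fin_num_measure P _ mE)) -(fineK (fin_num_measure P _ mEB)) in hmain *.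
rewrite -!EFinM !lee_fin in hmain *.
have a0 : 0 <= fine (P E) by exact: fine_ge0.
move: hmain a0; move: (fine (P E)) (fine (P (E `&` _))) => a b hmain a0.
have Q0 := Q_gt0.
have dd : 4 <= L * (Q * del ^+ 2).
  by move: hL'; rewrite ler_pdivrMr// mulr_gt0// exprn_gt0.
exact: (tilt_conclusion L0 Q0 del0 del1 dd a0 hmain).
Unshelve. all: by end_near. Qed.

(** The divergent half of Borel-Cantelli by hand: relative to the past, block j succeeds with
    probability at least c / (j + 1), whose sum diverges, so failing from some block on has
    probability 0. The condition on p makes the start of a block at most a fraction kap / 8 of its
    end. *)
Let block_event_io (p : nat) : (2 ^+ p)^-1 <= kap / 8 ->
  {ae P, forall w, forall m, exists2 j, (m <= j)%N &
     block_event (2 ^ (p * j)) (2 ^ (p * j.+1)) w}.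
Proof.
move=> hp.
have p0 : (0 < p)%N.
  by rewrite lt0n; apply/eqP => p0; move: hp kap_le; rewrite p0 expr0 invr1; lra.
have [N0 _ hN0] := block_event_prob.
pose B j := block_event (2 ^ (p * j)) (2 ^ (p * j.+1)).
(* From lg N = p (j + 1) and p (j + 1) + 4 <= (p + 4) (j + 1), the probability 1 / (2 (p (j + 1) +
   4)) is at least c / (j + 1). *)
pose c : R := (2 * p.+4%:R)^-1.
have c0 : 0 < c by rewrite invr_gt0 mulr_gt0// ltr0n.
have mB j : measurable (B j) by exact: (sigma_past_measurable (@block_event_past _ _)).
have hB j E : (N0 <= j)%N -> <<s past X (2 ^ (p * j))>> E ->
    ((c / j.+1%:R)%:E * P E <= P (E `&` B j))%E.
  move=> Nj sE.
  have jN : (N0 <= 2 ^ (p * j.+1))%N.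
    apply: (leq_trans Nj); apply: (@leq_trans (p * j.+1)).
      by rewrite (leq_trans (leqnSn j))// leq_pmull.
    by rewrite ltnW// ltn_expl.
  have nN : (2 ^ (p * j))%:R <= kap / 8 * (2 ^ (p * j.+1))%:R.
    rewrite mulnS expnD natrM mulrA [(2 ^ p)%:R]natrX -[leLHS]mul1r ler_wpM2r//.
    by rewrite -ler_pdivrMr ?exprn_gt0// mul1r.
  have := hN0 _ jN _ _ nN sE; apply: le_trans; apply: lee_wpmul2r => //.
  rewrite lee_fin trunc_expnK// expRN lnK ?posrE ?ltr0n// /c -!invfM lef_pV2 ?posrE; last 2 first.
    by rewrite mulr_gt0 ?ltr0n.
    by rewrite !mulr_gt0 ?ltr0n.
  rewrite [leLHS]mulrC -mulrA ler_wpM2l// -natrM ler_nat.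
  by rewrite -(addn4 (p * j.+1)) -(addn4 p) mulnDl leq_add2l leq_pmulr.
have hE m : (N0 <= m)%N -> P.-negligible (\bigcap_(j in [set j | (m <= j)%N]) ~` B j).
  move=> Nm.
  (* [E k] is the event that none of the blocks m, ..., m + k - 1 succeeds. It lies in the past of
     block m + k, so its probability shrinks at least by the factor 1 - c / (m + k + 1) in the next
     step. *)
  pose E := fix E k : set T := if k is k'.+1 then E k' `&` ~` B (m + k')%N else setT.
  have sE k : <<s past X (2 ^ (p * (m + k)))>> (E k).
    elim: k => [|k IH] /=.
      exact: (@measurableT _ (g_sigma_algebraType (past X (2 ^ (p * (m + 0)))))).
    apply: (@measurableI _ (g_sigma_algebraType (past X (2 ^ (p * (m + k.+1)))))).
      apply: sigma_past_le IH; rewrite leq_exp2l// leq_mul2l addnS leqnSn orbT//.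
    apply: (@measurableC _ (g_sigma_algebraType (past X (2 ^ (p * (m + k.+1)))))).
    by rewrite addnS; exact: block_event_past.
  have mE k : measurable (E k) by exact: (sigma_past_measurable (sE k)).
  pose e k := fine (P (E k)).
  have e0 k : 0 <= e k by exact: fine_ge0.
  have estep k : e k.+1 <= e k * expR (- (c / (m + k).+1%:R)).
    have : (P (E k.+1) + P (E k `&` B (m + k)%N) = P (E k))%E.
      rewrite /= -measureU//; last 3 first.
      - by apply: measurableI => //; exact: measurableC.
      - exact: measurableI.
      - by apply/seteqP; split=> // w /= [[_ h] [_ h']].
      by rewrite -setIUr setUC setUv setIT.
    have := hB (m + k)%N (E k) (leq_trans Nm (leq_addr _ _)) (sE k).
    rewrite -(fineK (fin_num_measure P _ (mE k))) -(fineK (fin_num_measure P _ (mE k.+1))).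
    rewrite -(fineK (fin_num_measure P _ (measurableI _ _ (mE k) (mB (m + k)%N)))).
    rewrite -EFinM -EFinD lee_fin => h1 [h2].
    apply: (@le_trans _ _ (e k * (1 + - (c / (m + k).+1%:R)))); last first.
      by apply: ler_wpM2l => //; exact: expR_ge1Dx.
    have h2' : e k.+1 + fine (P (E k `&` B (m + k)%N)) = e k := h2.
    have h1' : c / (m + k).+1%:R * e k <= fine (P (E k `&` B (m + k)%N)) := h1.
    rewrite mulrDr mulr1 mulrN lerBrDr -[leRHS]h2' lerD2l; apply: le_trans h1'.
    by rewrite mulrC.
  have ebound k : e k <= expR (- c * \sum_(0 <= i < k) (m + i).+1%:R^-1).
    elim: k => [|k IH].
      rewrite big_geq// mulr0 expR0 -lee_fin fineK ?fin_num_measure//.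
      exact: probability_le1.
    apply: (le_trans (estep k)); rewrite big_nat_recr//= mulrDr expRD.
    rewrite -[- (c / _)]mulNr; apply: ler_wpM2r => //; exact: expR_ge0.
  have mI : measurable (\bigcap_(j in [set j | (m <= j)%N]) ~` B j).
    by apply: bigcap_measurable => [|j _]; [exists m => /=|exact: measurableC].
  apply/negligibleP => //; apply/eqP; rewrite eq_le measure_ge0 andbT.
  apply/lee_addgt0Pr => r r0; rewrite add0e.
  pose C := \sum_(0 <= i < m) (i.+1%:R^-1 : R).
  have [k hk] : exists k : nat, - ln r / c + C <= ln (m + k).+1%:R.
    have /cvgryPge/(_ (- ln r / c + C))[K _ hK] := @ln_natr_cvgy R.
    by exists K; apply: hK => /=; rewrite (leq_trans (leq_addl m K)).
  apply: (@le_trans _ _ (P (E k))).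
    apply: le_measure; rewrite ?inE// => w hw.
    elim: k {hk} => //= k IH; split=> //; apply: hw => /=; exact: leq_addr.
  rewrite -(fineK (fin_num_measure P _ (mE k))) lee_fin; apply: (le_trans (ebound k)).
  rewrite -[leRHS](@lnK _ r) ?posrE// ler_expR mulNr lerNl.
  rewrite -ler_pdivrMl// mulrC.
  have : ln (m + k).+1%:R <= C + \sum_(0 <= i < k) ((m + i).+1%:R^-1 : R).
    apply: (le_trans (ln_le_harmonic _ _)); rewrite (big_cat_nat (n := m)) ?leq_addr//= lerD2l.
    rewrite -{1}[m]add0n big_addn addKn.
    by apply: ler_sum => i _; rewrite addnC.
  by move: hk; lra.
have hae m : {ae P, forall w, exists2 j, (m <= j)%N & B j w}.
  apply: negligibleS (hE (maxn m N0) (leq_maxr _ _)) => w /= hw j /= mj hBj.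
  by apply: hw; exists j => //; exact: leq_trans (leq_maxl _ _) mj.
exact/ae_foralln.
Qed.

Lemma lower_lil_delta :
  {ae P, forall w, forall m, exists2 n, (m <= n)%N &
    (1 - 9 * del) * (Num.sqrt 2 * Num.sqrt (n%:R * ll (lg n)))
    <= \sum_(0 <= k < n) X k w}.
Proof.
have [p hp] : exists p : nat, (2 ^+ p)^-1 <= kap / 8.
  have /cvgryPge/(_ (8 / kap))[p _ hp] := @exp2_cvgy R.
  exists p; have := hp p (leqnn p); rewrite /= => h.
  by rewrite -(invf_div 8 kap) lef_pV2 ?posrE ?exprn_gt0// divr_gt0.
have p0 : (0 < p)%N.
  by rewrite lt0n; apply/eqP => p0; move: hp kap_le; rewrite p0 expr0 invr1; lra.
(* The sum before the block is bounded below by the upper law for - X. With parameter 1 / 3 that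
   bound is twice the scale at n, and as n <= (del / 4)^2 N, where (del / 4)^2 = kap / 8, it costs
   at most del / 2 of the scale at N. *)
have mopp : measurable_fun [set: R] (fun x : R => - x) by exact: measurable_funN.
pose Y := comp_RV X mopp.
have t0 : 0 < 3^-1 :> R by rewrite invr_gt0.
have t1 : 3^-1 <= 1 :> R by rewrite invf_le1// ler1n.
have varY : (\int[P]_w (Y 0%N w ^+ 2)%:E = 1)%E.
  by rewrite -var1; apply: eq_integral => w _ /=; rewrite sqrrN.
have meanY : (\int[P]_w (Y 0%N w)%:E = 0)%E.
  have := integralZl measurableT (integrable_X0 var1) (-1).
  rewrite /= mean0 mule0 => <-; apply: eq_integral => w _.
  by rewrite -EFinM mulN1r.
have h1 := upper_lil_delta (independent_comp mopp hindep)
  (identically_distributed_comp mopp hident) varY meanY t0 t1.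
have h2 := sum_tail_part_small hident var1 tau0.
have h3 := block_event_io hp.
apply: filterS3 h1 h2 h3 => w [K1 _ hK1] h2w h3w m.
have [K2 _ hK2] := h2w _ del0.
have [j hj hBj] := h3w (maxn m (maxn K1 K2)).+1.
have jn : (j <= 2 ^ (p * j))%N by rewrite (leq_trans (leq_pmull j p0))// ltnW// ltn_expl.
have nN : (2 ^ (p * j) <= 2 ^ (p * j.+1))%N by rewrite leq_exp2l// leq_mul2l leqnSn orbT.
move: hBj jn nN; set n := (2 ^ (p * j))%N; set N := (2 ^ (p * j.+1))%N => hBj jn nN.
have := ltnW hj; rewrite !geq_max => /and3P[mj K1j K2j].
exists N; first exact: leq_trans mj (leq_trans jn nN).
have n0 : (0 < n)%N by rewrite expn_gt0.
have N0 : (0 < N)%N by rewrite expn_gt0.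
have nNR : n%:R <= (del / 4) ^+ 2 * N%:R.
  rewrite /n /N mulnS expnD natrM mulrA [(2 ^ p)%:R]natrX -[leLHS]mul1r ler_wpM2r//.
  rewrite -ler_pdivrMr ?exprn_gt0// mul1r; apply: (le_trans hp); rewrite /kap; lra.
pose SN := Num.sqrt (N%:R * ll (lg N)).
have hSn : Num.sqrt (n%:R * ll (lg n)) <= del / 4 * SN.
  have d4 : 0 <= del / 4 by rewrite divr_ge0// ltW.
  rewrite -[X in _ <= X * _]ger0_norm// -sqrtr_sqr -sqrtrM ?sqr_ge0//.
  apply: ler_wsqrtr; rewrite mulrA; apply: ler_pM => //; first exact: (ltW (ll_gt0 _ _)).
  by apply: le_ll; exact: leq_trunc_log.
have e1 := hK1 n (leq_trans K1j jn); rewrite /= in e1.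
have e2 := hK2 N (leq_trans K2j (leq_trans jn nN)); rewrite /= in e2.
have e2' := le_trans e2 (ler_wpM2l (ltW del0) (upper_scale_le R N0)).
have e3 : truncated_block tau n N w - \sum_(0 <= k < N) tail_part (tau * u (lg k)) (X k w)
    <= \sum_(n <= k < N) X k w.
  apply: (@le_trans _ _ (truncated_block tau n N w -
      \sum_(n <= k < N) tail_part (tau * u (lg k)) (X k w))).
    rewrite lerD2l lerN2 [leRHS](big_cat_nat (n := n))//= lerDr sumr_ge0// => k _.
    exact: tail_part_ge0.
  rewrite -sumrB; apply: ler_sum => k _.
  by rewrite lerBlDr -lerBlDl -norm_sub_truncate distrC ler_norm.
have hBj' : (1 - 2 * del) * (lam * SN) <= truncated_block tau n N w by exact: hBj.
have SN0 : 0 <= SN by exact: sqrtr_ge0.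
have s1 : 1 <= Num.sqrt 2 :> R by rewrite -[leLHS]sqrtr1 ler_wsqrtr// ler1n.
have s20 : 0 <= Num.sqrt 2 * SN by rewrite mulr_ge0.
(* sqrt Q >= Q >= 1 - 5 del, whence (1 - 2 del) sqrt Q >= 1 - 7 del. The removed tails cost another
   del and the sum before n another del / 2, which stays below 9 del. *)
have e4 : (1 - 7 * del) * (Num.sqrt 2 * SN) <= (1 - 2 * del) * (lam * SN).
  rewrite /lam [_ * Num.sqrt Q]mulrC -[Num.sqrt Q * _ * _]mulrA [leRHS]mulrA ler_wpM2r//.
  have : 1 - 5 * del <= Num.sqrt Q.
    apply: (@le_trans _ _ Q).
      rewrite /Q -[leRHS]mul1r ler_pdivlMr; last by move: del0; lra.
      by have := sqr_ge0 del; lra.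
    have := sqr_sqrtr (ltW Q_gt0); have := sqrtr_ge0 Q => q0 q2.
    have : Num.sqrt Q <= 1 by rewrite -[leRHS]sqrtr1 ler_wsqrtr.
    move=> q1; apply: (@le_trans _ _ (Num.sqrt Q ^+ 2)); first by rewrite q2.
    by rewrite expr2 ler_piMr.
  have d2 : 0 <= 1 - 2 * del by move: del1; lra.
  move=> /(ler_wpM2l d2); apply: le_trans; have := sqr_ge0 del; lra.
have e5 : del * SN <= del * (Num.sqrt 2 * SN).
  by rewrite ler_pM2l// ler_peMl.
have e6 := ler_wpM2l (sqrtr_ge0 (2 : R)) hSn.
have e7 : 0 <= del * (Num.sqrt 2 * SN) by rewrite mulr_ge0// ltW.
rewrite -/SN (big_cat_nat (n := n))//=.
have : - \sum_(0 <= k < n) X k w <=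
    (1 + 3 / 3) * (Num.sqrt 2 * Num.sqrt (n%:R * ll (lg n))).
  by rewrite -sumrN; apply: le_trans e1 _.
move: e2' e3 hBj' e4 e5 e6 e7; rewrite -/SN.
move: (\sum_(0 <= k < n) X k w) (\sum_(n <= k < N) X k w) (truncated_block _ _ _ _).
move: (\sum_(0 <= k < N) _) (Num.sqrt (n%:R * _)) => A B C D E.
rewrite [Num.sqrt 2 * (del / 4 * SN)]mulrCA.
move: (Num.sqrt 2 * SN) (Num.sqrt 2 * B) (del * SN) (lam * SN) => F G H I.
move: del => DD; lra.
Qed.

End LowerLIL.

(** * Laws of large numbers and of the iterated logarithm *)

Section StrongLaw.
Context d (T : measurableType d) (R : realType) (P : probability T R).
Variable X : nat -> {RV P >-> R}.
Hypothesis hindep : independent_RVs X.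
Hypothesis hident : identically_distributed X.

(** A geometric series: the first j with 2^j >= y contributes at most 1 / y, and all later ones
    together no more. To close the induction, the remaining tail 2 / 2^J of the series is carried
    along. *)
Lemma sum_inv_pow2_le (y : R) J : 0 <= y ->
  y ^+ 2 * \sum_(0 <= j < J) ((y <= 2 ^+ j)%R%:R * (2 ^+ j)^-1) <= 2 * y.
Proof.
move=> y0; have e0 j : 0 < 2 ^+ j :> R by exact: exprn_gt0.
suff [h1 h2] : (y <= 2 ^+ J -> y * \sum_(0 <= j < J) ((y <= 2 ^+ j)%R%:R * (2 ^+ j)^-1)
      + 2 * (y * (2 ^+ J)^-1) <= 2) /\
    (2 ^+ J < y -> \sum_(0 <= j < J) ((y <= 2 ^+ j)%R%:R * (2 ^+ j)^-1) = 0 :> R).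
  rewrite expr2 -mulrA [leRHS]mulrC; apply: ler_wpM2l => //.
  have [/h1|/h2->] := leP y (2 ^+ J); last by rewrite mulr0.
  by apply: le_trans; rewrite lerDl !mulr_ge0// invr_ge0 ltW.
elim: J => [|J [IH1 IH2]].
  rewrite !big_geq// mulr0 add0r expr0 invr1 mulr1; split => // y1.
  by rewrite ler_piMr.
rewrite big_nat_recr//=; have h : (2 ^+ J.+1)^-1 = 2^-1 * (2 ^+ J)^-1 :> R.
  by rewrite exprS invfM.
have [yJ|yJ] := leP y (2 ^+ J); split.
- move=> _; have := IH1 yJ; rewrite h mul1r.
  by move: (\sum_(0 <= j < J) _) (2 ^+ J)^-1 => S e; lra.
- by rewrite exprS => h2; have := e0 J; lra.
- move=> h1; rewrite (IH2 yJ) mul0r addr0 mulr0 add0r ler_piMr//.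
  by rewrite ler_pdivrMr// mul1r.
- by move=> _; rewrite (IH2 yJ) mul0r addr0.
Qed.

Lemma sum_pow2_le (y : R) J : 0 <= y ->
  \sum_(0 <= j < J) (2 ^+ j * (2 ^+ j < y)%R%:R) <= 2 * y.
Proof.
move=> y0; suff [h _] : \sum_(0 <= j < J) (2 ^+ j * (2 ^+ j < y)%R%:R) <= 2 * y /\
  \sum_(0 <= j < J) (2 ^+ j * (2 ^+ j < y)%R%:R) <= 2 ^+ J :> R by exact: h.
elim: J => [|J [IH1 IH2]]; first by rewrite !big_geq// mulr_ge0.
rewrite !big_nat_recr//= exprS; have e0 : 0 < 2 ^+ J :> R by exact: exprn_gt0.
by case: ltP => yJ; rewrite ?mulr1 ?mulr0; split; lra.
Qed.

Section NonnegativeAverage.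
Variable phi : R -> R.
Hypothesis mphi : measurable_fun setT phi.
Hypothesis phi0 : forall x, 0 <= phi x.

Let meas_comp (g : R -> R) k : measurable_fun setT g ->
  measurable_fun setT (fun w => g (X k w)).
Proof. by move=> mg; exact: (measurableT_comp mg). Qed.

Lemma second_moment_sum (n : nat) (m s : R) :
  (\int[P]_w (phi (X 0%N w))%:E = m%:E)%E ->
  (\int[P]_w (phi (X 0%N w) ^+ 2)%:E = s%:E)%E ->
  (\int[P]_w (\sum_(0 <= k < n) phi (X k w))%:E = (n%:R * m)%:E)%E /\
  (\int[P]_w ((\sum_(0 <= k < n) phi (X k w)) ^+ 2)%:E =
    (n%:R * s + n%:R * (n%:R - 1) * m ^+ 2)%:E)%E.
Proof.
move=> hm hs.
have mS k : measurable_fun (setT : set (g_sigma_algebraType (past X k)))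
    (fun w => \sum_(0 <= i < k) phi (X i w)).
  rewrite (_ : (fun w => _) = fun w => \sum_(0 <= i < k)
    (if (i < k)%N then phi (X i w) else 0)); last first.
    apply/funext => w; rewrite big_nat_cond [RHS]big_nat_cond.
    by apply: eq_bigr => i /andP[/andP[_ ->]].
  apply: measurable_sum => i; case: ltnP => ik; last exact: measurable_cst.
  by apply: (measurableT_comp mphi); exact: measurable_past_X.
have mST k := measurable_past_fun (mS k).
have S0 k w : 0 <= \sum_(0 <= i < k) phi (X i w) by exact: sumr_ge0.
have mphi2 : measurable_fun setT (fun x => phi x ^+ 2) by exact: measurable_funX.
have mk k : (\int[P]_w (phi (X k w))%:E = m%:E)%E.
  by rewrite (ident_integral hident).
have sk k : (\int[P]_w (phi (X k w) ^+ 2)%:E = s%:E)%E.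
  by rewrite (ident_integral hident k mphi2)// => x; exact: sqr_ge0.
elim: n => [|n [IH1 IH2]].
  under eq_integral do rewrite big_geq//.
  rewrite integral0 mul0r; split => //.
  under eq_integral do rewrite big_geq// expr0n/=.
  by rewrite integral0 !mul0r addr0.
split.
  under eq_integral do rewrite big_nat_recr//= EFinD.
  rewrite ge0_integralD//; last 4 first.
  - by move=> w _; rewrite lee_fin.
  - by apply/measurable_EFinP; exact: mST.
  - by move=> w _; rewrite lee_fin.
  - by apply/measurable_EFinP; exact: meas_comp.
  by rewrite IH1 mk -EFinD -natr1 mulrDl mul1r.
pose S w := \sum_(0 <= i < n) phi (X i w).
transitivity (\int[P]_w ((S w ^+ 2)%:E + ((2 * (S w * phi (X n w)))%:E
   + (phi (X n w) ^+ 2)%:E)))%E.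
  apply: eq_integral => w _; rewrite big_nat_recr//= -/(S w) -!EFinD; congr EFin; ring.
have mSX : measurable_fun [set: T] (fun w => 2 * (S w * phi (X n w))).
  by apply: measurable_funM => //; apply: measurable_funM; [exact: mST|exact: meas_comp].
have mX2 : measurable_fun [set: T] (fun w => phi (X n w) ^+ 2).
  exact: (meas_comp _ mphi2).
rewrite ge0_integralD//; last 4 first.
- by move=> w _; rewrite lee_fin sqr_ge0.
- by apply/measurable_EFinP; apply: measurable_funX; exact: mST.
- by move=> w _; rewrite -EFinD lee_fin addr_ge0 ?sqr_ge0 ?mulr_ge0 ?S0.
- under eq_fun do rewrite -EFinD.
  by apply/measurable_EFinP; exact: measurable_funD.
rewrite ge0_integralD//; last 4 first.
- by move=> w _; rewrite lee_fin !mulr_ge0 ?S0.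
- exact/measurable_EFinP.
- by move=> w _; rewrite lee_fin sqr_ge0.
- exact/measurable_EFinP.
rewrite IH2 sk.
have -> : (\int[P]_w (2 * (S w * phi (X n w)))%:E = (2 * (n%:R * m * m))%:E)%E.
  under eq_integral do rewrite EFinM.
  rewrite ge0_integralZl//.
  - by rewrite (past_indep_fun hindep (mS n) (S0 n) mphi phi0) IH1 mk -!EFinM.
  - apply/measurable_EFinP; apply: measurable_funM; [exact: mST|exact: meas_comp].
  - by move=> w _; rewrite lee_fin mulr_ge0 ?S0.
rewrite -!EFinD; congr EFin; rewrite -natr1; ring.
Qed.

End NonnegativeAverage.

Lemma chebyshev_sum (psi : R -> R) (C : R) (n : nat) (nu s : R) :
  measurable_fun setT psi -> (forall x, 0 <= psi x <= C) -> (0 < n)%N -> 0 < nu ->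
  (\int[P]_w (psi (X 0%N w))%:E <= nu%:E)%E ->
  (\int[P]_w (psi (X 0%N w) ^+ 2)%:E <= s%:E)%E ->
  (P [set w | (2 * nu * n%:R <= \sum_(0 <= k < n) psi (X k w))%R] <=
   (s / (n%:R * nu ^+ 2))%:E)%E.
Proof.
move=> mpsi psi01 n0 nu0 hnu hs.
have psi0 x : 0 <= psi x by case/andP : (psi01 x).
pose m := \int[P]_w psi (X 0%N w); pose s2 := \int[P]_w (psi (X 0%N w) ^+ 2).
have mc k : measurable_fun setT (fun w => psi (X k w)) by exact: (measurableT_comp mpsi).
have im : P.-integrable setT (EFin \o (fun w => psi (X 0%N w))).
  apply: (@bounded_integrable _ _ _ _ _ C) => // w.
  by rewrite ger0_norm//; case/andP : (psi01 (X 0%N w)).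
have is2 : P.-integrable setT (EFin \o (fun w => psi (X 0%N w) ^+ 2)).
  apply: (@bounded_integrable _ _ _ _ _ (C ^+ 2)); first exact: measurable_funX.
  move=> w; have /andP[p0 pC] := psi01 (X 0%N w).
  by rewrite ger0_norm ?sqr_ge0// lerXn2r ?nnegrE// (le_trans p0).
have hm : (\int[P]_w (psi (X 0%N w))%:E = m%:E)%E by rewrite EFin_Rintegral.
have hs2 : (\int[P]_w (psi (X 0%N w) ^+ 2)%:E = s2%:E)%E by rewrite EFin_Rintegral.
have m0 : 0 <= m by apply: Rintegral_ge0.
have mnu : m <= nu by rewrite -lee_fin -hm.
have s2s : s2 <= s by rewrite -lee_fin -hs2.
have [h1 h2] := second_moment_sum mpsi psi0 n hm hs2.
pose S w := \sum_(0 <= k < n) psi (X k w).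
have mS : measurable_fun setT S by apply: measurable_sum => i; exact: mc.
have S0 w : 0 <= S w by exact: sumr_ge0.
have nR : 0 < n%:R :> R by rewrite ltr0n.
pose V w := (S w - n%:R * m) ^+ 2.
have mV : measurable_fun setT V.
  by apply: measurable_funX; apply: measurable_funB.
have V0 w : 0 <= V w by exact: sqr_ge0.
have iV : (\int[P]_w (V w)%:E <= (n%:R * s)%:E)%E.
  (* The identity V + 2 n m S = S^2 + (n m)^2 has nonnegative terms on both sides, so it can be
     integrated in the extended reals; subtraction comes only when the other integrals are known to
     be finite. *)
  have E : (\int[P]_w ((V w)%:E + (2 * (n%:R * m) * S w)%:E) =
            \int[P]_w ((S w ^+ 2)%:E + ((n%:R * m) ^+ 2)%:E))%E.
    by apply: eq_integral => w _; rewrite -!EFinD /V; congr EFin; ring.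
  move: E; rewrite ge0_integralD//; last 4 first.
  - by move=> w _; rewrite lee_fin.
  - exact/measurable_EFinP.
  - by move=> w _; rewrite lee_fin !mulr_ge0.
  - by apply/measurable_EFinP; apply: measurable_funM.
  rewrite ge0_integralD//; last 3 first.
  - by move=> w _; rewrite lee_fin sqr_ge0.
  - by apply/measurable_EFinP; apply: measurable_funX.
  - by move=> w _; rewrite lee_fin sqr_ge0.
  rewrite h2 integral_cst// [X in (_ + _ * X)%E](_ : _ = 1%E) ?mule1; last exact: probability_setT.
  under [X in (_ + X)%E = _]eq_integral do rewrite EFinM.
  rewrite ge0_integralZl//; last 3 first.
  - exact/measurable_EFinP.
  - by move=> w _; rewrite lee_fin.
  - by rewrite lee_fin !mulr_ge0.
  rewrite h1 -EFinM -EFinD => E.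
  have -> : (\int[P]_w (V w)%:E = (n%:R * s2 - n%:R * m ^+ 2)%:E)%E.
    move: E; case: (\int[P]_w (V w)%:E)%E => [r||]//.
    rewrite -EFinD => -[]; move: (n%:R : R) => N E; congr EFin; lra.
  rewrite lee_fin; apply: (@le_trans _ _ (n%:R * s2)).
    by rewrite gerBl mulr_ge0// sqr_ge0.
  by rewrite ler_pM2l.
apply: (@le_trans _ _ (P [set w | ((n%:R * nu) ^+ 2 <= V w)%R])).
  apply: le_measure; rewrite ?inE; [exact: measurable_superlevel|exact: measurable_superlevel|].
  move=> w /= h; rewrite /V lerXn2r ?nnegrE ?mulr_ge0 ?(ltW nu0)//.
    rewrite subr_ge0; apply: le_trans h; rewrite mulrC ler_wpM2r//.
    by move: m0 mnu nu0; lra.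
  rewrite lerBrDr; apply: le_trans h.
  have : n%:R * m <= n%:R * nu by rewrite ler_pM2l.
  by lra.
have y0 : 0 < (n%:R * nu) ^+ 2 by rewrite exprn_gt0// mulr_gt0.
apply: (le_trans (markov_ge0 _ mV V0 y0)).
apply: (@le_trans _ _ (((n%:R * nu) ^+ 2)^-1%:E * (n%:R * s)%:E)%E).
  by apply: lee_wpmul2l => //; rewrite lee_fin invr_ge0 ltW.
rewrite -EFinM lee_fin le_eqVlt; apply/orP; left; apply/eqP.
by field; rewrite !gt_eqF.
Qed.

Section DyadicBound.
Variable phi : R -> R.
Hypothesis mphi : measurable_fun setT phi.
Hypothesis phi0 : forall x, 0 <= phi x.
Variable nu : R.
Hypothesis nu0 : 0 < nu.
Hypothesis hnu : (\int[P]_w (phi (X 0%N w))%:E <= nu%:E)%E.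

(** Truncation of phi at the number 2^j of summands. At this level both the normalised second
    moments ([sqcut_sum]) and the weighted exceedance probabilities ([exceed_sum]) are summable from
    a first moment alone. *)
Let cut j x : R := phi x * (phi x <= 2 ^+ j)%R%:R.

Let mcut j : measurable_fun setT (cut j).
Proof.
rewrite (_ : cut j = fun x => if phi x <= 2 ^+ j then phi x else 0); last first.
  by apply/funext => x; rewrite /cut; case: ifP; rewrite ?mulr1 ?mulr0.
apply: measurable_fun_ifT => //; apply: measurable_fun_ler => //.
Qed.

Let cut01 j x : 0 <= cut j x <= 2 ^+ j.
Proof.
apply/andP; split; first by rewrite /cut mulr_ge0.
by rewrite /cut; case: (leP (phi x)) => h; rewrite ?mulr1 ?mulr0 ?exprn_ge0.
Qed.

Let exceed j : R := fine (P [set w | (2 ^+ j < phi (X 0%N w))%R]).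
Let sqcut j : R := \int[P]_w (cut j (X 0%N w) ^+ 2).

Let mcX g k : measurable_fun [set: R] g -> measurable_fun [set: T] (fun w => g (X k w) : R).
Proof. by move=> mg; exact: (measurableT_comp mg). Qed.

Let mexceed j k : measurable [set w | 2 ^+ j < phi (X k w)].
Proof.
rewrite (_ : [set _ | _] = ~` [set w | phi (X k w) <= 2 ^+ j]); last first.
  by apply/seteqP; split=> w /=; rewrite ltNge => /negP.
apply: measurableC; rewrite -[X in measurable X]setTI.
by apply: measurable_fun_le => //; exact: mcX.
Qed.

Let exceed_ident j k : (P [set w | (2 ^+ j < phi (X k w))%R] = (exceed j)%:E)%E.
Proof.
rewrite /exceed fineK ?fin_num_measure//.
have mA : measurable [set x : R | 2 ^+ j < phi x].
  rewrite (_ : [set _ | _] = ~` [set x | phi x <= 2 ^+ j]); last first.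
    by apply/seteqP; split=> w /=; rewrite ltNge => /negP.
  apply: measurableC; rewrite -[X in measurable X]setTI.
  exact: measurable_fun_le.
exact: (hident k 0%N mA).
Qed.

Let sqcut_sum J : \sum_(0 <= j < J) (sqcut j / 2 ^+ j) <= 2 * nu.
Proof.
have isq j : P.-integrable setT (EFin \o (fun w => cut j (X 0%N w) ^+ 2)).
  apply: (@bounded_integrable _ _ _ _ _ ((2 ^+ j) ^+ 2)).
    by apply: measurable_funX; exact: mcX.
  move=> w; have /andP[p0 pC] := cut01 j (X 0%N w).
  by rewrite ger0_norm ?sqr_ge0// lerXn2r ?nnegrE// (le_trans p0).
rewrite -lee_fin -sumEFin.
apply: (@le_trans _ _ (\int[P]_w (2 * phi (X 0%N w))%:E)%E); last first.
  under eq_integral do rewrite EFinM.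
  rewrite ge0_integralZl//.
  - by rewrite EFinM; apply: lee_wpmul2l.
  - by apply/measurable_EFinP; exact: mcX.
  - by move=> w _; rewrite lee_fin.
have -> : (\sum_(0 <= j < J) (sqcut j / 2 ^+ j)%:E =
    \int[P]_w (\sum_(0 <= j < J) (cut j (X 0%N w) ^+ 2 / 2 ^+ j)%:E))%E.
  rewrite ge0_integral_sum//.
  - apply: eq_bigr => j _; rewrite EFinM /sqcut EFin_Rintegral//.
    under [RHS]eq_integral do rewrite EFinM.
    rewrite ge0_integralZr//.
    + by apply/measurable_EFinP; apply: measurable_funX; exact: mcX.
    + by move=> w _; rewrite lee_fin sqr_ge0.
  - move=> j; apply/measurable_EFinP; apply: measurable_funM => //.
    by apply: measurable_funX; exact: mcX.
  - by move=> j w _; rewrite lee_fin divr_ge0 ?sqr_ge0 ?exprn_ge0.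
apply: ge0_le_integral => //.
- move=> w _; rewrite sumEFin lee_fin sumr_ge0// => j _.
  by rewrite divr_ge0 ?sqr_ge0 ?exprn_ge0.
- apply: emeasurable_sum => j; apply/measurable_EFinP; apply: measurable_funM => //.
  by apply: measurable_funX; exact: mcX.
- by apply/measurable_EFinP; apply: measurable_funM => //; exact: mcX.
move=> w _; rewrite sumEFin lee_fin.
apply: le_trans (sum_inv_pow2_le J (phi0 (X 0%N w))).
rewrite mulr_sumr; apply: ler_sum => j _; rewrite /cut.
by case: (phi _ <= _); rewrite ?mulr1 ?mulr0 ?mul1r// expr0n/= !mul0r mulr0.
Qed.

Let exceed_sum J : \sum_(0 <= j < J) (2 ^+ j * exceed j) <= 2 * nu.
Proof.
rewrite -lee_fin -sumEFin.
apply: (@le_trans _ _ (\int[P]_w (2 * phi (X 0%N w))%:E)%E); last first.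
  under eq_integral do rewrite EFinM.
  rewrite ge0_integralZl//.
  - by rewrite EFinM; apply: lee_wpmul2l.
  - by apply/measurable_EFinP; exact: mcX.
  - by move=> w _; rewrite lee_fin.
pose A j := [set w | 2 ^+ j < phi (X 0%N w)].
have -> : (\sum_(0 <= j < J) (2 ^+ j * exceed j)%:E =
    \int[P]_w (\sum_(0 <= j < J) (2 ^+ j * \1_(A j) w)%:E))%E.
  rewrite ge0_integral_sum//.
  - apply: eq_bigr => j _; rewrite EFinM.
    under [RHS]eq_integral do rewrite EFinM.
    rewrite ge0_integralZl//.
    + by rewrite integral_indic ?setIT//; [rewrite -(exceed_ident j 0%N)|exact: mexceed].
    + by apply/measurable_EFinP; apply: measurable_indic; exact: mexceed.
  - move=> j; apply/measurable_EFinP; apply: measurable_funM => //.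
    by apply: measurable_indic; exact: mexceed.
apply: ge0_le_integral => //.
- by move=> w _; rewrite sumEFin lee_fin sumr_ge0.
- apply: emeasurable_sum => j; apply/measurable_EFinP; apply: measurable_funM => //.
  by apply: measurable_indic; exact: mexceed.
- by apply/measurable_EFinP; apply: measurable_funM => //; exact: mcX.
move=> w _; rewrite sumEFin lee_fin.
apply: le_trans (sum_pow2_le J (phi0 (X 0%N w))).
apply: ler_sum => j _; rewrite indicE /A.
by rewrite (_ : (w \in _) = (2 ^+ j < phi (X 0%N w)))//; apply/idP/idP; rewrite inE.
Qed.

(** At the times 2^j, Chebyshev's inequality for the truncated summands and a union bound for the
    exceedances; in between, monotonicity costs a factor 2, whence 4 nu. The crude constant suffices
    for both uses: remainders with small nu in the strong law, and the order of magnitude of the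
    sums of H^q. *)
Lemma average_bounded :
  {ae P, forall w, \forall n \near \oo, \sum_(0 <= k < n) phi (X k w) <= 4 * nu * n%:R}.
Proof.
pose F j := [set w | 2 * nu * (2 ^ j)%:R <= \sum_(0 <= k < 2 ^ j) phi (X k w)].
have mF j : measurable (F j).
  apply: measurable_superlevel; apply: measurable_sum => k; exact: mcX.
have hF j : (P (F j) <= (sqcut j / 2 ^+ j / nu ^+ 2 + 2 ^+ j * exceed j)%:E)%E.
  pose G := [set w | 2 * nu * (2 ^ j)%:R <= \sum_(0 <= k < 2 ^ j) cut j (X k w)].
  pose H k := [set w | 2 ^+ j < phi (X k w)].
  have mG : measurable G.
    by apply: measurable_superlevel; apply: measurable_sum => k; exact: mcX.
  apply: (@le_trans _ _ (P (G `|` \big[setU/set0]_(0 <= k < 2 ^ j) H k))).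
    apply: le_measure; rewrite ?inE//.
      by apply: measurableU => //; apply: bigsetU_measurable => k _; exact: mexceed.
    move=> w hw; case: (pselect (exists2 k, (k < 2 ^ j)%N & H k w)) => [[k kj hk]|hn].
      by right; rewrite big_mkord -bigcup_mkord; exists k.
    left; move: hw; rewrite /F /G /=; move/le_trans; apply.
    rewrite big_nat_cond [leRHS]big_nat_cond; apply: ler_sum => k /andP[/andP[_ kj] _].
    rewrite /cut; case: (leP (phi _) (2 ^+ j)) => hk; rewrite ?mulr1//.
    by exfalso; apply: hn; exists k.
  have mU : measurable (\big[setU/set0]_(0 <= k < 2 ^ j) H k).
    by apply: bigsetU_measurable => k _; exact: mexceed.
  apply: le_trans; first exact: measureU2 mG mU.
  rewrite EFinD; apply: leeD.
    rewrite (_ : sqcut j / _ / _ = sqcut j / ((2 ^ j)%:R * nu ^+ 2)); last first.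
      by rewrite natrX; field; rewrite !gt_eqF ?exprn_gt0.
    apply: (@chebyshev_sum (cut j) (2 ^+ j)) => //.
    - by rewrite expn_gt0.
    - apply: le_trans hnu; apply: ge0_le_integral => //.
      + by move=> w _; rewrite lee_fin; case/andP : (cut01 j (X 0%N w)).
      + by apply/measurable_EFinP; exact: mcX.
      + by apply/measurable_EFinP; exact: mcX.
      + by move=> w _; rewrite lee_fin /cut; case: (leP (phi _) (2 ^+ j)); rewrite ?mulr1 ?mulr0.
    - rewrite /sqcut EFin_Rintegral//.
      apply: (@bounded_integrable _ _ _ _ _ ((2 ^+ j) ^+ 2)).
        by apply: measurable_funX; exact: mcX.
      move=> w; have /andP[p0 pC] := cut01 j (X 0%N w).
      by rewrite ger0_norm ?sqr_ge0// lerXn2r ?nnegrE// (le_trans p0).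
  apply: (@le_trans _ _ (\sum_(0 <= k < 2 ^ j) P (H k))%E).
    by rewrite !big_mkord; apply: Boole_inequality => k _; exact: mexceed.
  rewrite (eq_bigr (fun=> (exceed j)%:E)) => [|k _]; last exact: exceed_ident.
  by rewrite sumEFin sumr_const_nat subn0 lee_fin -[leLHS]mulr_natl natrX.
have hsum J : \sum_(0 <= j < J) (sqcut j / 2 ^+ j / nu ^+ 2 + 2 ^+ j * exceed j)
    <= 2 * nu / nu ^+ 2 + 2 * nu.
  rewrite big_split/=; apply: lerD => //; rewrite -mulr_suml.
  by rewrite ler_pM2r ?invr_gt0 ?exprn_gt0.
have := borel_cantelli_ev mF hF hsum; apply: filterS => w [K _ hK].
near=> n.
have n0 : (0 < n)%N by near: n; exists 1%N.
have nK : (K <= (lg n).+1)%N.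
  apply: leqW; near: n; have : \forall j \near \oo, (K <= j)%N by exists K.
  exact: lg_cvgy.
have := hK _ nK; rewrite /F /= => /negP; rewrite -ltNge => h.
apply: (@le_trans _ _ (\sum_(0 <= k < 2 ^ (lg n).+1) phi (X k w))).
  rewrite [leRHS](big_cat_nat (n := n))//=; last by rewrite ltnW// trunc_log_ltn.
  by rewrite lerDl sumr_ge0.
apply: (le_trans (ltW h)).
have : (2 ^ (lg n).+1)%:R <= 2 * n%:R :> R.
  by rewrite expnS natrM ler_pM2l// ler_nat trunc_logP.
have nu2 : 0 <= 2 * nu by rewrite mulr_ge0// ltW.
by move=> /(ler_wpM2l nu2); rewrite mulrA; lra.
Unshelve. all: by end_near. Qed.

End DyadicBound.

End StrongLaw.

Section StrongLawNonneg.
Context d (T : measurableType d) (R : realType) (P : probability T R).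
Variable X : nat -> {RV P >-> R}.
Hypothesis hindep : independent_RVs X.
Hypothesis hident : identically_distributed X.

Lemma bounded_average_le (psi : R -> R) (eps : R) :
  measurable_fun setT psi -> (forall x, `|psi x| <= 1) ->
  \int[P]_w psi (X 0%N w) = 0 -> 0 < eps -> eps <= 1 ->
  {ae P, forall w, \forall n \near \oo, \sum_(0 <= k < n) psi (X k w) <= eps * n%:R}.
Proof.
move=> mpsi psi1 ipsi e0 e1.
(* This choice makes th * eps = 4 th^2, against th^2 from each factor: the probabilities decay like
   exp (- 3 th^2 n), summable over all n. *)
pose th := eps / 4.
have th0 : 0 < th by rewrite divr_gt0.
have th4 : th <= 4^-1 by rewrite /th; lra.
pose f (k : nat) x := expR (th * psi x).
have mf k : measurable_fun setT (f k).
  by apply: measurableT_comp => //; exact: measurable_funM.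
have f0 k x : 0 <= f k x by exact: expR_ge0.
have mpX : measurable_fun [set: T] (fun w => psi (X 0%N w)).
  exact: (measurableT_comp mpsi).
have ipX : P.-integrable setT (EFin \o (fun w => psi (X 0%N w))).
  by apply: (@bounded_integrable _ _ _ _ _ 1).
have hf k : (\int[P]_w (f k (X k w))%:E <= (expR (th ^+ 2))%:E)%E.
  rewrite (ident_integral hident k (mf k) (f0 k)).
  have if0 : P.-integrable setT (EFin \o (fun w => f k (X 0%N w))).
    apply: (@bounded_integrable _ _ _ _ _ (expR th)).
      exact: (measurableT_comp (mf k)).
    move=> w; rewrite ger0_norm// ler_expR -[leRHS]mulr1 ler_pM2l//.
    by rewrite (le_trans (ler_norm _)).
  rewrite -(EFin_Rintegral if0) lee_fin.
  apply: (@le_trans _ _ (\int[P]_w ((1 + th ^+ 2) + th * psi (X 0%N w)))).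
    apply: le_Rintegral => //.
      by apply: integrable_EFinD; [exact: integrable_EFin_cst|exact: integrable_EFinZ].
    move=> w _; have hz : `|th * psi (X 0%N w)| <= 4^-1.
      rewrite normrM (gtr0_norm th0) -[leRHS]mulr1; apply: ler_pM => //; exact: ltW.
    have := expR_le_quad hz _; rewrite -/(f k (X 0%N w)) => h.
    apply: le_trans (h _) _; first by rewrite lef_pV2 ?posrE// ler_nat.
    have : (th * psi (X 0%N w)) ^+ 2 <= th ^+ 2.
      rewrite exprMn ler_piMr ?sqr_ge0// -real_normK ?num_real// expr_le1//.
    rewrite (_ : 4 * 4^-1 = 1); last by rewrite divff.
    by move: (psi _) => z; lra.
  rewrite RintegralD//; last exact: integrable_EFinZ; last exact: integrable_EFin_cst.
  rewrite RintegralZl// ipsi mulr0 addr0 Rintegral_probability_cst.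
  exact: expR_ge1Dx.
pose F n := [set w | expR (th * (eps * n%:R)) <= \prod_(0 <= k < n) f k (X k w)].
have mprod n : measurable_fun [set: T] (fun w => \prod_(0 <= k < n) f k (X k w)).
  by apply: measurable_prod => i _; exact: (measurableT_comp (mf i)).
have mF n : measurable (F n) by exact: measurable_superlevel.
pose q := expR (- (3 * th ^+ 2)).
have q1 : q < 1 by rewrite /q expR_lt1 oppr_lt0 mulr_gt0// exprn_gt0.
have hF n : (P (F n) <= (q ^+ n)%:E)%E.
  have p0 w : 0 <= \prod_(0 <= k < n) f k (X k w) by exact: prodr_ge0.
  apply: (le_trans (markov_ge0 _ (mprod n) p0 (expR_gt0 _))).
  have := @integral_prod_indep _ _ _ P X hindep f mf f0 0%N n (fun=> 1).
  move=> /(_ _ _ (leq0n n)); rewrite [X in (_ = X * _)%E](_ : _ = 1%E) => [h|]; last first.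
    rewrite integral_cst// mul1e; exact: probability_setT.
  rewrite (_ : (\int[P]_w _ = \prod_(0 <= i < n) \int[P]_w (f i (X i w))%:E)%E); last first.
    rewrite -[RHS]mul1e -h//.
    by apply: eq_integral => w _; rewrite mul1r.
  apply: (@le_trans _ _ ((expR (th * (eps * n%:R)))^-1%:E * (expR (th ^+ 2) ^+ n)%:E)%E).
    apply: lee_wpmul2l; first by rewrite lee_fin invr_ge0 expR_ge0.
    elim: n {h p0} => [|n IH]; first by rewrite big_geq.
    rewrite big_nat_recr//= exprSr EFinM; apply: lee_pmul => //.
      by apply: prode_ge0 => i _; apply: integral_ge0 => w _; rewrite lee_fin.
    by apply: integral_ge0 => w _; rewrite lee_fin.
  rewrite -EFinM lee_fin -expRN /q -!expRM_natr -expRD ler_expR.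
  by clear h p0; rewrite /th; move: (n%:R : R) => N; lra.
have hsum n : \sum_(0 <= i < n) q ^+ i <= (1 - q)^-1.
  have : (1 - q) * \sum_(0 <= i < n) q ^+ i = 1 - q ^+ n.
    elim: n => [|n IH]; first by rewrite big_geq// mulr0 expr0 subrr.
    by rewrite big_nat_recr//= mulrDr IH exprS; ring.
  move=> h; rewrite -[leRHS]mul1r ler_pdivlMr ?subr_gt0// mulrC h gerBl.
  by rewrite exprn_ge0// expR_ge0.
have := borel_cantelli_ev mF hF hsum; apply: filterS => w; apply: filterS => n.
rewrite /F /= => /negP; rewrite -ltNge -expR_sum ltr_expR -mulr_sumr ltr_pM2l//.
exact: ltW.
Qed.

Variable phi : R -> R.
Hypothesis mphi : measurable_fun setT phi.
Hypothesis phi0 : forall x, 0 <= phi x.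
Variable mu : R.
Hypothesis hmu : (\int[P]_w (phi (X 0%N w))%:E = mu%:E)%E.

Let clip (K : nat) x := Num.min (phi x) K%:R.

Let mclip K : measurable_fun setT (clip K).
Proof. by apply: measurable_minr => //; exact: measurable_cst. Qed.

Let clip01 K x : 0 <= clip K x <= K%:R.
Proof. by rewrite /clip le_min phi0 ler0n/= ge_min lexx orbT. Qed.

Let iphi : P.-integrable setT (EFin \o (fun w => phi (X 0%N w))).
Proof.
apply/integrableP; split; first by apply/measurable_EFinP; exact: (measurableT_comp mphi).
under eq_integral do rewrite gee0_abs ?lee_fin//.
by rewrite hmu ltry.
Qed.

Let iclip K : P.-integrable setT (EFin \o (fun w => clip K (X 0%N w))).
Proof.
apply: (@bounded_integrable _ _ _ _ _ K%:R); first exact: (measurableT_comp (mclip K)).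
by move=> w; have /andP[h1 h2] := clip01 K (X 0%N w); rewrite ger0_norm.
Qed.

Let clip_cvg : \int[P]_w clip K (X 0%N w) @[K --> \oo] --> mu.
Proof.
have mf n : measurable_fun setT (EFin \o (fun w => clip n (X 0%N w))).
  by apply/measurable_EFinP; exact: (measurableT_comp (mclip n)).
have mg : measurable_fun setT (EFin \o (fun w => phi (X 0%N w))).
  by apply/measurable_EFinP; exact: (measurableT_comp mphi).
have := @dominated_convergence _ _ _ P setT measurableT
  (fun n => EFin \o (fun w => clip n (X 0%N w)))
  (EFin \o (fun w => phi (X 0%N w))) (EFin \o (fun w => phi (X 0%N w))) mf mg.
case=> [| | |_ _ h].
- apply/aeW => w _; apply: cvg_near_cst; near=> K.
  rewrite /= /clip min_l//; near: K; exact: nbhs_infty_ger.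
- exact: iphi.
- apply/aeW => w n _ /=; have /andP[h1 h2] := clip01 n (X 0%N w).
  by rewrite !ger0_norm// lee_fin /clip ge_min lexx.
have h1 : (\int[P]_w (clip n (X 0%N w))%:E)%E @[n --> \oo] --> mu%:E.
  by rewrite -hmu; exact: h.
exact: (fine_cvg h1).
Unshelve. all: by end_near. Qed.

Let strong_law_eps (eps : R) : 0 < eps ->
  {ae P, forall w, \forall n \near \oo,
     `|\sum_(0 <= k < n) phi (X k w) - n%:R * mu| <= eps * n%:R}.
Proof.
move=> e0.
(* phi is split into a clipped part, centred and divided by K so that [bounded_average_le] applies
   in both directions, and a nonnegative rest of mean at most eps / 8, for which [average_bounded]
   yields 4 * (eps / 8) = eps / 2. *)
have [K K0 hK] : exists2 K, (0 < K)%N & mu - \int[P]_w clip K (X 0%N w) <= eps / 8.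
  have e8 : 0 < eps / 8 by rewrite divr_gt0.
  have /cvgrPdist_le/(_ _ e8)[N _ hN] := clip_cvg.
  exists N.+1 => //; have := hN N.+1 (leqnSn N).
  by rewrite /= ler_norml => /andP[].
have KR : 0 < K%:R :> R by rewrite ltr0n.
pose m := \int[P]_w clip K (X 0%N w).
have m01 : 0 <= m <= K%:R.
  apply/andP; split.
    by apply: Rintegral_ge0 => w _; case/andP : (clip01 K (X 0%N w)).
  rewrite -[leRHS](Rintegral_probability_cst P); apply: le_Rintegral => //.
    exact: integrable_EFin_cst.
  by move=> w _; case/andP : (clip01 K (X 0%N w)).
have mmu : m <= mu.
  rewrite -lee_fin -hmu EFin_Rintegral//; apply: ge0_le_integral => //.
  - by move=> w _; rewrite lee_fin; case/andP : (clip01 K (X 0%N w)).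
  - by apply/measurable_EFinP; exact: (measurableT_comp (mclip K)).
  - by apply/measurable_EFinP; exact: (measurableT_comp mphi).
  - by move=> w _; rewrite lee_fin /clip ge_min lexx.
pose psi x := (clip K x - m) / K%:R.
have mpsi : measurable_fun setT psi.
  by apply: measurable_funM => //; exact: measurable_funB.
have psi1 x : `|psi x| <= 1.
  rewrite /psi normrM normfV (gtr0_norm KR) ler_pdivrMr// mul1r ler_norml.
  by have /andP[h1 h2] := clip01 K x; case/andP : m01 => h3 h4; lra.
have ipsi : \int[P]_w psi (X 0%N w) = 0.
  rewrite /psi RintegralZr//; last first.
    by apply: integrable_EFinB => //; exact: integrable_EFin_cst.
  rewrite RintegralB//; last exact: integrable_EFin_cst.
  by rewrite Rintegral_probability_cst subrr mul0r.
pose e' := Num.min 1 (eps / (2 * K%:R)).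
have e'0 : 0 < e' by rewrite lt_min ltr01 divr_gt0// mulr_gt0.
have e'1 : e' <= 1 by rewrite ge_min lexx.
have e'K : K%:R * e' <= eps / 2.
  have : e' <= eps / (2 * K%:R) by rewrite ge_min lexx orbT.
  by rewrite ler_pdivlMr ?mulr_gt0//; lra.
have mpsiN : measurable_fun setT (fun x => - psi x) by exact: measurable_funN.
have psiN1 x : `|- psi x| <= 1 by rewrite normrN.
have ipX : P.-integrable setT (EFin \o (fun w => psi (X 0%N w))).
  by apply: (@bounded_integrable _ _ _ _ _ 1) => //; exact: (measurableT_comp mpsi).
have ipsiN : \int[P]_w - psi (X 0%N w) = 0.
  under eq_Rintegral do rewrite -mulN1r.
  by rewrite RintegralZl// ipsi mulr0.
have h1 := bounded_average_le mpsi psi1 ipsi e'0 e'1.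
have h2 := bounded_average_le mpsiN psiN1 ipsiN e'0 e'1.
pose rest x := phi x - clip K x.
have mrest : measurable_fun setT rest by exact: measurable_funB.
have rest0 x : 0 <= rest x by rewrite /rest subr_ge0 /clip ge_min lexx.
have e80 : 0 < eps / 8 by rewrite divr_gt0.
have irest : (\int[P]_w (rest (X 0%N w))%:E <= (eps / 8)%:E)%E.
  rewrite -EFin_Rintegral; last exact: integrable_EFinB.
  rewrite lee_fin /rest RintegralB//; apply: le_trans hK.
  by rewrite lerD2r -lee_fin EFin_Rintegral// hmu.
have h3 := average_bounded hindep hident mrest rest0 e80 irest.
apply: filterS3 h1 h2 h3 => w h1 h2 h3.
near=> n.
have a1 : \sum_(0 <= k < n) psi (X k w) <= e' * n%:R by near: n.
have a2 : \sum_(0 <= k < n) - psi (X k w) <= e' * n%:R by near: n.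
have a3 : \sum_(0 <= k < n) rest (X k w) <= 4 * (eps / 8) * n%:R by near: n.
have a30 : 0 <= \sum_(0 <= k < n) rest (X k w) by exact: sumr_ge0.
have E : \sum_(0 <= k < n) phi (X k w) =
    K%:R * \sum_(0 <= k < n) psi (X k w) + n%:R * m + \sum_(0 <= k < n) rest (X k w).
  have -> : n%:R * m = \sum_(0 <= k < n) m.
    by rewrite sumr_const_nat subn0 mulr_natl.
  rewrite mulr_sumr -!big_split/=; apply: eq_bigr => k _.
  by rewrite /rest /psi; field; rewrite gt_eqF.
rewrite sumrN in a2.
have nR : 0 <= n%:R :> R by [].
have b1 := ler_wpM2l (ltW KR) a1; have b2 := ler_wpM2l (ltW KR) a2.
have b3 := ler_wpM2r nR e'K.
have b4 := ler_wpM2r nR hK; have b5 := ler_wpM2r nR mmu.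
rewrite E ler_norml; move: b1 b2 b3 b4 b5 a3 a30; rewrite -/m.
move: (\sum_(0 <= k < n) psi _) (\sum_(0 <= k < n) rest _) (n%:R : R) => A B N.
move=> b1 b2 b3 b4 b5 a3 a30; clear - b1 b2 b3 b4 b5 a3 a30.
move: (K%:R : R) b1 b2 b3 => k b1 b2 b3.
by apply/andP; split; lra.
Unshelve. all: by end_near. Qed.

Lemma strong_law_nonneg :
  {ae P, forall w, forall eps : R, 0 < eps -> \forall n \near \oo,
     `|\sum_(0 <= k < n) phi (X k w) - n%:R * mu| <= eps * n%:R}.
Proof.
have : {ae P, forall w, forall j : nat, \forall n \near \oo,
     `|\sum_(0 <= k < n) phi (X k w) - n%:R * mu| <= j.+1%:R^-1 * n%:R}.
  by apply/ae_foralln => j; apply: strong_law_eps; rewrite invr_gt0 ltr0n.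
apply: filterS => w hw eps e0.
have [j hj] : exists j : nat, j.+1%:R^-1 <= eps.
  have [j hj] := ltr_add_invr (e0); rewrite add0r in hj.
  by exists j; exact: ltW.
by apply: filterS (hw j) => n /le_trans; apply; rewrite ler_wpM2r.
Qed.

End StrongLawNonneg.

(** * The Hartman-Wintner law for unit variance *)

Section LawOfIteratedLogarithm.
Context d (T : measurableType d) (R : realType) (P : probability T R).
Variable X : nat -> {RV P >-> R}.
Hypothesis hindep : independent_RVs X.
Hypothesis hident : identically_distributed X.
Hypothesis var1 : (\int[P]_w (X 0%N w ^+ 2)%:E = 1)%E.
Hypothesis mean0 : (\int[P]_w (X 0%N w)%:E = 0)%E.

Definition lil_scale (R : realType) (n : nat) : R :=
  Num.sqrt 2 * Num.sqrt (n%:R * ll R (lg n)).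

Lemma law_of_iterated_logarithm :
  {ae P, forall w, forall e : R, 0 < e ->
    (\forall n \near \oo, \sum_(0 <= k < n) X k w <= (1 + e) * lil_scale R n) /\
    (forall m, exists2 n, (m <= n)%N &
       (1 - e) * lil_scale R n <= \sum_(0 <= k < n) X k w)}.
Proof.
have s0 n : 0 <= lil_scale R n by rewrite mulr_ge0.
(* The parameters del = 1 / (9 (j + 4)): the 9 compensates the loss of 9 del in [lower_lil_delta],
   the shift by 4 keeps del <= 1 / 4, and countably many values suffice for one exceptional set
   valid for all e. *)
have hj j : 0 < (9 * j.+4%:R)^-1 :> R by rewrite invr_gt0 mulr_gt0 ?ltr0n.
have hj4 j : (9 * j.+4%:R)^-1 <= 4^-1 :> R.
  rewrite lef_pV2 ?posrE ?mulr_gt0 ?ltr0n//.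
  by apply: (@le_trans _ _ j.+4%:R); [rewrite ler_nat|rewrite ler_peMl// ler1n].
have hj1 j : (9 * j.+4%:R)^-1 <= 1 :> R.
  by apply: (le_trans (hj4 j)); rewrite invf_le1// ler1n.
have U : {ae P, forall w, forall j : nat, \forall n \near \oo,
    \sum_(0 <= k < n) X k w <= (1 + 3 * (9 * j.+4%:R)^-1) * lil_scale R n}.
  by apply/ae_foralln => j; exact: upper_lil_delta.
have L : {ae P, forall w, forall j m, exists2 n, (m <= n)%N &
    (1 - 9 * (9 * j.+4%:R)^-1) * lil_scale R n <= \sum_(0 <= k < n) X k w}.
  by apply/ae_foralln => j; exact: lower_lil_delta.
apply: filterS2 U L => w hU hL e e0.
have [j je] : exists j : nat, 9 * (9 * j.+4%:R)^-1 <= e.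
  have [j hj'] := ltr_add_invr e0; rewrite add0r in hj'.
  exists j; rewrite invfM mulrA divff// mul1r.
  apply: le_trans (ltW hj'); rewrite lef_pV2 ?posrE ?ltr0n// ler_nat.
  by rewrite !ltnS -addn3 leq_addr.
have h9 := hj j.
split.
  apply: filterS (hU j) => n /le_trans; apply; apply: ler_wpM2r => //.
  by rewrite lerD2l; move: je h9; move: (9 * j.+4%:R)^-1 => x; lra.
move=> m; have [n mn hn] := hL j m; exists n => //.
by apply: le_trans hn; apply: ler_wpM2r => //; rewrite lerD2l lerN2.
Qed.

End LawOfIteratedLogarithm.

(** * Deviation means *)

Section LimsupCharacterization.
Context (R : realType).

Lemma limn_esup_EFin_eq (y : nat -> R) (L : R) :
  (forall e, 0 < e -> \forall n \near \oo, y n <= L + e) ->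
  (forall e, 0 < e -> forall m, exists2 n, (m <= n)%N & L - e <= y n) ->
  limn_esup (fun n => (y n)%:E) = L%:E.
Proof.
move=> hU hL; apply/eqP; rewrite eq_le; apply/andP; split.
  apply/lee_addgt0Pr => e e0; rewrite -EFinD.
  apply: (@le_trans _ _ (ereal_sup ((fun n => (y n)%:E) @` [set n | y n <= L + e]))).
    by apply: ereal_inf_lbound; exists [set n | y n <= L + e] => //; exact: hU.
  by apply: ge_ereal_sup => _ [n hn <-]; rewrite lee_fin.
apply: le_ereal_inf_tmp => _ [V [m _ hV] <-].
apply/lee_addgt0Pr => e e0; have [n mn hn] := hL e e0 m.
apply: (@le_trans _ _ ((y n)%:E + e%:E)%E).
  by rewrite -EFinD lee_fin -lerBlDr.
by rewrite leeD2r//; apply: ereal_sup_ubound; exists n => //; exact: hV.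
Qed.

Lemma limf_esup_near_le (f : R -> R) (F : set_system R) (M : \bar R) :
  Filter F ->
  (limf_esup (fun s => (f s)%:E) F < M)%E -> \forall s \near F, ((f s)%:E < M)%E.
Proof.
move=> FF /ereal_inf_lt[_ [V FV <-] hV]; apply: filterS FV => s Vs.
by apply: le_lt_trans hV; apply: ereal_sup_ubound; exists s.
Qed.

End LimsupCharacterization.

(** * The rate of the theorem compared with the dyadic scale *)

Section Rates.
Context (R : realType).
Local Notation ll := (ll R).

Definition lil_rate (n : nat) : R := Num.sqrt (2 * n%:R^-1 * ln (ln n%:R)).

Lemma lg_gt0_gt0 n : (0 < lg n)%N -> (0 < n)%N.
Proof. by case: n. Qed.

Lemma ln2_bounds : 2^-1 <= ln (2 : R) <= 1.
Proof.
apply/andP; split.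
  rewrite -[leLHS]expRK ler_ln ?posrE ?expR_gt0//.
  have : expR 2^-1 <= (1 - 2^-1)^-1 :> R by apply: expR_le_inv1B; lra.
  by move=> /le_trans; apply; rewrite (_ : 1 - 2^-1 = 2^-1 :> R) ?invrK//; lra.
by rewrite [X in ln X](_ : _ = 1 + 1 :> R)//; apply: le_ln1Dx; lra.
Qed.

Lemma ln_lg_bounds n : (0 < n)%N ->
  (lg n)%:R / 2 <= ln (n%:R : R) <= (lg n).+1%:R.
Proof.
move=> n0; have /andP[l1 l2] := ln2_bounds.
have n0' : 0 < n%:R :> R by rewrite ltr0n.
apply/andP; split.
  apply: (@le_trans _ _ (ln ((2 ^ lg n)%:R))).
    by rewrite natrX lnXn// -[leRHS]mulr_natl ler_wpM2l.
  by rewrite ler_ln ?posrE ?ltr0n ?expn_gt0// ler_nat trunc_logP.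
apply: (@le_trans _ _ (ln ((2 ^ (lg n).+1)%:R))).
  by rewrite ler_ln ?posrE ?ltr0n ?expn_gt0// ler_nat ltnW// trunc_log_ltn.
by rewrite natrX lnXn// -[leLHS]mulr_natl ler_piMr.
Qed.

(** Since (lg n) / 2 <= ln n <= lg n + 1, one has lg n + 4 <= 4 ln n once lg n >= 4, and ln 4 <= 2.
    A bounded difference disappears in the ratio of two quantities tending to infinity, which
    [lil_rate_bounds] exploits. *)
Lemma lnln_bounds n : (4 <= lg n)%N ->
  ll (lg n) - 2 <= ln (ln (n%:R : R)) <= ll (lg n).
Proof.
move=> n4; have n0 : (0 < n)%N by apply: lg_gt0_gt0; exact: leq_trans n4.
have /andP[h1 h2] := ln_lg_bounds n0.
have l4 : 4 <= (lg n)%:R :> R by rewrite ler_nat.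
have l0 : 0 < ln n%:R :> R by apply: lt_le_trans h1; lra.
have /andP[_ l2] := ln2_bounds.
apply/andP; split.
  rewrite lerBlDr; apply: (@le_trans _ _ (ln (ln n%:R * 4))).
    rewrite /ll ler_ln ?posrE ?mulr_gt0//; rewrite -addn4 natrD.
    by move: h1 l4; move: (lg n)%:R (ln n%:R : R) => a b; lra.
  rewrite lnM ?posrE// lerD2l [X in ln X](_ : _ = 2 ^+ 2); last by rewrite -natrX.
  by rewrite lnXn//; lra.
rewrite /ll ler_ln ?posrE//; apply: (le_trans h2); rewrite ler_nat.
by rewrite -addn4 -addn1 leq_add2l.
Qed.

Lemma lil_rate_bounds (e : R) : 0 < e ->
  \forall n \near \oo, [/\ 0 < lil_rate n,
     n%:R * lil_rate n <= lil_scale R n & lil_scale R n <= (1 + e) * (n%:R * lil_rate n)].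
Proof.
move=> e0; near=> n.
have n4 : (4 <= lg n)%N.
  near: n; have : \forall j \near \oo, (4 <= j)%N by exists 4%N.
  exact: lg_cvgy.
have hl : 2 + 2 / e <= ll (lg n).
  near: n; have : ll (lg k) @[k --> \oo] --> +oo := cvg_comp _ _ lg_cvgy (@ll_cvgy R).
  by move=> /cvgryPge; apply.
have n0 : (0 < n)%N by apply: lg_gt0_gt0; exact: leq_trans n4.
have nR : 0 < n%:R :> R by rewrite ltr0n.
have /andP[h1 h2] := lnln_bounds n4.
have e2 : 0 < 2 / e by rewrite divr_gt0.
have ll0 : 0 < ln (ln n%:R) :> R.
  by apply: lt_le_trans h1; move: hl e2; move: (2 / e) (ll _) => a b; lra.
have r0 : 0 < lil_rate n by rewrite sqrtr_gt0 !mulr_gt0// invr_gt0.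
have E : n%:R * lil_rate n = Num.sqrt 2 * Num.sqrt (n%:R * ln (ln n%:R)).
  rewrite -[X in X * _]ger0_norm// -sqrtr_sqr /lil_rate -!sqrtrM ?sqr_ge0//.
  congr Num.sqrt; move: (n%:R : R) nR (ln _) => a a0 b; field; exact: lt0r_neq0.
split => //; rewrite E /lil_scale.
  by apply: ler_wpM2l => //; apply: ler_wsqrtr; rewrite ler_pM2l.
rewrite mulrCA; apply: ler_wpM2l => //.
have e10 : 0 <= 1 + e by rewrite addr_ge0// ltW.
rewrite -[X in _ <= X * _]ger0_norm// -sqrtr_sqr -sqrtrM ?sqr_ge0//.
apply: ler_wsqrtr; rewrite mulrCA ler_pM2l//.
have he : 2 <= e * (ll (lg n) - 2).
  have : 2 / e <= ll (lg n) - 2 by move: hl; move: (2 / e) (ll _) => a b; lra.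
  by rewrite ler_pdivrMr// mulrC.
have he2 : e * (ll (lg n) - 2) <= e * ln (ln n%:R) by rewrite ler_pM2l.
have : 0 <= (e + e ^+ 2) * ln (ln n%:R) by rewrite mulr_ge0 ?ltW// addr_gt0// exprn_gt0.
move: he he2 h1; move: (ll _) (ln (ln n%:R) : R) => a b; lra.
Unshelve. all: by end_near. Qed.

Lemma lil_rate_small (e : R) : 0 < e -> \forall n \near \oo, lil_rate n <= e.
Proof.
move=> e0; near=> n.
have n4 : (4 <= lg n)%N.
  near: n; have : \forall j \near \oo, (4 <= j)%N by exists 4%N.
  exact: lg_cvgy.
have n0 : (0 < n)%N by apply: lg_gt0_gt0; exact: leq_trans n4.
have nR : 0 < n%:R :> R by rewrite ltr0n.
have /andP[_ h2] := lnln_bounds n4.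
have h : ll (lg n) <= e ^+ 2 / 2 * n%:R.
  by near: n; apply: ll_lg_small; rewrite divr_gt0// exprn_gt0.
rewrite -[leRHS]ger0_norm ?(ltW e0)// -sqrtr_sqr; apply: ler_wsqrtr.
rewrite mulrAC ler_pdivrMr//; have := le_trans h2 h.
by move: (ln (ln n%:R) : R) (n%:R : R) => a b; lra.
Unshelve. all: by end_near. Qed.

Lemma ll_le_linear (e : R) : 0 < e -> \forall j \near \oo, ll j <= e * j%:R.
Proof.
move=> e0; near=> j.
have j4 : 4 <= j%:R :> R by near: j; exact: nbhs_infty_ger.
have je : 8 / e ^+ 2 <= j%:R :> R by near: j; exact: nbhs_infty_ger.
have s0 : 0 < Num.sqrt j.+4%:R :> R by rewrite sqrtr_gt0 ltr0n.
(* ln x = 2 ln (sqrt x) <= 2 sqrt x, which is sublinear. *)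
rewrite /ll (_ : ln _ = ln (Num.sqrt j.+4%:R ^+ 2 : R)); last by rewrite sqr_sqrtr.
rewrite lnXn//.
rewrite -[leLHS]mulr_natl; apply: (@le_trans _ _ (2 * Num.sqrt j.+4%:R)).
  by rewrite ler_wpM2l// ltW// ln_sublinear.
have ej0 : 0 <= e * j%:R by rewrite mulr_ge0// ltW.
have s20 : 0 <= 2 * Num.sqrt j.+4%:R :> R by rewrite mulr_ge0.
rewrite -(@ler_pXn2r _ 2) ?nnegrE// exprMn sqr_sqrtr//.
rewrite ler_pdivrMr ?exprn_gt0// in je.
have h : 8 * j%:R <= j%:R * e ^+ 2 * j%:R :> R by rewrite ler_wpM2r.
rewrite -addn4 natrD exprMn; move: j4 h; move: (j%:R : R) => x; lra.
Unshelve. all: by end_near. Qed.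

(** Since ln (rate) <= ll (lg n) - ln n / 2, the product has logarithm at most al * ll (lg n) - rho
    * ln n with rho = al / 2 - be > 0, and [ll (lg n)] is negligible against lg n. *)
Lemma lil_rate_power_small (al be : R) : 0 < al -> be < al / 2 -> forall e : R, 0 < e ->
  \forall n \near \oo, lil_rate n `^ al * n%:R `^ be <= e.
Proof.
move=> al0 ba e e0.
pose rho := al / 2 - be.
have rho0 : 0 < rho by rewrite /rho; lra.
have ea0 : 0 < rho / (4 * al) by rewrite divr_gt0// mulr_gt0.
(* As ln n >= (lg n) / 2, the gain is at least rho * lg n / 2: one half of it absorbs al * ll (lg
   n), the other half brings the logarithm below ln e. *)
have hj : \forall j \near \oo, ll j <= rho / (4 * al) * j%:R /\ - ln e <= rho / 4 * j%:R.
  near=> j; split; first by near: j; exact: ll_le_linear.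
  have : - ln e / (rho / 4) <= j%:R by near: j; exact: nbhs_infty_ger.
  by rewrite ler_pdivrMr ?divr_gt0// mulrC.
near=> n.
have n4 : (4 <= lg n)%N.
  near: n; have : \forall j \near \oo, (4 <= j)%N by exists 4%N.
  exact: lg_cvgy.
have [r0 _ _] : [/\ 0 < lil_rate n,
     n%:R * lil_rate n <= lil_scale R n & lil_scale R n <= (1 + 1) * (n%:R * lil_rate n)].
  by near: n; exact: lil_rate_bounds.
have [j1 j2] : ll (lg n) <= rho / (4 * al) * (lg n)%:R /\ - ln e <= rho / 4 * (lg n)%:R.
  by near: n; exact: (lg_cvgy hj).
have n0 : (0 < n)%N by apply: lg_gt0_gt0; exact: leq_trans n4.
have nR : 0 < n%:R :> R by rewrite ltr0n.
have /andP[h1 h2] := lnln_bounds n4.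
have /andP[h3 _] := ln_lg_bounds n0.
rewrite /powR !gt_eqF// -expRD -[leRHS]lnK ?posrE// ler_expR.
have hr : ln (lil_rate n) <= ll (lg n) - ln n%:R / 2.
  have : lil_rate n ^+ 2 <= 2 * ll (lg n) / n%:R.
    rewrite /lil_rate sqr_sqrtr.
      by rewrite mulrAC ler_wpM2r ?invr_ge0// ler_wpM2l.
    have := r0; rewrite /lil_rate sqrtr_gt0; exact: ltW.
  have l0 := ll_gt0 R (lg n).
  rewrite -ler_ln ?posrE ?exprn_gt0 ?divr_gt0 ?mulr_gt0// lnXn// ln_div ?posrE ?mulr_gt0//.
  have : ln (2 * ll (lg n)) <= 2 * ll (lg n) by rewrite ltW// ln_sublinear// mulr_gt0.
  rewrite -[ln (lil_rate n) *+ 2]mulr_natl.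
  by move: (ln (lil_rate n)) (ln (2 * ll (lg n))) (ll _) (ln (n%:R : R)) => a b c f; lra.
apply: (@le_trans _ _ (al * ll (lg n) - rho * ln n%:R)).
  have := ler_wpM2l (ltW al0) hr; rewrite /rho.
  by move: (ln (lil_rate n)) (ll _) (ln (n%:R : R)) => b c f; lra.
have k1 : al * ll (lg n) <= rho / 4 * (lg n)%:R.
  rewrite -ler_pdivlMl//; apply: (le_trans j1).
  rewrite le_eqVlt; apply/orP; left; apply/eqP.
  by move: ((lg n)%:R : R) => x; field; exact: lt0r_neq0.
have k2 : rho * ((lg n)%:R / 2) <= rho * ln n%:R by rewrite ler_pM2l.
by move: k1 k2 j2; move: (al * ll _) (rho * ln (n%:R : R)) (ln e) ((lg n)%:R : R) => a b c f; lra.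
Unshelve. all: by end_near. Qed.

End Rates.

Section SampleMean.
Context (R : realType) (I : set R) (D : R -> R -> R).
Hypothesis hI : is_interval I.
Hypothesis hD : deviation I D.

Let Dlt x s t : I x -> I s -> I t -> s < t -> D x t < D x s.
Proof. by case: hD => h _ _ Ix Is It; exact: h. Qed.

Let Dle x s t : I x -> I s -> I t -> s <= t -> D x t <= D x s.
Proof.
by move=> Ix Is It; rewrite le_eqVlt => /predU1P[->//|st]; rewrite ltW// Dlt.
Qed.

Lemma sum_deviation_lt n (x : 'I_n -> R) (s t : R) : (0 < n)%N -> (forall i, I (x i)) ->
  I s -> I t -> s < t -> \sum_(i < n) D (x i) t < \sum_(i < n) D (x i) s.
Proof.
move=> n0 Ix Is It st; case: n x n0 Ix => // n x _ Ix.
rewrite !big_ord_recl; apply: ltr_leD; first exact: Dlt.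
by apply: ler_sum => i _; rewrite ltW// Dlt.
Qed.

(** At the smallest observation every summand is nonnegative, at the largest nonpositive; the
    intermediate value theorem between them, inside I, shows that the set from which [get] chooses
    is not empty. *)
Lemma sample_deviation_meanP n (x : 'I_n -> R) : (0 < n)%N -> (forall i, I (x i)) ->
  I (sample_deviation_mean I D x) /\
  \sum_(i < n) D (x i) (sample_deviation_mean I D x) = 0.
Proof.
move=> n0 Ix.
suff h : exists t, [set t | I t /\ \sum_(i < n) D (x i) t = 0] t by exact: (getPex h).
pose i0 := Ordinal n0.
have [a _ ha] := @Order.TotalTheory.arg_minP _ _ _ i0 xpredT x isT.
have [b _ hb] := @Order.TotalTheory.arg_maxP _ _ _ i0 xpredT x isT.
have [_ _ Dtt] := hD.
have ab : x a <= x b by exact: ha.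
have sub : `[x a, x b] `<=` I.
  by move=> z /=; rewrite in_itv/= => /andP[z1 z2]; apply: (hI (Ix a) (Ix b)); rewrite z1.
have cS : {within `[x a, x b], continuous (fun t => \sum_(i < n) D (x i) t)}.
  apply: continuous_big => [|i _]; first exact: add_continuous.
  by apply: continuous_subspaceW sub _; case: hD => _ h _; exact: h.
have Sa : 0 <= \sum_(i < n) D (x i) (x a).
  by apply: sumr_ge0 => i _; rewrite -(Dtt (x i))//; apply: Dle => //; exact: ha.
have Sb : \sum_(i < n) D (x i) (x b) <= 0.
  by apply: sumr_le0 => i _; rewrite -(Dtt (x i))//; apply: Dle => //; exact: hb.
have [|c cin hc] := @IVT _ _ _ _ 0 ab cS.
  by rewrite ge_min Sb orbT le_max Sa.
by exists c; split => //; exact: sub.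
Qed.

Lemma sample_mean_gt n (x : 'I_n -> R) (t : R) : (0 < n)%N -> (forall i, I (x i)) ->
  I t -> 0 < \sum_(i < n) D (x i) t -> t < sample_deviation_mean I D x.
Proof.
move=> n0 Ix It St; have [IM SM] := sample_deviation_meanP n0 Ix.
rewrite ltNge le_eqVlt; apply/negP => /predU1P[Mt|Mt].
  by move: St; rewrite -Mt SM ltxx.
by have := sum_deviation_lt n0 Ix IM It Mt; rewrite SM ltNge (ltW St).
Qed.

Lemma sample_mean_lt n (x : 'I_n -> R) (t : R) : (0 < n)%N -> (forall i, I (x i)) ->
  I t -> \sum_(i < n) D (x i) t < 0 -> sample_deviation_mean I D x < t.
Proof.
move=> n0 Ix It St; have [IM SM] := sample_deviation_meanP n0 Ix.
rewrite ltNge le_eqVlt; apply/negP => /predU1P[Mt|Mt].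
  by move: St; rewrite Mt SM ltxx.
by have := sum_deviation_lt n0 Ix It IM Mt; rewrite SM ltNge (ltW St).
Qed.

End SampleMean.

(** * Upper and lower limits of the roots from signs *)

Section RootLimsup.
Context (R : realType).
Local Notation rate := (lil_rate R).

(* [M n] stands for the zero of the decreasing function [S n]; only the signs of
   [S n] at the points [t0 + c * rate n] matter. *)
Lemma root_limsup (I : set R) (S : nat -> R -> R) (M : nat -> R) (t0 s m : R) :
  0 < s -> 0 < m ->
  (forall n t, (0 < n)%N -> I t -> S n t < 0 -> M n < t) ->
  (forall n t, (0 < n)%N -> I t -> 0 < S n t -> t < M n) ->
  (forall c e, c != 0 -> 0 < e -> \forall n \near \oo, I (t0 + c * rate n) /\
     `|S n (t0 + c * rate n) - S n t0 + c * m * (n%:R * rate n)| <= e * (n%:R * rate n)) ->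
  (forall e, 0 < e -> (\forall n \near \oo, S n t0 <= (1 + e) * (s * lil_scale R n)) /\
     forall k, exists2 n, (k <= n)%N & (1 - e) * (s * lil_scale R n) <= S n t0) ->
  limn_esup (fun n => ((M n - t0) / rate n)%:E) = (s / m)%:E.
Proof.
move=> s0 m0 hlt hgt hdiff hlil.
have sm0 : 0 < s / m by rewrite divr_gt0.
apply: limn_esup_EFin_eq => e e0.
  pose c := s / m + e; have c0 : 0 < c by rewrite addr_gt0.
  pose del := Num.min 1 (e * m / (8 * s)).
  have em0 : 0 < e * m by rewrite mulr_gt0.
  have del0 : 0 < del by rewrite lt_min ltr01 divr_gt0// mulr_gt0.
  have del1 : del <= 1 by rewrite ge_min lexx.
  have dels : del * s <= e * m / 8.
    rewrite -ler_pdivlMr// ge_min; apply/orP; right.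
    by rewrite invfM mulrA.
  have cm : c * m = s + e * m by rewrite /c mulrDl divfK// gt_eqF.
  near=> n.
  have [r0 r1 r2] : [/\ 0 < rate n, n%:R * rate n <= lil_scale R n
      & lil_scale R n <= (1 + del) * (n%:R * rate n)].
    by near: n; exact: lil_rate_bounds.
  have n0 : (0 < n)%N by near: n; exists 1%N.
  have [Ic hc] : I (t0 + c * rate n) /\ `|S n (t0 + c * rate n) - S n t0 +
      c * m * (n%:R * rate n)| <= e * m / 4 * (n%:R * rate n).
    by near: n; apply: hdiff; rewrite ?gt_eqF// divr_gt0.
  have hS : S n t0 <= (1 + del) * (s * lil_scale R n).
    by near: n; have [] := hlil del del0.
  rewrite ler_pdivrMr// -/c lerBlDl; apply/ltW/hlt => //.
  have x0 : 0 < n%:R * rate n by rewrite mulr_gt0// ltr0n.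
  move: x0 r1 r2 hc hS; rewrite cm.
  move: (n%:R * rate n) (S n (t0 + _)) (S n t0) (lil_scale R n) => x S1 S0 L x0 r1 r2 hc hS.
  have hS' : S0 <= (s + 3 * (del * s)) * x.
    apply: (le_trans hS); apply: (@le_trans _ _ ((1 + del) * (s * ((1 + del) * x)))).
      by rewrite !ler_wpM2l ?addr_ge0// ?(ltW s0) ?(ltW del0).
    have : 0 <= del * s * x * (1 - del) by rewrite !mulr_ge0 ?subr_ge0// ltW.
    by move: del1; clear; nra.
  have k : 3 * (del * s) * x <= 3 * (e * m / 8) * x.
    by rewrite ler_pM2r// ler_pM2l.
  have k2 : 0 < e * m * x by rewrite mulr_gt0.
  move: hc hS' k k2; rewrite ler_norml => /andP[_]; move: (del * s) (e * m) => a b; clear.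
  lra.
move=> k.
(* Shrinking e keeps c = s / m - e positive, hence nonzero as the expansion requires. *)
wlog es : e e0 / e <= s / m / 2 => [hw|].
  have h2 : 0 < s / m / 2 by rewrite divr_gt0.
  have [h|h] := leP e (s / m / 2); first exact: hw.
  have [n kn hn] := hw _ h2 (lexx _); exists n => //; apply: le_trans hn.
  by rewrite lerD2l lerN2 ltW.
pose c := s / m - e; have c0 : 0 < c by rewrite /c; move: es sm0; move: (s / m) => a; clear; lra.
have em0 : 0 < e * m by rewrite mulr_gt0.
pose del := Num.min 1 (e * m / (8 * s)).
have del0 : 0 < del by rewrite lt_min ltr01 divr_gt0// mulr_gt0.
have del1 : del <= 1 by rewrite ge_min lexx.
have dels : del * s <= e * m / 8.
  rewrite -ler_pdivlMr// ge_min; apply/orP; right.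
  by rewrite invfM mulrA.
have cm : c * m = s - e * m by rewrite /c mulrBl divfK// gt_eqF.
have : \forall n \near \oo, [/\ (0 < n)%N, 0 < rate n, n%:R * rate n <= lil_scale R n,
     I (t0 + c * rate n) & `|S n (t0 + c * rate n) - S n t0 +
      c * m * (n%:R * rate n)| <= e * m / 4 * (n%:R * rate n)].
  near=> n.
  have [r0 r1 r2] : [/\ 0 < rate n, n%:R * rate n <= lil_scale R n
      & lil_scale R n <= (1 + del) * (n%:R * rate n)].
    by near: n; exact: lil_rate_bounds.
  have [Ic hc] : I (t0 + c * rate n) /\ `|S n (t0 + c * rate n) - S n t0 +
      c * m * (n%:R * rate n)| <= e * m / 4 * (n%:R * rate n).
    by near: n; apply: hdiff; rewrite ?gt_eqF// divr_gt0.
  by split => //; near: n; exists 1%N.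
case=> N _ hN.
have [n kn hS] := (hlil del del0).2 (maxn k N).
have /hN[/= n0 r0 r1 Ic hc] : (N <= n)%N by apply: leq_trans kn; exact: leq_maxr.
exists n; first by apply: leq_trans kn; exact: leq_maxl.
rewrite ler_pdivlMr// -/c lerBrDl; apply/ltW/hgt => //.
have x0 : 0 < n%:R * rate n by rewrite mulr_gt0// ltr0n.
move: x0 r1 hc hS; rewrite cm.
move: (n%:R * rate n) (S n (t0 + _)) (S n t0) (lil_scale R n) => x S1 S0 L x0 r1 hc hS.
have hS' : (s - del * s) * x <= S0.
  apply: le_trans hS; rewrite mulrA [(1 - del) * s]mulrBl mul1r ler_wpM2l// subr_ge0.
  by rewrite ger_pMl.
have k1 : del * s * x <= e * m / 8 * x by rewrite ler_pM2r.
have k2 : 0 < e * m * x by rewrite mulr_gt0.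
move: hc hS' k1 k2; rewrite ler_norml => /andP[+ _]; move: (del * s) (e * m) => a b; clear.
lra.
Unshelve. all: by end_near. Qed.

(** By reflection: t |-> - S n (- t) has the same pattern of signs around - M n, with centre - t0,
    and the lower limit becomes an upper one. *)
Lemma root_liminf (I : set R) (S : nat -> R -> R) (M : nat -> R) (t0 s m : R) :
  0 < s -> 0 < m ->
  (forall n t, (0 < n)%N -> I t -> S n t < 0 -> M n < t) ->
  (forall n t, (0 < n)%N -> I t -> 0 < S n t -> t < M n) ->
  (forall c e, c != 0 -> 0 < e -> \forall n \near \oo, I (t0 + c * rate n) /\
     `|S n (t0 + c * rate n) - S n t0 + c * m * (n%:R * rate n)| <= e * (n%:R * rate n)) ->
  (forall e, 0 < e -> (\forall n \near \oo, - S n t0 <= (1 + e) * (s * lil_scale R n)) /\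
     forall k, exists2 n, (k <= n)%N & (1 - e) * (s * lil_scale R n) <= - S n t0) ->
  limn_einf (fun n => ((M n - t0) / rate n)%:E) = (- (s / m))%:E.
Proof.
move=> s0 m0 hlt hgt hdiff hlil.
rewrite EFinN; congr (- _)%E.
rewrite -(@root_limsup [set t | I (- t)] (fun n t => - S n (- t)) (fun n => - M n) (- t0) s m)//.
- by congr limn_esup; apply/funext => n; rewrite /= -mulNr opprB opprK addrC.
- by move=> n t n0 It; rewrite oppr_lt0 ltrNl; exact: hgt.
- by move=> n t n0 It; rewrite oppr_gt0 ltrNr; exact: hlt.
- move=> c e c0 e0; have := hdiff (- c) e _ e0; rewrite oppr_eq0 => /(_ c0).
  apply: filterS => n [h1 h2]; rewrite /= opprD opprK -mulNr; split => //.
  rewrite -normrN; apply: le_trans h2; rewrite le_eqVlt; apply/orP; left; apply/eqP.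
  by congr `|_|; ring.
- by move=> e e0; rewrite /= opprK; exact: hlil.
Qed.

End RootLimsup.

(** * The modulus h along the rate *)

Section Modulus.
Context (R : realType).

Lemma near0_right (Q : R -> Prop) : (\forall s \near 0^'+, Q s) ->
  exists2 e : R, 0 < e & forall s, 0 < s < e -> Q s.
Proof.
case=> e /= e0 he; exists e => // s /andP[s0 se]; apply: he => //=.
by rewrite sub0r normrN gtr0_norm.
Qed.

Variables (alpha q : R) (h : R -> R).
Hypothesis alpha0 : 0 <= alpha.
Hypothesis hzero : alpha = 0 ->
  q = 1 /\ limf_esup (fun s : R => (h s / s `^ alpha)%R%:E) 0^'+ = 0%E.
Hypothesis hpos : 0 < alpha -> 2 / (2 + alpha) < q < 1 /\
  (limf_esup (fun s : R => (h s / s `^ alpha)%R%:E) 0^'+ < +oo)%E.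

Lemma modulus_exponent : 0 < q <= 1.
Proof.
move: alpha0; rewrite le_eqVlt => /predU1P[/esym a0|a0].
  by have [-> _] := hzero a0; rewrite ltr01 lexx.
have [/andP[q1 q2] _] := hpos a0.
rewrite (ltW q2) andbT; apply: lt_trans q1.
by rewrite divr_gt0// addr_gt0.
Qed.

Let modulus_zero : alpha = 0 -> forall e, 0 < e -> \forall s \near 0^'+, h s <= e.
Proof.
move=> a0 e e0; have [_ hl] := hzero a0.
have : \forall s \near 0^'+, ((h s / s `^ alpha)%R%:E < e%:E)%E.
  by apply: limf_esup_near_le; rewrite hl lte_fin.
by apply: filterS => s; rewrite lte_fin a0 powRr0 divr1 => /ltW.
Qed.

Let modulus_pos : 0 < alpha -> exists2 C, 0 < C & \forall s \near 0^'+, h s <= C * s `^ alpha.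
Proof.
move=> a0; have [_ hl] := hpos a0.
have [C C0 hC] : exists2 C, 0 < C &
    (limf_esup (fun s : R => (h s / s `^ alpha)%R%:E) 0^'+ < C%:E)%E.
  move: hl; case: (limf_esup _ _) => [a _| //|_].
    exists (`|a| + 1); first by rewrite ltr_wpDl.
    by rewrite lte_fin (le_lt_trans (ler_norm _))// ltrDl.
  by exists 1 => //; rewrite ltNyr.
exists C => //.
have hn := limf_esup_near_le _ hC.
near=> s.
have s0 : 0 < s by near: s; exact: nbhs_right_gt.
rewrite -ler_pdivrMr ?powR_gt0//; apply/ltW; rewrite -lte_fin.
by near: s; exact: hn.
Unshelve. all: by end_near. Qed.

Lemma modulus_small (e : R) : 0 < e -> \forall s \near 0^'+, h s <= e.
Proof.
move=> e0; move: alpha0; rewrite le_eqVlt => /predU1P[/esym a0|a0].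
  exact: modulus_zero.
have [C C0 hC] := modulus_pos a0.
have hs : \forall s \near 0^'+, s `^ alpha <= e / C.
  have /cvgrPdist_le/(_ (e / C)) := @powR_cvg0 R _ a0.
  rewrite divr_gt0// => /(_ isT); apply: filterS => s.
  by rewrite sub0r normrN ger0_norm ?powR_ge0.
apply: filterS2 hC hs => s h1 h2; apply: (le_trans h1).
by rewrite mulrC -ler_pdivlMr.
Qed.

(** (A n)^(1 / q) is the bound for the sum of the [H (x k)] in [sum_deviation_expansion], so this
    estimates the error of the expansion there, after division by |y|. *)
Lemma modulus_rate_small (A c e : R) : 0 <= A -> 0 < c -> 0 < e ->
  \forall n \near \oo, h (c * lil_rate R n) * (A * n%:R) `^ q^-1 <= e * n%:R.
Proof.
move=> A0 c0 e0.
have rate_near Q : (\forall s \near 0^'+, Q s) ->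
    \forall n \near \oo, 0 < lil_rate R n /\ Q (c * lil_rate R n).
  move=> /near0_right[b b0 hb]; near=> n.
  have [r0 _ _] : [/\ 0 < lil_rate R n, n%:R * lil_rate R n <= lil_scale R n
      & lil_scale R n <= (1 + 1) * (n%:R * lil_rate R n)].
    by near: n; exact: lil_rate_bounds.
  have r1 : lil_rate R n <= b / (2 * c).
    by near: n; apply: lil_rate_small; rewrite divr_gt0// mulr_gt0.
  split => //; apply: hb; rewrite mulr_gt0//=.
  move: r1; rewrite ler_pdivlMr ?mulr_gt0// => r1.
  have : 0 < c * lil_rate R n by rewrite mulr_gt0.
  by move: r1; rewrite mulrCA mulrC [_ * c]mulrC; move: (c * _) => y; lra.
have /andP[q0 q1] := modulus_exponent.
have AnE n : (A * n%:R) `^ q^-1 = A `^ q^-1 * n%:R `^ q^-1 by rewrite powRM.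
move: alpha0; rewrite le_eqVlt => /predU1P[/esym a0|a0].
  have [-> _] := hzero a0; rewrite invr1.
  have e1 : 0 < e / (A + 1) by rewrite divr_gt0// ltr_wpDl.
  apply: filterS (rate_near _ (modulus_small e1)) => n [_ hn].
  rewrite powRr1 ?mulr_ge0// mulrA ler_wpM2r//.
  apply: (@le_trans _ _ (e / (A + 1) * A)); first by rewrite ler_wpM2r.
  by rewrite mulrAC ler_pdivrMr ?ltr_wpDl// ler_pM2l// lerDl.
have [/andP[q2 q3] _] := hpos a0.
have [C C0 hC] := modulus_pos a0.
(* q > 2 / (2 + alpha) read as 1 / q < alpha / 2 + 1, the exponent condition of
   [lil_rate_power_small]. *)
have be0 : q^-1 - 1 < alpha / 2.
  rewrite ltrBlDr; have -> : alpha / 2 + 1 = ((2 / (2 + alpha))^-1).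
    by rewrite invf_div; field.
  by rewrite ltf_pV2// posrE divr_gt0// addr_gt0.
pose K := C * c `^ alpha * A `^ q^-1.
have K0 : 0 <= K by rewrite !mulr_ge0 ?powR_ge0// ltW.
have eK : 0 < e / (K + 1) by rewrite divr_gt0// ltr_wpDl.
near=> n.
have [r0 hn] : 0 < lil_rate R n /\
    h (c * lil_rate R n) <= C * (c * lil_rate R n) `^ alpha.
  by near: n; exact: (rate_near _ hC).
have n0 : 0 < n%:R :> R by rewrite ltr0n; near: n; exists 1%N.
have hp : lil_rate R n `^ alpha * n%:R `^ (q^-1 - 1) <= e / (K + 1).
  by near: n; exact: lil_rate_power_small.
rewrite AnE; apply: (@le_trans _ _ (C * (c * lil_rate R n) `^ alpha *
    (A `^ q^-1 * n%:R `^ q^-1))).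
  by rewrite ler_wpM2r// mulr_ge0// powR_ge0.
rewrite powRM ?(ltW c0) ?(ltW r0)//.
rewrite -(mulr_powRB1 (ltW n0)) ?invr_gt0//.
apply: (@le_trans _ _ (K * (e / (K + 1)) * n%:R)).
  rewrite -subr_ge0.
  have -> : K * (e / (K + 1)) * n%:R - C * (c `^ alpha * lil_rate R n `^ alpha) *
    (A `^ q^-1 * (n%:R * n%:R `^ (q^-1 - 1))) =
    K * n%:R * (e / (K + 1) - lil_rate R n `^ alpha * n%:R `^ (q^-1 - 1)).
    by rewrite /K; move: (_ / (_ + 1)) => z; ring.
  by apply: mulr_ge0; [apply: mulr_ge0 => //; exact: ltW|rewrite subr_ge0].
rewrite ler_wpM2r ?(ltW n0)// mulrCA -[leRHS]mulr1 ler_pM2l// ler_pdivrMr ?ltr_wpDl//.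
by rewrite mul1r lerDl.
Unshelve. all: by end_near. Qed.

End Modulus.

Section SubadditivePowers.
Context (R : realType).

(** For 0 < x <= s and q <= 1 one has x / s <= (x / s)^q, that is (x / s) s^q <= x^q; the cases x =
    a and x = b with s = a + b are added. *)
Lemma powR_subadditive (q a b : R) : 0 < q <= 1 -> 0 <= a -> 0 <= b ->
  (a + b) `^ q <= a `^ q + b `^ q.
Proof.
move=> /andP[q0 q1] a0 b0.
have := addr_ge0 a0 b0; rewrite le_eqVlt => /predU1P[/esym s0|s0].
  by rewrite s0 powR0 ?gt_eqF// addr_ge0// powR_ge0.
have part x : 0 <= x -> x <= a + b -> x / (a + b) * (a + b) `^ q <= x `^ q.
  rewrite le_eqVlt => /predU1P[<-|x0] xs; first by rewrite !mul0r powR_ge0.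
  rewrite -[in leRHS](divfK (lt0r_neq0 s0) x) powRM ?(ltW s0)//; last first.
    by rewrite divr_ge0 ?ltW.
  rewrite ler_wpM2r ?powR_ge0// ger1_powR// divr_gt0//=.
  by rewrite ler_pdivrMr// mul1r.
apply: le_trans (lerD (part a a0 _) (part b b0 _)); rewrite ?lerDl ?lerDr//.
by rewrite -mulrDl -mulrDl divff ?mul1r// gt_eqF.
Qed.

Lemma sum_le_sum_powR (q : R) (a : nat -> R) n : 0 < q <= 1 -> (forall k, 0 <= a k) ->
  \sum_(0 <= k < n) a k <= (\sum_(0 <= k < n) a k `^ q) `^ q^-1.
Proof.
move=> hq a0; have /andP[q0 _] := hq.
have s0 : 0 <= \sum_(0 <= k < n) a k by apply: sumr_ge0.
rewrite -[leLHS]powRr1// -(divff (lt0r_neq0 q0)) powRrM.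
apply: ge0_ler_powR; rewrite ?invr_ge0 ?(ltW q0) ?nnegrE ?powR_ge0//.
  by apply: sumr_ge0 => k _; exact: powR_ge0.
elim: n {s0} => [|n IH]; first by rewrite !big_nil powR0// gt_eqF.
rewrite !big_nat_recr//=; apply: le_trans (powR_subadditive hq _ _) _ => //.
  exact: sumr_ge0.
by rewrite lerD2r.
Qed.

End SubadditivePowers.

Section ScaledLil.
Context d (T : measurableType d) (R : realType) (P : probability T R).
Variable X : nat -> {RV P >-> R}.
Hypothesis hindep : independent_RVs X.
Hypothesis hident : identically_distributed X.

Variable phi : R -> R.
Hypothesis mphi : measurable_fun setT phi.
Variable v : R.
Hypothesis v0 : 0 < v.
Hypothesis var : (\int[P]_w (phi (X 0%N w) ^+ 2)%:E)%E = v%:E.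

Let s := Num.sqrt v.

Let s0 : 0 < s.
Proof. by rewrite sqrtr_gt0. Qed.

Let mg : measurable_fun setT (fun x => s^-1 * phi x).
Proof. exact: measurable_funM. Qed.

Let Y := comp_RV X mg.

Let varY : (\int[P]_w (Y 0%N w ^+ 2)%:E)%E = 1%E.
Proof.
have mX : measurable_fun setT (fun w => phi (X 0%N w)).
  exact: measurableT_comp mphi (measurable_funPT (X 0%N)).
transitivity (\int[P]_w (v^-1%:E * (phi (X 0%N w) ^+ 2)%:E))%E.
  by apply: eq_integral => w _; rewrite /Y/= exprMn exprVn sqr_sqrtr ?(ltW v0)// EFinM.
rewrite ge0_integralZl//.
- by rewrite var -EFinM mulVf// gt_eqF.
- by apply/measurable_EFinP; exact: measurable_funX.
- by move=> w _; rewrite lee_fin sqr_ge0.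
- by rewrite lee_fin invr_ge0 ltW.
Qed.

Lemma integrable_of_second_moment : P.-integrable setT (fun w => (phi (X 0%N w))%:E).
Proof.
rewrite (_ : (fun w => _) = (fun w => s%:E * (Y 0%N w)%:E)%E).
  exact/integrableZl/integrable_X0.
by apply/funext => w; rewrite /Y/= -EFinM mulVKf// gt_eqF.
Qed.

Lemma scaled_law_of_iterated_logarithm : (\int[P]_w (phi (X 0%N w))%:E)%E = 0%E ->
  {ae P, forall w, forall e : R, 0 < e ->
    (\forall n \near \oo, \sum_(0 <= k < n) phi (X k w) <=
       (1 + e) * (Num.sqrt v * lil_scale R n)) /\
    forall m, exists2 n, (m <= n)%N &
      (1 - e) * (Num.sqrt v * lil_scale R n) <= \sum_(0 <= k < n) phi (X k w)}.
Proof.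
move=> mean; have meanY : (\int[P]_w (Y 0%N w)%:E)%E = 0%E.
  under eq_integral do rewrite /Y/= EFinM.
  by rewrite integralZl ?mean ?mule0//; exact: integrable_of_second_moment.
have := law_of_iterated_logarithm (independent_comp mg hindep)
  (identically_distributed_comp mg hident) varY meanY.
apply: filterS => w h e e0; have [h1 h2] := h e e0.
have sumE n : \sum_(0 <= k < n) phi (X k w) = s * \sum_(0 <= k < n) Y k w.
  by rewrite mulr_sumr; apply: eq_bigr => k _; rewrite /Y/= mulVKf// gt_eqF.
split.
  by apply: filterS h1 => n hn; rewrite -/s sumE mulrCA ler_pM2l.
by move=> m; have [n mn hn] := h2 m; exists n => //; rewrite -/s sumE mulrCA ler_pM2l.
Qed.

End ScaledLil.

(** * Expansion of deviation sums around t0 *)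

Section Expansion.
Context (R : realType) (I : set R) (D : R -> R -> R) (t0 r alpha q : R) (H h : R -> R).
Hypothesis r0 : 0 < r.
Hypothesis H0 : forall x, I x -> 0 <= H x.
Hypothesis h0 : forall s, 0 < s < r -> 0 <= h s.
Hypothesis hsub : `]t0 - r, t0 + r[%classic `<=` I.
Hypothesis hquot : forall x t, I x -> t \in `]t0 - r, t0 + r[ -> t != t0 ->
  `|(D x t - D x t0) / (t - t0) - partial2 D x t0| <= H x * h `|t - t0|.
Hypothesis alpha0 : 0 <= alpha.
Hypothesis hzero : alpha = 0 ->
  q = 1 /\ limf_esup (fun s : R => (h s / s `^ alpha)%R%:E) 0^'+ = 0%E.
Hypothesis hpos : 0 < alpha -> 2 / (2 + alpha) < q < 1 /\
  (limf_esup (fun s : R => (h s / s `^ alpha)%R%:E) 0^'+ < +oo)%E.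

Let in_range y : `|y| < r -> t0 + y \in `]t0 - r, t0 + r[.
Proof. by rewrite ltr_norml in_itv/= => /andP[y1 y2]; rewrite !ltrD2l y1. Qed.

(** Exhibiting [partial2] as a limit along one fixed sequence of difference quotients yields both
    its measurability in x and its sign; [n.+2] keeps the points strictly inside the range where the
    quotients are controlled. *)
Lemma quotient_cvg x : I x ->
  (D x (t0 + r / n.+2%:R) - D x t0) / (r / n.+2%:R) @[n --> \oo] --> partial2 D x t0.
Proof.
move=> Ix; apply/cvgrPdist_le => e e0.
have Hx1 : 0 < H x + 1 by rewrite ltr_wpDl// H0.
have [b b0 hb] := near0_right (modulus_small alpha0 hzero hpos (divr_gt0 e0 Hx1)).
near=> n.
have n2 : 0 < n.+2%:R :> R by rewrite ltr0n.
have rn0 : 0 < r / n.+2%:R by rewrite divr_gt0.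
have rnr : r / n.+2%:R < r by rewrite ltr_pdivrMr// ltr_pMr// ltr1n.
have nrb : r / b <= n%:R by near: n; exact: nbhs_infty_ger.
have rnb : r / n.+2%:R < b.
  rewrite ltr_pdivrMr// mulrC -ltr_pdivrMr//; apply: le_lt_trans nrb _.
  by rewrite ltr_nat.
rewrite distrC.
have := @hquot x (t0 + r / n.+2%:R) Ix.
rewrite [t0 + _ - t0]addrAC subrr add0r (gtr0_norm rn0) => /(_ _ _)/le_trans; apply.
- by apply: in_range; rewrite gtr0_norm.
- by rewrite -subr_eq0 addrAC subrr add0r gt_eqF.
apply: (@le_trans _ _ (H x * (e / (H x + 1)))).
  by rewrite ler_wpM2l ?H0// hb// rn0.
by rewrite mulrCA -[leRHS]mulr1 ler_pM2l// ler_pdivrMr// mul1r lerDl.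
Unshelve. all: by end_near. Qed.

Lemma measurable_partial2 : measurable_in_first_variable I D ->
  measurable_fun I (fun x => - partial2 D x t0).
Proof.
move=> mD; apply: measurableT_comp => //.
have It y : `|y| < r -> I (t0 + y) by move=> yr; apply: hsub; exact: in_range.
apply: (@measurable_fun_cvg _ _ _ _
  (fun n x => (D x (t0 + r / n.+2%:R) - D x t0) / (r / n.+2%:R))); last exact: quotient_cvg.
move=> n; have rnr : r / n.+2%:R < r.
  by rewrite ltr_pdivrMr// ltr_pMr// ltr1n.
apply: measurable_funM => //; apply: measurable_funB; apply: mD.
  by apply: It; rewrite gtr0_norm// divr_gt0.
by rewrite -[t0]addr0; apply: It; rewrite normr0.
Qed.

Lemma partial2_le0 x : deviation I D -> I x -> partial2 D x t0 <= 0.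
Proof.
move=> [Dlt _ _] Ix; have hc := quotient_cvg Ix.
rewrite -(cvg_lim (@Rhausdorff R) hc); apply: limr_le; first exact: cvgP hc.
near=> n; have n2 : 0 < n.+2%:R :> R by rewrite ltr0n.
have rn0 : 0 < r / n.+2%:R by rewrite divr_gt0.
have rnr : r / n.+2%:R < r by rewrite ltr_pdivrMr// ltr_pMr// ltr1n.
rewrite pmulr_lle0 ?invr_gt0// subr_le0 ltW//; apply: Dlt => //.
- by apply: hsub; rewrite -[X in _ X]addr0; apply: in_range; rewrite normr0.
- by apply: hsub; apply: in_range; rewrite gtr0_norm.
- by rewrite ltrDl.
Unshelve. all: by end_near. Qed.

(** A deterministic statement about one sequence of observations: the almost sure inputs enter as
    hypotheses, so that the exceptional set depends neither on c nor on e. *)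
Lemma sum_deviation_expansion (x : nat -> R) (m A c e : R) :
  (forall k, I (x k)) ->
  (forall eps, 0 < eps -> \forall n \near \oo,
     `|\sum_(0 <= k < n) - partial2 D (x k) t0 - n%:R * m| <= eps * n%:R) ->
  0 <= A -> (\forall n \near \oo, \sum_(0 <= k < n) H (x k) `^ q <= A * n%:R) ->
  c != 0 -> 0 < e ->
  \forall n \near \oo, I (t0 + c * lil_rate R n) /\
    `|\sum_(0 <= k < n) D (x k) (t0 + c * lil_rate R n) - \sum_(0 <= k < n) D (x k) t0 +
      c * m * (n%:R * lil_rate R n)| <= e * (n%:R * lil_rate R n).
Proof.
move=> Ix hm A0 hH c0 e0.
have nc0 : 0 < `|c| by rewrite normr_gt0.
have e1 : 0 < e / (2 * `|c|) by rewrite divr_gt0// mulr_gt0.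
have hq := modulus_exponent alpha0 hzero hpos; have /andP[q0 _] := hq.
near=> n.
have [rt0 _ _] : [/\ 0 < lil_rate R n, n%:R * lil_rate R n <= lil_scale R n
    & lil_scale R n <= (1 + 1) * (n%:R * lil_rate R n)].
  by near: n; exact: lil_rate_bounds.
pose y := c * lil_rate R n.
have y0 : y != 0 by rewrite mulf_neq0// gt_eqF.
have yE : `|y| = `|c| * lil_rate R n by rewrite normrM (gtr0_norm rt0).
have yr : `|y| < r.
  have : lil_rate R n <= r / (2 * `|c|).
    by near: n; apply: lil_rate_small; rewrite divr_gt0// mulr_gt0.
  rewrite yE ler_pdivlMr ?mulr_gt0// mulrCA mulrC [_ * `|c|]mulrC.
  by have := mulr_gt0 nc0 rt0; move: (`|c| * _) => z; move: r0; lra.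
have yI := in_range yr.
split; first exact: hsub.
have hh0 : 0 <= h `|y| by rewrite h0// normr_gt0 y0.
have hmod : h (`|c| * lil_rate R n) * (A * n%:R) `^ q^-1 <= e / (2 * `|c|) * n%:R.
  by near: n; exact: (modulus_rate_small alpha0 hzero hpos).
have hmn : `|\sum_(0 <= k < n) - partial2 D (x k) t0 - n%:R * m| <= e / (2 * `|c|) * n%:R.
  by near: n; exact: hm.
have hHn : \sum_(0 <= k < n) H (x k) `^ q <= A * n%:R by near: n.
have term k : `|D (x k) (t0 + y) - D (x k) t0 - y * partial2 D (x k) t0| <=
    `|y| * h `|y| * H (x k).
  have := @hquot (x k) (t0 + y) (Ix k) yI.
  rewrite [t0 + y - t0]addrAC subrr add0r -subr_eq0 [t0 + y - t0]addrAC subrr add0r => /(_ y0).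
  rewrite -[X in _ -> is_true (_ <= X)]mulrA [h _ * _]mulrC => hk.
  have -> : D (x k) (t0 + y) - D (x k) t0 - y * partial2 D (x k) t0 =
    y * ((D (x k) (t0 + y) - D (x k) t0) / y - partial2 D (x k) t0) by field.
  by rewrite normrM ler_wpM2l.
have -> : \sum_(0 <= k < n) D (x k) (t0 + y) - \sum_(0 <= k < n) D (x k) t0 +
    c * m * (n%:R * lil_rate R n) =
  \sum_(0 <= k < n) (D (x k) (t0 + y) - D (x k) t0 - y * partial2 D (x k) t0) -
    y * (\sum_(0 <= k < n) - partial2 D (x k) t0 - n%:R * m).
  rewrite !sumrB -mulr_sumr sumrN /y.
  by ring.
apply: le_trans (ler_normB _ _) _.
(* One half of e is for the remainder of the difference quotients, the other for the law of large
   numbers for [- partial2]. *)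
have -> : e * (n%:R * lil_rate R n) =
    `|y| * (e / (2 * `|c|) * n%:R) + `|y| * (e / (2 * `|c|) * n%:R).
  by rewrite yE; field; rewrite gt_eqF.
apply: lerD; last by rewrite normrM ler_wpM2l.
apply: le_trans (ler_norm_sum _ _ _) _.
apply: (@le_trans _ _ (\sum_(0 <= k < n) `|y| * h `|y| * H (x k))).
  by apply: ler_sum => k _; exact: term.
rewrite -mulr_sumr -mulrA ler_wpM2l//; apply: le_trans hmod; rewrite -yE ler_wpM2l//.
apply: le_trans (sum_le_sum_powR n hq (fun k => H0 (Ix k))) _.
apply: ge0_ler_powR; rewrite ?invr_ge0 ?(ltW q0) ?nnegrE ?mulr_ge0//.
by apply: sumr_ge0 => k _; exact: powR_ge0.
Unshelve. all: by end_near. Qed.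

End Expansion.

Section Expectations.
Context d (T : measurableType d) (R : realType) (P : probability T R).

Lemma expectation_onE (I : set R) (X : T -> R) (f : R -> R) :
  expectation_on P I X f = (\int[P]_w ((f \_ I) (X w))%:E)%E.
Proof. by rewrite /expectation_on unlock. Qed.

Lemma identically_distributed_in (X : nat -> {RV P >-> R}) (I : set R) :
  identically_distributed X -> measurable I -> P (X 0%N @^-1` I) = 1%E ->
  {ae P, forall w, forall k, I (X k w)}.
Proof.
move=> hident mI hI; apply: ae_foralln => k.
have mk : measurable (X k @^-1` I).
  by rewrite -[_ @^-1` _]setTI; exact: (measurable_funPT (X k)).
exists (~` (X k @^-1` I)); split => //; first exact: measurableC.
apply: etrans (probability_setC P mk) _.
have -> : P (X k @^-1` I) = 1%E by rewrite -hI; exact: (hident k 0%N I mI).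
by rewrite subee.
Qed.

End Expectations.

Theorem theorem5p1 (R : realType) (d : measure_display) (T : measurableType d)
    (P : probability T R) (I : set R) (D : R -> R -> R)
    (xi : nat -> {RV P >-> R}) (t0 : R)
    (hI : nondegenerate_interval I)
    (hD : deviation I D)
    (hindep : independent_RVs xi)
    (hident : identically_distributed xi)
    (h_i : measurable_in_first_variable I D)
    (h_ii_I : P (xi 0%N @^-1` I) = 1%E)
    (h_ii_int : interior_point_condition P I D (xi 0%N))
    (h_t0 : t0 = deviation_mean P I D (xi 0%N))
    (h_iii_diff : differentiable_in_second_variable I D t0)
    (h_iii : exists (r alpha q : R) (H h : R -> R),
       [/\ 0 < r, 0 <= alpha,
           (forall x, I x -> 0 <= H x) /\ measurable_fun I H
         & forall s, 0 < s < r -> 0 <= h s] /\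
       [/\ `]t0 - r, t0 + r[%classic `<=` deviation_domain P I D (xi 0%N),
           forall x t, I x -> t \in `]t0 - r, t0 + r[ -> t != t0 ->
             `|(D x t - D x t0) / (t - t0) - partial2 D x t0|
               <= H x * h `|t - t0|,
           (alpha = 0 ->
             q = 1 /\
             limf_esup (fun s : R => (h s / s `^ alpha)%R%:E) 0^'+ = 0%E),
           (0 < alpha ->
             2 / (2 + alpha) < q < 1 /\
             (limf_esup (fun s : R => (h s / s `^ alpha)%R%:E) 0^'+ < +oo)%E)
         & (expectation_on P I (xi 0%N) (fun x => (H x `^ q)%R) < +oo)%E])
    (h_iv_var :
       (0 < expectation_on P I (xi 0%N) (fun x => (D x t0 ^+ 2)%R) < +oo)%E)
    (h_iv_der :
       (0 < expectation_on P I (xi 0%N) (fun x => (- partial2 D x t0)%R) < +oo)%E) :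
  let Mn (w : T) (n : nat) :=
    sample_deviation_mean I D (fun i : 'I_n => xi i w) in
  let rate (n : nat) : R := Num.sqrt (2 * n%:R^-1 * ln (ln n%:R)) in
  let sigma : R :=
    Num.sqrt (fine (expectation_on P I (xi 0%N) (fun x => (D x t0 ^+ 2)%R))) /
    fine (expectation_on P I (xi 0%N) (fun x => (- partial2 D x t0)%R)) in
  {ae P, forall w,
     limn_esup (fun n => ((Mn w n - t0) / rate n)%:E) = sigma%:E} /\
  {ae P, forall w,
     limn_einf (fun n => ((Mn w n - t0) / rate n)%:E) = (- sigma)%:E}.
Proof.
move=> Mn rate sigma.
have [itvI _] := hI.
have mI : measurable I := is_interval_measurable itvI.
(* t0 is defined by [get]; the existence part of the interior point condition is what makes it a
   deviation mean. *)
have [[It0 _] mean0] : is_deviation_mean P I D (xi 0%N) t0.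
  by rewrite h_t0; apply: getPex; have [] := h_ii_int.
have [r [alpha [q [H [h [[r0 alpha0 [H0 mH] h0] [hsub hquot hzero hpos EH]]]]]]] := h_iii.
have {}hsub : `]t0 - r, t0 + r[%classic `<=` I by move=> t /hsub[].
have aeI := identically_distributed_in hident mI h_ii_I.
pose v := fine (expectation_on P I (xi 0%N) (fun x => (D x t0 ^+ 2)%R)).
pose m := fine (expectation_on P I (xi 0%N) (fun x => (- partial2 D x t0)%R)).
have [vE v0] : expectation_on P I (xi 0%N) (fun x => (D x t0 ^+ 2)%R) = v%:E /\ 0 < v.
  have /andP[a b] := h_iv_var; split; last by rewrite fine_gt0// a b.
  by rewrite fineK// ge0_fin_numE// ltW.
have [mE m0] : expectation_on P I (xi 0%N) (fun x => (- partial2 D x t0)%R) = m%:E /\ 0 < m.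
  have /andP[a b] := h_iv_der; split; last by rewrite fine_gt0// a b.
  by rewrite fineK// ge0_fin_numE// ltW.
have /andP[q0 q1] := modulus_exponent alpha0 hzero hpos.
(* Functions on I are extended by 0, exactly as in [expectation_on], because the limit theorems are
   stated for total functions; almost surely all observations lie in I, where nothing changes. *)
pose g1 := (fun x => D x t0) \_ I.
have mg1 : measurable_fun setT g1 by apply/(measurable_restrictT _ mI); exact: h_i.
have var1 : (\int[P]_w (g1 (xi 0%N w) ^+ 2)%:E)%E = v%:E.
  rewrite -vE expectation_onE; apply: eq_integral => w _; rewrite /g1 !patchE.
  by case: ifP => // _; rewrite expr0n.
have mn1 : (\int[P]_w (g1 (xi 0%N w))%:E)%E = 0%E by rewrite -mean0 expectation_onE.
pose g2 := (fun x => - partial2 D x t0) \_ I.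
have mg2 : measurable_fun setT g2.
  apply/(measurable_restrictT _ mI).
  exact: (measurable_partial2 r0 H0 hsub hquot alpha0 hzero hpos).
have g20 x : 0 <= g2 x.
  rewrite /g2 patchE; case: ifPn => // /set_mem Ix; rewrite oppr_ge0.
  exact: (partial2_le0 r0 H0 hsub hquot alpha0 hzero hpos hD).
pose g3 := (fun x => H x `^ q) \_ I.
have mg3 : measurable_fun setT g3.
  apply/(measurable_restrictT _ mI).
  exact: measurableT_comp (measurable_powR q) mH.
have g30 x : 0 <= g3 x by rewrite /g3 patchE; case: ifPn => // _; exact: powR_ge0.
(* The added 1 keeps the bound strictly positive even if H vanishes at almost every observation. *)
pose nu := fine (expectation_on P I (xi 0%N) (fun x => H x `^ q)) + 1.
have ge3 : (0 <= expectation_on P I (xi 0%N) (fun x => H x `^ q)%R)%E.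
  by rewrite expectation_onE; apply: integral_ge0 => w _; rewrite lee_fin; exact: g30.
have nu0 : 0 < nu by rewrite ltr_wpDl// fine_ge0.
have nuE : (\int[P]_w (g3 (xi 0%N w))%:E <= nu%:E)%E.
  rewrite -expectation_onE /nu EFinD fineK ?ge0_fin_numE//.
  by rewrite leeDl.
have lil1 := scaled_law_of_iterated_logarithm hindep hident mg1 v0 var1 mn1.
(* The lower limit rests on the same law for [- g1], in the form that [root_liminf] takes. *)
have lil2 : {ae P, forall w, forall e : R, 0 < e ->
    (\forall n \near \oo, \sum_(0 <= k < n) - g1 (xi k w) <=
       (1 + e) * (Num.sqrt v * lil_scale R n)) /\
    forall m, exists2 n, (m <= n)%N &
      (1 - e) * (Num.sqrt v * lil_scale R n) <= \sum_(0 <= k < n) - g1 (xi k w)}.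
  apply: (@scaled_law_of_iterated_logarithm _ _ _ _ _ hindep hident (fun x => - g1 x)) => //.
  - exact: measurableT_comp.
  - by rewrite -var1; apply: eq_integral => w _; rewrite sqrrN.
  - under eq_integral do rewrite -mulN1r EFinM.
    by rewrite integralZl ?mn1 ?mule0//; exact: (integrable_of_second_moment mg1 v0).
have slln : {ae P, forall w, forall eps : R, 0 < eps -> \forall n \near \oo,
    `|\sum_(0 <= k < n) g2 (xi k w) - n%:R * m| <= eps * n%:R}.
  by apply: strong_law_nonneg; rewrite // -mE expectation_onE.
have avg := average_bounded hindep hident mg3 g30 nu0 nuE.
have patchI (f : R -> R) w : (forall k, I (xi k w)) -> forall n,
    \sum_(0 <= k < n) (f \_ I) (xi k w) = \sum_(0 <= k < n) f (xi k w).
  by move=> Iw n; apply: eq_bigr => k _; rewrite patchE mem_set.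
have sumg1 w : (forall k, I (xi k w)) -> forall n,
    \sum_(0 <= k < n) g1 (xi k w) = \sum_(i < n) D (xi i w) t0.
  by move=> Iw n; rewrite patchI// big_mkord.
have expan w : (forall k, I (xi k w)) ->
  (forall eps : R, 0 < eps -> \forall n \near \oo,
    `|\sum_(0 <= k < n) g2 (xi k w) - n%:R * m| <= eps * n%:R) ->
  (\forall n \near \oo, \sum_(0 <= k < n) g3 (xi k w) <= 4 * nu * n%:R) ->
  forall c e, c != 0 -> 0 < e -> \forall n \near \oo, I (t0 + c * lil_rate R n) /\
    `|\sum_(i < n) D (xi i w) (t0 + c * lil_rate R n) - \sum_(i < n) D (xi i w) t0 +
      c * m * (n%:R * lil_rate R n)| <= e * (n%:R * lil_rate R n).
  move=> Iw s2 s3 c e c0 e0.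
  have : \forall n \near \oo, I (t0 + c * lil_rate R n) /\
    `|\sum_(0 <= i < n) D (xi i w) (t0 + c * lil_rate R n) - \sum_(0 <= i < n) D (xi i w) t0 +
      c * m * (n%:R * lil_rate R n)| <= e * (n%:R * lil_rate R n).
    apply: (sum_deviation_expansion r0 H0 h0 hsub hquot alpha0 hzero hpos Iw _ _ _ c0 e0).
    - by move=> eps /s2; apply: filterS => n; rewrite patchI.
    - by apply: (@mulr_ge0 _ 4 nu) => //; exact: ltW.
    - by apply: filterS s3 => n; rewrite patchI.
  by apply: filterS => n; rewrite !big_mkord.
have s0 : 0 < Num.sqrt v by rewrite sqrtr_gt0.
split.
- apply: filterS2 (filterI aeI lil1) (filterI slln avg) => w [Iw hl] [s2 s3].
  apply: (@root_limsup _ I (fun n t => \sum_(i < n) D (xi i w) t) (Mn w) t0 _ m) => //.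
  + by move=> n t n0 It; exact: sample_mean_lt.
  + by move=> n t n0 It; exact: sample_mean_gt.
  + exact: expan.
  + move=> e e0; have [h1 h2] := hl e e0; split.
      by apply: filterS h1 => n; rewrite sumg1.
    by move=> k; have [n kn hn] := h2 k; exists n => //; rewrite -sumg1.
- apply: filterS2 (filterI aeI lil2) (filterI slln avg) => w [Iw hl] [s2 s3].
  apply: (@root_liminf _ I (fun n t => \sum_(i < n) D (xi i w) t) (Mn w) t0 _ m) => //.
  + by move=> n t n0 It; exact: sample_mean_lt.
  + by move=> n t n0 It; exact: sample_mean_gt.
  + exact: expan.
  + move=> e e0; have [h1 h2] := hl e e0; split.
      by apply: filterS h1 => n; rewrite sumrN sumg1.
    by move=> k; have [n kn hn] := h2 k; exists n => //; rewrite -sumg1// -sumrN.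
Qed.
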